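(* Let $d\ge 1$ be an integer and $k>0$. For $n\ge 0$ and $1\le m\le \dim\mathscr{Y}_n$, let $\psi_n^m:\mathbb{R}^d\to\mathbb{C}$ be the function $$\psi_n^m(\mathbf r)=\mathrm{J}_{d,n}(k|\mathbf r|)\,Y_n^m(\mathbf r/|\mathbf r|).$$ Then every $\psi_n^m$ belongs to the spherical surface band-limited space $\mathcal{S}_k^{d-1}$, and the family $\{\psi_n^m : n\ge 0,\ 1\le m\le\dim\mathscr{Y}_n\}$ is an orthonormal basis (complete orthonormal system) of the Hilbert space $\mathcal{S}_k^{d-1}$.
   Context: $S^{d-1}$ is the unit sphere in $\mathbb{R}^d$ with its surface measure $\mathrm d\boldsymbol\vartheta$ (counting measure on $\{\pm1\}$ if $d=1$). $\mathscr{Y}_n$ is the complex vector space of spherical harmonics of degree $n$, i.e. restrictions to $S^{d-1}$ of complex-valued homogeneous harmonic polynomials of degree $n$ on $\mathbb{R}^d$, and for each $n$, $\{Y_n^m\}_{1\le m\le\dim\mathscr{Y}_n}$ is an arbitrary fixed basis of $\mathscr{Y}_n$ that is orthonormal for the $L^2(S^{d-1})$ inner product $\int_{S^{d-1}} f\,\overline{g}\,\mathrm d\boldsymbol\vartheta$. For $z>0$, $\mathrm{J}_{d,n}(z):=(2\pi)^{d/2} J_{n+\frac d2-1}(z)/z^{\frac d2-1}$, where $J_\nu$ is the Bessel function of the first kind, and $\mathrm{J}_{d,n}(0)$ is defined by continuous extension; thus $\mathrm{J}_{d,n}(0)=0$ for $n\ge1$, and $\psi_n^m(0)$ is understood as $0$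 for $n\geq 1$ and as $\mathrm{J}_{d,0}(0)$ times the constant value of $Y_0^1$ for $n=0$. The spherical surface band-limited space is $$\mathcal{S}_k^{d-1}:=\Big\{f:\mathbb{R}^d\to\mathbb{C}\ \Big|\ \exists\,\tilde F\in L^2(kS^{d-1}):\ f(\mathbf r)=\int_{S^{d-1}}\tilde F(k\boldsymbol\vartheta)\,e^{\mathrm i k\boldsymbol\vartheta\cdot\mathbf r}\,\mathrm d\boldsymbol\vartheta\ \text{ for all }\mathbf r\in\mathbb{R}^d\Big\},$$ where $\tilde F\in L^2(kS^{d-1})$ means that $\boldsymbol\vartheta\mapsto\tilde F(k\boldsymbol\vartheta)$ is in $L^2(S^{d-1})$ (complex-valued). The function $\tilde F$ is uniquely determined (almost everywhere) by $f$. With $\tilde F,\tilde G$ the functions corresponding to $f,g$, the inner product on $\mathcal{S}_k^{d-1}$ is $$\langle f,g\rangle:=\int_{S^{d-1}}\tilde F(k\boldsymbol\vartheta)\,\overline{\tilde G(k\boldsymbol\vartheta)}\,\mathrm d\boldsymbol\vartheta ,$$ and the norm is the induced one; with it $\mathcal{S}_k^{d-1}$ is a Hilbert space. *)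

(* Defs.v *)
From HB Require Import structures.
From mathcomp Require Import all_boot all_order all_algebra.
(* The notations of mpoly clash with those of MathComp-Analysis. *)
From mathcomp Require Import -(notations) mpoly.
From mathcomp Require Import all_classical all_reals all_analysis.
From mathcomp Require Import measurable_realfun.
From mathcomp Require Import complex.
Set Implicit Arguments.
Unset Strict Implicit.
Unset Printing Implicit Defensive.
Import Order.TTheory GRing.Theory Num.Theory.
Import numFieldNormedType.Exports.
Local Open Scope classical_set_scope.
Local Open Scope ring_scope.

(* The Borel sets of R^d, as the sigma-algebra generated by the coordinates. *)
Section RowVectorMeasurable.
Variables (R : realType) (d : nat).

Definition rV_coord (i : 'I_d) (x : 'rV[R]_d) : measurableTypeR R := x ord0 i.

Let rV_set0 : g_sigma_preimage rV_coord set0.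
Proof. exact: sigma_algebra0. Qed.

Let rV_setC A : g_sigma_preimage rV_coord A -> g_sigma_preimage rV_coord (~` A).
Proof. exact: sigma_algebraC. Qed.

Let rV_bigcup (F : (set 'rV[R]_d)^nat) :
  (forall i, g_sigma_preimage rV_coord (F i)) ->
  g_sigma_preimage rV_coord (\bigcup_i (F i)).
Proof. exact: sigma_algebra_bigcup. Qed.

HB.instance Definition _ := @isMeasurable.Build default_measure_display
  'rV[R]_d (g_sigma_preimage rV_coord) rV_set0 rV_setC rV_bigcup.

End RowVectorMeasurable.

Lemma measurable_rV_coord (R : realType) (d : nat) (i : 'I_d) :
  measurable_fun [set: 'rV[R]_d] (@rV_coord R d i).
Proof.
move=> _ Y mY; rewrite setTI; apply: sub_sigma_algebra => /=.
rewrite -bigcup_seq/=; exists i => /=; first by rewrite mem_index_enum.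
by exists Y => //; rewrite setTI.
Qed.

Lemma measurable_fun_rV (R : realType) (d : nat) disp (T : measurableType disp)
    (f : T -> 'rV[R]_d) :
  (forall i, measurable_fun [set: T] (@rV_coord R d i \o f)) ->
  measurable_fun [set: T] f.
Proof.
move=> mf _ A; rewrite setTI.
suff : measurable `<=` [set A : set 'rV[R]_d | measurable (f @^-1` A)] by exact.
apply: smallest_sub.
  split => /=.
  - by rewrite preimage_set0.
  - by move=> B mB; rewrite setTD preimage_setC; exact: measurableC.
  - by move=> F mF; rewrite preimage_bigcup; exact: bigcup_measurable.
rewrite -bigcup_seq => B [i _] [C mC <-] /=.
by rewrite setTI -comp_preimage -[X in measurable X]setTI; exact: mf.
Qed.

Section LebesgueStep.
Local Open Scope ereal_scope.
Variables (R : realType) (n : nat).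
Variable m : {sigma_finite_measure set 'rV[R]_n -> \bar R}.

Definition rV_cons (p : measurableTypeR R * 'rV[R]_n) : 'rV[R]_n.+1 :=
  row_mx (const_mx p.1 : 'rV[R]_1) p.2.

Definition rV_uncons (x : 'rV[R]_n.+1) : measurableTypeR R * 'rV[R]_n :=
  (x ord0 ord0, rsubmx (x : 'rV[R]_(1 + n))).

Lemma rV_consE (p : measurableTypeR R * 'rV[R]_n) (i : 'I_1 + 'I_n) :
  rV_cons p ord0 (unsplit i) = if i is inr j then p.2 ord0 j else p.1.
Proof.
case: i => j /=.
  exact: (etrans (row_mxEl _ _ _ _) (mxE _ _ _ _)).
exact: row_mxEr.
Qed.

Lemma rV_consK : cancel rV_cons rV_uncons.
Proof.
move=> [a x]; rewrite /rV_uncons; congr pair.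
  apply: etrans (rV_consE (a, x) (inl ord0)).
  by congr (rV_cons _ _ _); exact: val_inj.
exact: row_mxKr.
Qed.

Lemma rV_unconsK : cancel rV_uncons rV_cons.
Proof.
move=> x; apply/rowP => i; rewrite -(@splitK 1 n i) rV_consE.
case: (@fintype.split 1 n i) => j /=; last by rewrite mxE.
by congr (x _ _); apply: val_inj; rewrite /= ord1.
Qed.

Lemma measurable_rV_cons : measurable_fun setT rV_cons.
Proof.
apply: measurable_fun_rV => i.
rewrite -(@splitK 1 n i); case: (@fintype.split 1 n i) => j.
  rewrite (_ : _ \o _ = fst) //.
  by apply/funext => p; exact: (rV_consE p (inl j)).
rewrite (_ : _ \o _ = @rV_coord R n j \o snd).
  by apply: measurableT_comp => //; exact: measurable_rV_coord.
by apply/funext => p; exact: (rV_consE p (inr j)).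
Qed.

Lemma measurable_rV_uncons : measurable_fun setT rV_uncons.
Proof.
apply/measurable_fun_pairP; split; first exact: (measurable_rV_coord ord0).
apply: measurable_fun_rV => i.
rewrite (_ : _ \o _ = @rV_coord R n.+1 (rshift 1 i)).
  exact: measurable_rV_coord.
by apply/funext => x; rewrite /rV_coord /= mxE.
Qed.

Definition lebesgue_rV_step : set 'rV[R]_n.+1 -> \bar R :=
  pushforward (lebesgue_measure \x m) rV_cons.

#[local] Hint Extern 0 (measurable_fun _ rV_cons) =>
  solve [apply: measurable_rV_cons] : core.

Let step0 : lebesgue_rV_step set0 = 0. Proof. exact: measure0. Qed.

Let step_ge0 A : 0 <= lebesgue_rV_step A. Proof. exact: measure_ge0. Qed.

Let step_sigma_additive : semi_sigma_additive lebesgue_rV_step.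
Proof. exact: measure_semi_sigma_additive. Qed.

HB.instance Definition _ := isMeasure.Build _ _ _ lebesgue_rV_step
  step0 step_ge0 step_sigma_additive.

Let step_sigma_finite : sigma_finite setT lebesgue_rV_step.
Proof.
pose l : {sigma_finite_measure set (measurableTypeR R) -> \bar R} :=
  lebesgue_measure.
have /sigma_finiteP[F [FT ndF Foo]] := sigma_finiteT l.
have /sigma_finiteP[G [GT ndG Goo]] := sigma_finiteT m.
exists (fun k => rV_uncons @^-1` (F k `*` G k)) => [|k].
  rewrite -preimage_bigcup (_ : \bigcup_k _ = setT) ?preimage_setT//.
  apply/seteqP; split=> // -[x y] _.
  have [j _ Fjx] : (\bigcup_i F i) x by rewrite -FT.
  have [k _ Gky] : (\bigcup_i G i) y by rewrite -GT.
  exists (maxn j k) => //; split=> /=.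
    by move: x Fjx; exact/subsetPset/ndF/leq_maxl.
  by move: y Gky; exact/subsetPset/ndG/leq_maxr.
have [mF Fy] := Foo k; have [mG Gy] := Goo k; split.
  rewrite -[X in measurable X]setTI; apply: measurable_rV_uncons => //.
  exact: measurableX.
rewrite /lebesgue_rV_step /pushforward -comp_preimage.
rewrite (_ : rV_uncons \o rV_cons = id); last exact/funext/rV_consK.
rewrite preimage_id (product_measure1E l m)//.
by rewrite lte_mul_pinfty// ge0_fin_numE.
Qed.

HB.instance Definition _ := Measure_isSigmaFinite.Build _ _ _ lebesgue_rV_step
  step_sigma_finite.

End LebesgueStep.

Fixpoint lebesgue_rV (R : realType) (n : nat) :
    {sigma_finite_measure set 'rV[R]_n -> \bar R} :=
  match n with
  | 0 => dirac (0 : 'rV[R]_0)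
  | n'.+1 => lebesgue_rV_step (lebesgue_rV R n')
  end.

Section Euclidean.
Variables (R : realType) (d : nat).
Implicit Types x y : 'rV[R]_d.

Definition edot x y : R := \sum_(i < d) x ord0 i * y ord0 i.

(* The library's norm on 'rV[R]_d is the sup norm. *)
Definition enorm x : R := Num.sqrt (edot x x).

Definition unit_sphere : set 'rV[R]_d := [set x | enorm x = 1].

Definition unit_ball : set 'rV[R]_d := [set x | enorm x <= 1].

Definition direction x : 'rV[R]_d := (enorm x)^-1 *: x.

Lemma measurable_enorm : measurable_fun setT enorm.
Proof.
rewrite (_ : enorm = (fun t : R => t `^ 2^-1) \o (fun x => edot x x)).
  apply: measurableT_comp; first exact: measurable_powR.
  apply: measurable_sum => i.
  by apply: measurable_funM; exact: (measurable_rV_coord i).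
apply/funext => x; rewrite /= powR12_sqrt//.
by apply: sumr_ge0 => i _; rewrite -expr2 sqr_ge0.
Qed.

Lemma measurable_unit_ball : measurable unit_ball.
Proof.
rewrite -[X in measurable X]setTI.
by apply: measurable_fun_le => //; exact: measurable_enorm.
Qed.

Lemma measurable_direction : measurable_fun setT direction.
Proof.
apply: measurable_fun_rV => i.
rewrite (_ : _ \o _ = (fun x => enorm x `^ (-1) * x ord0 i)).
  apply: measurable_funM; last exact: (measurable_rV_coord i).
  apply: (measurableT_comp (measurable_powR _)); exact: measurable_enorm.
by apply/funext => x; rewrite /rV_coord /= mxE powR_inv1// sqrtr_ge0.
Qed.

(* The surface measure of A is d times the volume of the part of the unit ball
   in the cone spanned by A. For d = 1 it is the counting measure on {-1, 1}. *)
Definition surface_measure : set 'rV[R]_d -> \bar R :=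
  pushforward (mscale d%:R%:nng (mrestr (lebesgue_rV R d) measurable_unit_ball))
    direction.

#[local] Hint Extern 0 (measurable_fun _ direction) =>
  solve [apply: measurable_direction] : core.

Let surface0 : surface_measure set0 = 0%E. Proof. exact: measure0. Qed.

Let surface_ge0 A : (0 <= surface_measure A)%E. Proof. exact: measure_ge0. Qed.

Let surface_sigma_additive : semi_sigma_additive surface_measure.
Proof. exact: measure_semi_sigma_additive. Qed.

HB.instance Definition _ := isMeasure.Build _ _ _ surface_measure
  surface0 surface_ge0 surface_sigma_additive.

End Euclidean.
Arguments unit_sphere {R d}.
Arguments surface_measure {R d}.

Definition expi (R : realType) (t : R) : R[i] := (cos t +i* sin t)%C.

Section SphereL2.
Variables (R : realType) (d : nat).
Implicit Types F G : 'rV[R]_d -> R[i].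

Definition sphere_int F : R[i] :=
  ((\int[surface_measure]_(x in unit_sphere) complex.Re (F x))
   +i* (\int[surface_measure]_(x in unit_sphere) complex.Im (F x)))%C.

Definition sphere_L2 F : Prop :=
  [/\ measurable_fun unit_sphere (fun x => complex.Re (F x)),
      measurable_fun unit_sphere (fun x => complex.Im (F x)) &
      (\int[surface_measure]_(x in unit_sphere)
         (complex.Re (F x) ^+ 2 + complex.Im (F x) ^+ 2)%:E < +oo)%E].

Definition sphere_dot F G : R[i] := sphere_int (fun x => F x * (G x)^*%C).

End SphereL2.

Section SphericalHarmonics.
Variables (R : realType) (d : nat).

Definition laplacian (p : mpoly d R[i]) : mpoly d R[i] :=
  \sum_(i < d) mderiv i (mderiv i p).

(* Y is a function on the ambient space, but only its values on the unit sphere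
   matter, here and in harmonic_orthonormal_basis. *)
Definition spherical_harmonic (n : nat) (Y : 'rV[R]_d -> R[i]) : Prop :=
  exists p : mpoly d R[i],
    [/\ p \is ishomog1 n mdeg, laplacian p = 0 &
        forall x, unit_sphere x -> Y x = meval (fun i => (x ord0 i)%:C%C) p].

(* By the first three clauses Y is a basis, so N is the dimension of the space of spherical
   harmonics of degree n. *)
Definition harmonic_orthonormal_basis (n N : nat)
    (Y : 'I_N -> 'rV[R]_d -> R[i]) : Prop :=
  [/\ forall m, spherical_harmonic n (Y m),
      forall c : 'I_N -> R[i],
        (forall x, unit_sphere x -> \sum_(m < N) c m * Y m x = 0) ->
        forall m, c m = 0,
      forall H, spherical_harmonic n H ->
        exists c : 'I_N -> R[i],
          forall x, unit_sphere x -> H x = \sum_(m < N) c m * Y m x &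
      forall m m', sphere_dot (Y m) (Y m') = (m == m')%:R].

End SphericalHarmonics.

Section Bessel.
Variable R : realType.
Implicit Types (x z nu : R) (d n : nat).

(* Euler's integral, meaningful for x > 0. *)
Definition gamma x : R :=
  \int[lebesgue_measure]_(t in `]0, +oo[) (t `^ (x - 1) * expR (- t)).

(* The power series of J_nu, for nu > -1 and z > 0. *)
Definition bessel_J nu z : R :=
  \big[+%R/0]_(0 <= m <oo)
    ((-1) ^+ m / (m`!%:R * gamma (m%:R + nu + 1)) * (z / 2) `^ (2 * m%:R + nu)).

Definition sph_bessel_pos d n z : R :=
  (2 * pi) `^ (d%:R / 2) * bessel_J (n%:R + d%:R / 2 - 1) z
  / z `^ (d%:R / 2 - 1).

Definition sph_bessel d n z : R :=
  if z == 0 then lim (sph_bessel_pos d n x @[x --> 0^'+])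
  else sph_bessel_pos d n z.

End Bessel.

Section BandLimited.
Variables (R : realType) (d : nat) (k : R).
Implicit Types f g F : 'rV[R]_d -> R[i].

(* Only the values of F on the sphere of radius k matter. *)
Definition sbl_density f F : Prop :=
  sphere_L2 (fun x => F (k *: x)) /\
  forall r, f r = sphere_int (fun x => F (k *: x) * expi (k * edot x r)).

Definition sbl_space : set ('rV[R]_d -> R[i]) :=
  [set f | exists F, sbl_density f F].

(* The density is unique up to equality almost everywhere, so the choice of a
   representative does not affect sbl_dot. *)
Definition density_of f : 'rV[R]_d -> R[i] :=
  xget (fun=> 0) [set F | sbl_density f F].

Definition sbl_dot f g : R[i] :=
  sphere_dot (fun x => density_of f (k *: x)) (fun x => density_of g (k *: x)).

Definition sbl_norm f : R := Num.sqrt (complex.Re (sbl_dot f f)).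

(* An orthonormal family of elements of the space whose finite linear
   combinations are dense. *)
Definition sbl_orthonormal_basis (I : eqType)
    (psi : I -> 'rV[R]_d -> R[i]) : Prop :=
  [/\ forall i, sbl_space (psi i),
      forall i j, sbl_dot (psi i) (psi j) = (i == j)%:R &
      forall f, sbl_space f -> forall e : R, 0 < e ->
        exists (s : seq I) (c : I -> R[i]),
          sbl_norm (fun r => f r - \sum_(i <- s) c i * psi i r) < e].

(* A point of the unit sphere when 0 < d. *)
Definition base_point : 'rV[R]_d := \row_i (i == 0 :> nat)%:R.

(* Y is constant on the unit sphere when n = 0. *)
Definition psi_fun (n : nat) (Y : 'rV[R]_d -> R[i]) (r : 'rV[R]_d) : R[i] :=
  if r == 0 then
    if n == 0 then (sph_bessel d 0 0)%:C%C * Y base_point else 0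
  else (sph_bessel d n (k * enorm r))%:C%C * Y (direction r).

End BandLimited.

(* Main.v *)
(** By the Funk-Hecke formula, [\int_S Y(x) e^(i k x.r) dx] equals
    [i^n J_(d,n)(k|r|) Y(r/|r|)] for a spherical harmonic [Y] of degree [n], so
    [psi_n^m] has density [(-i)^n Y_n^m], and the inner product of two elements of
    the space is that of their densities. It remains to see that the [Y_n^m] form
    an orthonormal basis of L2 of the sphere and that the density is unique.

    In polar coordinates the integral of a homogeneous polynomial over the sphere
    is, up to a value of the gamma function, its integral against [e^(-|x|^2)].
    For the latter, integration by parts trades a polynomial for its Laplacian;
    applied to [p q] and to [p (x.r)^j] with [p], [q] harmonic this gives
    the orthogonality of distinct degrees and, after expansion of the exponential,
    the Funk-Hecke formula.

    Every homogeneous polynomial is on the sphere a sum of spherical harmonics, and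
    polynomials are dense in L2: the measurable sets whose indicators are limits of
    polynomials with values in [[0, 1]] form a sigma-algebra containing the
    half-spaces [x_i < a]. Finally, a density orthogonal to all plane waves is, by
    differentiation in [r], orthogonal to all polynomials, hence zero. *)

Require Import Defs.
From HB Require Import structures.
From mathcomp Require Import all_boot all_order all_algebra.
From mathcomp Require Import -(notations) mpoly.
From mathcomp Require Import finmap.
From mathcomp Require Import all_classical all_reals all_analysis.
From mathcomp Require Import measurable_realfun gauss_integral.
From mathcomp Require Import complex.
From mathcomp Require Import ssrcomplements bigenough zify ring lra.
Set Implicit Arguments.
Unset Strict Implicit.
Unset Printing Implicit Defensive.
Import Order.TTheory GRing.Theory Num.Theory.
Import numFieldNormedType.Exports.
Import BigEnough.
Local Open Scope classical_set_scope.
Local Open Scope ring_scope.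

(** * Harmonic polynomials *)

(** The surface measure is an image of Lebesgue measure on the ball, so every statement about it is
    drawn from integrals over R^d. The Gaussian weight is convenient because its integrals split
    into one-dimensional moments [g n] with [n g(n-1) = 2 g(n+1)]. Integration by parts thereby
    becomes an algebraic identity, [gfun (lap p) = 2 n gfun p] for [p] homogeneous of degree [n],
    and orthogonality as well as the moments of plane waves follow by induction on degrees.

    A spherical moment of degree [a] is the Gaussian one times [2 / Gamma((a+d)/2)]. For a harmonic
    [p] of degree [n] against the power [(x.r)^(n+2s)], this gamma value is the one in the s-th term
    of the series of J_(n+d/2-1); the two series agree term by term, with their gamma values left
    unevaluated.

    The inner product of the space is computed from densities selected by a choice operator. It can
    be evaluated on a known density only after densities are shown to be unique up to functions of
    zero L2 norm, so uniqueness enters the orthonormality as well as the completeness. *)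

Section Harmonic.
Variables (F : numFieldType) (d : nat).
Implicit Types (p q : mpoly d F) (m : multinom d).

(** Convertible to [laplacian] when [F] is [R[i]]; the algebra of this section holds over any
    numeric field. *)
Definition lap p : mpoly d F := \sum_(i < d) mderiv i (mderiv i p).

Lemma lap_is_linear : linear lap.
Proof.
move=> c p q; rewrite /lap scaler_sumr -big_split /=.
by apply: eq_bigr => i _; rewrite !linearP.
Qed.

HB.instance Definition _ :=
  GRing.isLinear.Build F (mpoly d F) (mpoly d F) _ lap lap_is_linear.

Definition hom n p := p \is ishomog1 n mdeg.

Lemma homP n p : reflect {in msupp p, forall m, mdeg m = n} (hom n p).
Proof. exact: dhomogP. Qed.

Lemma hom0 n : hom n 0. Proof. exact: dhomog0. Qed.
Lemma homZ n c p : hom n p -> hom n (c *: p).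
Proof. exact: dhomogZ. Qed.
Lemma homB n p q : hom n p -> hom n q -> hom n (p - q).
Proof. by move=> hp hq; apply: rpredB. Qed.
Lemma hom_sum n (I : finType) (f : I -> mpoly d F) :
  (forall i, hom n (f i)) -> hom n (\sum_i f i).
Proof. by move=> h; apply: rpred_sum => i _; exact: h. Qed.
Lemma homM n k p q : hom n p -> hom k q -> hom (n + k) (p * q).
Proof. exact: dhomogM. Qed.
Lemma homX n p k : hom n p -> hom (n * k) (p ^+ k).
Proof. exact: dhomogMn. Qed.
Lemma homXU (i : 'I_d) : hom 1 (mpolyX F (mnm1 i)).
Proof. by rewrite /hom dhomogX /= mdeg1. Qed.

Lemma hom_deriv n i p : hom n.+1 p -> hom n (mderiv i p).
Proof.
move=> /homP hp; rewrite /hom /mderiv big_seq; apply: rpred_sum => m mp.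
have [->|mi0] := eqVneq (m i) 0%N; first by rewrite mul0r scale0r rpred0.
apply: rpredZ; rewrite dhomogX /=.
have := hp _ mp; have le1 : mpoly.lem (mnm1 i) m by rewrite lep1mP.
by rewrite -{1}(submK le1) mdegD mdeg1 addn1 => -[->].
Qed.

Lemma hom_lap n p : hom n.+2 p -> hom n (lap p).
Proof. by move=> hp; apply: hom_sum => i; do 2 apply: hom_deriv. Qed.

Lemma hom0_const p : hom 0 p -> p = mpolyC d (mcoeff mnm0 p).
Proof.
move=> hp; apply/mpolyP => m; rewrite mcoeffC.
have [->|m0] := eqVneq m mnm0; first by rewrite mulr1.
by rewrite mulr0; apply: (dhomog_nemf_coeff hp); rewrite /= mdeg_eq0.
Qed.

Lemma deriv_hom0 i p : hom 0 p -> mderiv i p = 0.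
Proof. by move=> /hom0_const ->; rewrite mderivC. Qed.

Lemma lap_hom0 p : hom 0 p -> lap p = 0.
Proof. by move=> hp; rewrite /lap big1 // => i _; rewrite (deriv_hom0 _ hp) raddf0. Qed.

Lemma lap_hom1 p : hom 1 p -> lap p = 0.
Proof. by move=> hp; rewrite /lap big1 // => i _; rewrite deriv_hom0 //; exact: hom_deriv. Qed.

Lemma lap_deriv i p : lap (mderiv i p) = mderiv i (lap p).
Proof.
rewrite /lap linear_sum; apply: eq_bigr => j _ /=.
by rewrite [mderiv j (mderiv i p)]mderiv_comm mderiv_comm.
Qed.

Lemma lapM p q :
  lap (p * q) = lap p * q + (\sum_i mderiv i p * mderiv i q) *+ 2 + p * lap q.
Proof.
rewrite /lap mulr_suml mulr_sumr -sumrMnl -!big_split /=; apply: eq_bigr => i _.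
by rewrite !mderivM mderivD !mderivM; ring.
Qed.

Lemma mderivXn i p n : mderiv i (p ^+ n) = n%:R *: (mderiv i p * p ^+ n.-1).
Proof.
elim: n => [|n IH]; first by rewrite scale0r expr0 -[1]/(mpolyC d 1) mderivC.
rewrite exprS mderivM IH /=; case: n {IH} => [|n] /=.
  by rewrite scale0r mulr0 addr0 scale1r.
by rewrite -[in RHS]natr1 scalerDl scale1r addrC -scalerAr mulrCA -exprS.
Qed.

Lemma mderivXU (i j : 'I_d) : mderiv i (mpolyX F (mnm1 j)) = (i == j)%:R.
Proof.
rewrite mderivX mnm1E eq_sym; have [->|_] := eqVneq i j; last by rewrite scale0r.
by rewrite scale1r (_ : mnm_sub _ _ = mnm0) ?mpolyX0//; apply/mnmP => k; rewrite mnmBE subnn mnm0E.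
Qed.

Definition linform (r : 'I_d -> F) : mpoly d F := \sum_j r j *: mpolyX F (mnm1 j).

Lemma hom_linform r : hom 1 (linform r).
Proof. by apply: hom_sum => i; apply/homZ/homXU. Qed.

Lemma deriv_linform i r : mderiv i (linform r) = mpolyC d (r i).
Proof.
rewrite linear_sum /= (bigD1 i) //= big1 => [|j ji].
  by rewrite linearZ /= mderivXU eqxx addr0 -mul_mpolyC mulr1.
by rewrite linearZ /= mderivXU eq_sym (negbTE ji) scaler0.
Qed.

Lemma lap_linformX r n :
  lap (linform r ^+ n) = (n * n.-1)%:R * (\sum_i r i ^+ 2) *: linform r ^+ n.-2.
Proof.
rewrite /lap mulr_sumr scaler_suml; apply: eq_bigr => i _.
rewrite mderivXn deriv_linform mderivZ mul_mpolyC mderivZ mderivXn deriv_linform mul_mpolyC.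
by rewrite !scalerA natrM; congr (_ *: _); ring.
Qed.

Definition dderiv (r : 'I_d -> F) p : mpoly d F := \sum_i r i *: mderiv i p.

Lemma hom_dderiv n r p : hom n.+1 p -> hom n (dderiv r p).
Proof. by move=> hp; apply: hom_sum => i; apply/homZ/hom_deriv. Qed.

Lemma lap_dderiv r p : lap p = 0 -> lap (dderiv r p) = 0.
Proof.
move=> hp; rewrite linear_sum big1 // => i _.
by rewrite linearZ /= lap_deriv hp mderiv0 scaler0.
Qed.

Lemma euler_mon m i : mpolyX F (mnm1 i) * mderiv i (mpolyX F m) = (m i)%:R *: mpolyX F m.
Proof.
rewrite mderivX -scalerAr -mpolyXD.
have [->|mi0] := eqVneq (m i) 0%N; first by rewrite !scale0r.
by rewrite addmC submK // lep1mP.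
Qed.

(** The operator [x_i d/dx_i] multiplies a monomial by its i-th exponent, and the exponents add up
    to the degree. *)
Lemma euler n p : hom n p -> \sum_i mpolyX F (mnm1 i) * mderiv i p = n%:R *: p.
Proof.
move=> /homP hp; rewrite {2}[p]mpolyE scaler_sumr.
have E i : mderiv i p = \sum_(m <- msupp p) mcoeff m p *: mderiv i (mpolyX F m).
  by rewrite [in LHS](mpolyE p) linear_sum; apply: eq_bigr => m _; rewrite linearZ.
under eq_bigr do rewrite E mulr_sumr.
rewrite exchange_big /= big_seq [RHS]big_seq; apply: eq_bigr => m mp.
under eq_bigr do rewrite -scalerAr euler_mon scalerA.
rewrite -scaler_suml -mulr_sumr scalerA mulrC -natr_sum; congr (_%:R * _ *: _).
by rewrite -mdegE hp.
Qed.

(** Euler's identity read at the point [r] itself. *)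
Lemma meval_dderiv n r p : hom n p -> meval r (dderiv r p) = n%:R * meval r p.
Proof.
move=> hp; rewrite -mevalZ -(euler hp) /dderiv !raddf_sum; apply: eq_bigr => i _ /=.
by rewrite mevalZ mevalM mevalXU.
Qed.

(** * Gaussian moments of harmonic polynomials, as pure algebra *)

Section Moment.
Variable g : nat -> F.
(** The recursion satisfied by the moments of e^(-x^2); at [n = 0] it says that [g 1] vanishes. *)
Hypothesis hg : forall n, n%:R * g n.-1 = 2 * g n.+1.

(* When [g n] is the integral of [x^n e^(-x^2)], [gfun p] is that of [p e^(-|x|^2)]. *)
Definition gmon m : F := \prod_i g (m i).
Definition gfun p : F := \sum_(m <- msupp p) mcoeff m p * gmon m.

Lemma gfun_is_linear : linear_for *%R gfun.
Proof.
(* The supports of [p], [q] and their combination differ, so all three sums are extended to the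
   multi-indices of degree below a common bound. *)
have E p k : (mmeasure mdeg p <= k)%N ->
    gfun p = \sum_(m : bmultinom d k) mcoeff m p * gmon m.
  move=> le; set I : subFinType _ := bmultinom d k.
  rewrite /gfun (big_mksub I) ?msupp_uniq //=; last first.
    by move=> x /msize_mdeg_lt /leq_trans; apply.
  rewrite big_rmcond //= => j /memN_msupp_eq0 ->; exact: mul0r.
move=> c p q /=; pose_big_enough k.
  rewrite !(E _ k) // mulr_sumr -big_split /=; apply: eq_bigr => m _.
  by rewrite mcoeffD mcoeffZ; ring.
by close.
Qed.

HB.instance Definition _ :=
  GRing.isLinear.Build F (mpoly d F) F _ gfun gfun_is_linear.

Lemma gfunX m : gfun (mpolyX F m) = gmon m.
Proof. by rewrite /gfun msuppX big_seq1 mcoeffX eqxx mul1r. Qed.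

Lemma gfunC c : gfun (mpolyC d c) = c * g 0 ^+ d.
Proof.
rewrite (_ : mpolyC d c = c *: mpolyX F mnm0); last first.
  by rewrite mpolyX0 -mul_mpolyC mulr1.
rewrite linearZ /= gfunX; congr (_ * _).
by rewrite /gmon; under eq_bigr do rewrite mnm0E; rewrite prodr_const card_ord.
Qed.

(** The second derivative in the i-th variable produces [m_i (m_i - 1) g (m_i - 2)], which is
    [2 m_i g (m_i)] by [hg]. *)
Lemma gfun_lap_mon m : gfun (lap (mpolyX F m)) = 2 * (mdeg m)%:R * gmon m.
Proof.
rewrite mdegE natr_sum mulr_sumr mulr_suml linear_sum; apply: eq_bigr => i _ /=.
rewrite mderivX linearZ /= mderivX !linearZ /= gfunX mnmBE mnm1E eqxx subn1.
rewrite {1}/gmon (bigD1 i) //= [gmon m](bigD1 i) //= !mnmBE mnm1E eqxx !subn1.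
have [->|mi0] := eqVneq (m i) 0%N; first by rewrite !mul0r mulr0 mul0r.
rewrite -{5}[m i]prednK ?lt0n // !mulrA [2 * _ * _]mulrAC -hg; congr (_ * _); last first.
  by apply: eq_bigr => j ji; rewrite !mnmBE mnm1E eq_sym (negbTE ji) !subn0.
by ring.
Qed.

(** In terms of integrals: moving one of each pair of derivatives onto the weight e^(-|x|^2) leaves
    twice the sum of the [x_i d_i p], which is [2 n p] by Euler's identity. *)
Lemma gfun_lap n p : hom n p -> gfun (lap p) = 2 * n%:R * gfun p.
Proof.
move=> /homP hp; rewrite [in LHS](mpolyE p) [gfun p]/gfun mulr_sumr.
rewrite [lap _]linear_sum [LHS]linear_sum /=.
rewrite big_seq [RHS]big_seq; apply: eq_bigr => m mp.
by rewrite 2!linearZ /= gfun_lap_mon hp //; ring.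
Qed.

(** For harmonic factors [lap (p * q)] is twice the sum of products of first derivatives. These are
    again harmonic of distinct degrees, so induction makes [gfun] vanish on them, and [gfun_lap]
    gives [gfun (p * q) = 0] because [n + k] is positive. *)
Lemma gfun_orth n k p q : hom n p -> hom k q -> lap p = 0 -> lap q = 0 ->
  n != k -> gfun (p * q) = 0.
Proof.
elim: n k p q => [|n IH] k p q hp hq lp lq nk.
  have /eqP := gfun_lap (homM hp hq).
  rewrite lapM lp lq mul0r mulr0 addr0 add0r big1 => [|i _]; last first.
    by rewrite (deriv_hom0 _ hp) mul0r.
  by rewrite mul0rn raddf0 eq_sym !mulf_eq0 !pnatr_eq0 add0n [k == _]eq_sym (negbTE nk) => /eqP.
have /eqP := gfun_lap (homM hp hq).
rewrite lapM lp lq mul0r mulr0 addr0 add0r raddfMn raddf_sum big1 => [|i _]; last first.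
  case: k hq nk => [hq _|k hq nk]; first by rewrite (deriv_hom0 _ hq) mulr0 raddf0.
  apply: (IH k) => //; rewrite ?lap_deriv ?lp ?lq ?mderiv0//; exact: hom_deriv.
by rewrite mul0rn eq_sym !mulf_eq0 !pnatr_eq0 /= => /eqP.
Qed.

(** This is [gfun_lap] for the product: the cross term differentiates [p] along [r], and the
    Laplacian of the power lowers its exponent by two. *)
Lemma gfun_step n j r p : hom n p -> lap p = 0 ->
  2 * (n + j)%:R * gfun (p * linform r ^+ j) =
  2 * j%:R * gfun (dderiv r p * linform r ^+ j.-1)
  + (j * j.-1)%:R * (\sum_i r i ^+ 2) * gfun (p * linform r ^+ j.-2).
Proof.
move=> hp lp; rewrite -(gfun_lap (n := n + j)); last first.
  by apply: homM => //; rewrite -[X in hom X]mul1n; apply/homX/hom_linform.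
rewrite lapM lp mul0r add0r lap_linformX -scalerAr linearD linearZ /=; congr (_ + _).
rewrite raddfMn /= -[RHS]mulrA -[X in _ = _ * X]linearZ [RHS]mulr_natl /=; congr (gfun _ *+ 2).
rewrite /dderiv mulr_suml scaler_sumr; apply: eq_bigr => i _.
by rewrite mderivXn deriv_linform mul_mpolyC -scalerAr -scalerAr -scalerAl.
Qed.

(** [gfun_step] leads from [(n, j)] to [(n - 1, j - 1)] and [(n, j - 2)]. Both moves keep the
    inequality [j < n] and the parity of [n + j], and the terms that would leave the range are
    zero. *)
Lemma gfun_linform0 n j r p : hom n p -> lap p = 0 -> (j < n)%N || odd (n + j) ->
  gfun (p * linform r ^+ j) = 0.
Proof.
elim/ltn_ind: j n p => j IH n p hp lp c.
have nj0 : (n + j)%:R != 0 :> F by rewrite pnatr_eq0; case: j n c {IH hp} => [|j] [|n].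
have /eqP := gfun_step j r hp lp.
rewrite [X in _ + X](_ : _ = 0) ?addr0; last first.
  case: j c {nj0} IH => [|[|j]] c IH; rewrite ?muln0 ?mul0n ?mul0r //.
  rewrite (IH j _ n p hp lp) ?mulr0 //; move: c; rewrite !addnS /= negbK.
  by case/orP => [/ltnW/ltnW ->|->] //; rewrite orbT.
rewrite [X in _ == X](_ : _ = 0); last first.
  case: j c IH {nj0} => [|j] c IH; first by rewrite mulr0 mul0r.
  case: n hp c => [hp c|n hp c].
    by rewrite /dderiv big1 ?mul0r ?raddf0 ?mulr0// => i _; rewrite deriv_hom0 ?scaler0.
  rewrite (IH j _ n _ (hom_dderiv r hp) (lap_dderiv r lp)) ?mulr0 //.
  by move: c; rewrite ltnS addSn addnS /= negbK.
by rewrite !mulf_eq0 pnatr_eq0 (negbTE nj0) /= => /eqP.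
Qed.

(** Each use of [gfun_step] lowers [n] or [s] by one, and derivatives along [r] reproduce the value
    at [r] by [meval_dderiv]. The two terms are the shares [n/(n+s)] and [s/(n+s)] of the right-hand
    side; they are [T1] and [T2] below. *)
Lemma gfun_linform n s r p : hom n p -> lap p = 0 ->
  gfun (p * linform r ^+ (n + s.*2)) =
  (n + s.*2)`!%:R / (2 ^+ n * 4 ^+ s * s`!%:R) * g 0 ^+ d
  * (\sum_i r i ^+ 2) ^+ s * meval r p.
Proof.
move: {2}(n + s)%N (leqnn (n + s)) => N; elim: N n s p => [|N IH] n s p.
  rewrite leqn0 addn_eq0 => /andP[/eqP-> /eqP->] hp _.
  rewrite (hom0_const hp) mevalC addn0 !expr0 mulr1 gfunC fact0 !mulr1 divr1 mul1r mulrC.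
  by [].
move=> le hp lp; have [ns0|ns0] := eqVneq (n + s.*2)%N 0%N.
  have /eqP := ns0; rewrite addn_eq0 double_eq0 => /andP[/eqP n0 /eqP s0].
  by apply: IH; rewrite // n0 s0.
have nz : (2 * (n + (n + s.*2)))%:R != 0 :> F.
  by rewrite pnatr_eq0 muln_eq0 /= addn_eq0 negb_and ns0 orbT.
apply: (mulfI nz); rewrite natrM gfun_step //.
have T1 : (n + s.*2)%:R * gfun (dderiv r p * linform r ^+ (n + s.*2).-1) =
  n%:R * 2 * ((n + s.*2)`!%:R / (2 ^+ n * 4 ^+ s * s`!%:R) * g 0 ^+ d
  * (\sum_i r i ^+ 2) ^+ s * meval r p).
  case: n hp le {ns0 nz} => [|n] hp le.
    rewrite !mul0r /dderiv big1 ?mul0r ?raddf0 ?mulr0// => i _.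
    by rewrite deriv_hom0 ?scaler0.
  rewrite addSn /= IH //; [|exact: hom_dderiv|exact: lap_dderiv].
  rewrite (meval_dderiv _ hp) factS natrM exprS; field.
  by rewrite !expf_neq0 ?pnatr_eq0 -?lt0n ?fact_gt0.
have T2 : ((n + s.*2) * (n + s.*2).-1)%:R * (\sum_i r i ^+ 2) *
    gfun (p * linform r ^+ (n + s.*2).-2) =
  s%:R * 4 * ((n + s.*2)`!%:R / (2 ^+ n * 4 ^+ s * s`!%:R) * g 0 ^+ d
  * (\sum_i r i ^+ 2) ^+ s * meval r p).
  case: s le {ns0 nz T1} => [|s] le; last first.
    rewrite doubleS !addnS /= IH ?leq_addnS//; last by rewrite addnS in le.
    rewrite !factS !natrM !exprS; field.
    by rewrite nat1r !expf_neq0 ?pnatr_eq0 -?lt0n ?fact_gt0.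
  rewrite !mul0r addn0; case: n hp le => [|[|n]] hp le; rewrite ?muln0 ?mul0n ?mul0r //.
  (* Here [s = 0], and the exponent [n - 2] of the linear form lies below the degree of [p]. *)
  by rewrite /= (gfun_linform0 _ hp lp) ?mulr0 // ltnS leqnSn.
rewrite -[2 * _ * gfun (dderiv _ _ * _)]mulrA T1 T2.
by move: (_ / _ * _ * _ * _) => X; rewrite -addnn !natrD; ring.
Qed.

End Moment.

(** * Decomposition of homogeneous polynomials into harmonic ones *)

Definition sqn : mpoly d F := \sum_i mpolyX F (mnm1 i) ^+ 2.

Lemma hom_sqn : hom 2 sqn.
Proof. by apply: hom_sum => i; rewrite -[2%N]mul1n; apply/homX/homXU. Qed.

Lemma deriv_sqn (i : 'I_d) : mderiv i sqn = 2 *: mpolyX F (mnm1 i).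
Proof.
rewrite linear_sum /= (bigD1 i) //= big1 => [|j ji].
  by rewrite mderivXn mderivXU eqxx addr0 mul1r expr1.
by rewrite mderivXn mderivXU eq_sym (negbTE ji) mul0r scaler0.
Qed.

Lemma deriv_sqnX (i : 'I_d) j :
  mderiv i (sqn ^+ j) = (2 * j)%:R *: (mpolyX F (mnm1 i) * sqn ^+ j.-1).
Proof. by rewrite mderivXn deriv_sqn -scalerAl scalerA natrM [2 * _]mulrC. Qed.

Lemma lap_sqnX j :
  lap (sqn ^+ j.+1) = (2 * j.+1 * (2 * j + d))%:R *: sqn ^+ j.
Proof.
rewrite /lap.
under eq_bigr do rewrite deriv_sqnX mderivZ mderivM mderivXU eqxx mul1r deriv_sqnX
  -scalerAr mulrA -expr2.
rewrite -scaler_sumr big_split /= sumr_const card_ord -scaler_sumr -mulr_suml -/sqn.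
case: j => [|j]; first by rewrite muln0 scale0r addr0 add0n -[_ *+ d]scaler_nat scalerA -natrM.
by rewrite -exprS -[_ *+ d]scaler_nat -scalerDl scalerA -natrD -natrM addnC.
Qed.

(** The cross term of the product rule is a multiple of the sum of the [x_i d_i p], hence of [p] by
    [euler]. *)
Lemma lap_sqnM j n p : hom n p ->
  lap (sqn ^+ j.+1 * p) =
  (2 * j.+1 * (2 * j + d + 2 * n))%:R *: (sqn ^+ j * p) + sqn ^+ j.+1 * lap p.
Proof.
move=> hp; rewrite lapM lap_sqnX; congr (_ + _).
under eq_bigr do rewrite deriv_sqnX /= -scalerAl mulrAC.
rewrite -scaler_sumr -mulr_suml (euler hp) -[_ *+ 2]scaler_nat -!scalerAl !scalerA.
rewrite [p * _]mulrC -scalerDl -!natrM -natrD; congr (_%:R *: _).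
lia.
Qed.

Hypothesis d_gt0 : (0 < d)%N.

(* Surjectivity of [q |-> lap (sqn * q)]: by [lap_sqnM] the equation is solved up to
   a term with [lap p] in place of [p]. *)
Lemma lap_sqn_onto n j p : hom n p ->
  exists2 q, hom (2 * j + n) q & lap (sqn * q) = sqn ^+ j * p.
Proof.
elim/ltn_ind: n j p => n IH j p hp.
have [q hq E] : exists2 q, hom (2 * j + n) q & lap (sqn * q) = sqn ^+ j.+1 * lap p.
  case: n hp IH => [|[|n]] hp IH.
  - by exists 0; rewrite ?mulr0 ?linear0 ?(lap_hom0 hp) ?mulr0//; exact: hom0.
  - by exists 0; rewrite ?mulr0 ?linear0 ?(lap_hom1 hp) ?mulr0//; exact: hom0.
  have [//|q hq E] := IH n _ j.+1 _ (hom_lap hp).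
  by exists q => //; move: hq; rewrite mulnS add2n !addSn !addnS.
(* Positivity of [d] is what keeps this factor nonzero when [j = n = 0]. *)
have c0 : (2 * j.+1 * (2 * j + d + 2 * n))%:R != 0 :> F.
  rewrite pnatr_eq0 -lt0n !muln_gt0 /= addn_gt0 addn_gt0 d_gt0 orbT; done.
exists ((2 * j.+1 * (2 * j + d + 2 * n))%:R^-1 *: (sqn ^+ j * p - q)).
  by apply/homZ/homB => //; apply: homM => //; apply/homX/hom_sqn.
rewrite -scalerAr linearZ /= mulrBr linearB /= mulrA -exprS (lap_sqnM _ hp) E addrK.
by rewrite scalerA mulVf // scale1r.
Qed.

(** Choosing [q] with [lap (sqn * q) = lap p] makes the remainder harmonic. On the sphere [sqn] is
    1, so iteration exhibits [p] there as a sum of spherical harmonics of degrees [n + 2], [n],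
    [n - 2] and so on. *)
Lemma harmonic_decomp n p : hom n.+2 p ->
  exists h q, [/\ hom n.+2 h, lap h = 0, hom n q & p = h + sqn * q].
Proof.
move=> hp; have [q hq E] := lap_sqn_onto 0 (hom_lap hp).
exists (p - sqn * q), q; split=> //; last by rewrite subrK.
  by apply: homB => //; rewrite -add2n; apply: homM => //; exact: hom_sqn.
by rewrite linearB /= E expr0 mul1r subrr.
Qed.

End Harmonic.

(** * Polar coordinates *)

Section Scaling.
Variable R : realType.
Local Open Scope ereal_scope.
Local Notation mu := (@lebesgue_measure R).

(** Lebesgue measure is determined by its values on half-open intervals, and there it agrees with
    [s] times its image under [x -> s x]. *)
Lemma ge0_integral_lebesgue_scale (s : R) (f : R -> \bar R) : (0 < s)%R ->
  measurable_fun setT f -> (forall x, 0 <= f x) ->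
  \int[mu]_x f (s * x)%R = (s^-1)%:E * \int[mu]_x f x.
Proof.
move=> s0 mf f0.
have ms : measurable_fun setT ((fun x => s * x)%R : R -> measurableTypeR R).
  exact: measurable_funM.
have si0 : (0 <= s^-1)%R by rewrite invr_ge0 ltW.
have E A : measurable A -> mu A = mscale (NngNum (ltW s0))
    (pushforward mu ((fun x => s * x)%R : R -> measurableTypeR R)) A.
  move=> mA; apply: lebesgue_measure_unique => //= _ [[a b]] _ <-.
  rewrite /mscale/= /pushforward.
  rewrite [X in _ * mu X](_ : _ = `](s^-1 * a)%R, (s^-1 * b)%R]%classic); last first.
    by apply/seteqP; split => x /=; rewrite !in_itv/= ltr_pdivrMl// ler_pdivlMl.
  rewrite !lebesgue_measure_itv/= !lte_fin ltr_pM2l ?invr_gt0//.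
  case: ifPn => _; last by rewrite mule0.
  by rewrite -!EFinB -EFinM -mulrBr mulVKf// gt_eqF.
rewrite (@eq_measure_integral _ _ _ setT _ mu f (fun A mA _ => E ms A mA)).
rewrite ge0_integral_mscale// ge0_integral_pushforward//.
by rewrite /= muleA -EFinM mulVf ?mul1e// gt_eqF.
Qed.

Lemma ge0_integral_rVS n (f : 'rV[R]_n.+1 -> \bar R) :
  measurable_fun setT f -> (forall x, 0 <= f x) ->
  \int[lebesgue_rV R n.+1]_x f x =
  \int[mu]_a \int[lebesgue_rV R n]_y f (rV_cons (a, y)).
Proof.
move=> mf f0.
rewrite (ge0_integral_pushforward (@measurable_rV_cons R n))//.
rewrite preimage_setT fubini_tonelli1//.
  by apply: measurableT_comp => //; exact: measurable_rV_cons.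
by move=> x; exact: f0.
Qed.

Lemma rV_consZ n (s : R) (p : R * 'rV[R]_n) :
  (s *: rV_cons p)%R = rV_cons (s * p.1, s *: p.2)%R.
Proof.
apply/rowP => i; rewrite [LHS]mxE -(@splitK 1 n i) !rV_consE.
by case: (@fintype.split 1 n i) => j //=; rewrite mxE.
Qed.

Lemma measurable_rV_scale n (s : R) : measurable_fun setT (fun x : 'rV[R]_n => s *: x)%R.
Proof.
apply: measurable_fun_rV => i; rewrite (_ : _ \o _ = fun x => s * rV_coord i x)%R.
  by apply: measurable_funM => //; exact: measurable_rV_coord.
by apply/funext => x; rewrite /rV_coord/= mxE.
Qed.

Lemma measurable_fun_rV_cons_integral n (f : 'rV[R]_n.+1 -> \bar R) :
  measurable_fun setT f -> (forall x, 0 <= f x) ->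
  measurable_fun setT (fun a : R => \int[lebesgue_rV R n]_y f (rV_cons (a, y))).
Proof.
move=> mf f0; apply: (measurable_fun_fubini_tonelli_F (f \o @rV_cons R n)) => //.
  by apply: measurableT_comp => //; exact: measurable_rV_cons.
by move=> x; exact: f0.
Qed.

Lemma ge0_integral_rV_scale n (s : R) (f : 'rV[R]_n -> \bar R) : (0 < s)%R ->
  measurable_fun setT f -> (forall x, 0 <= f x) ->
  \int[lebesgue_rV R n]_x f (s *: x)%R =
  (s^-1 ^+ n)%:E * \int[lebesgue_rV R n]_x f x.
Proof.
move=> s0; elim: n f => [|n IH] f mf f0.
  rewrite expr0 mul1e; apply: eq_integral => x _; congr f.
  by apply/rowP => -[].
have mfs : measurable_fun setT (fun x : 'rV[R]_n.+1 => f (s *: x)%R).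
  by apply: measurableT_comp => //; exact: measurable_rV_scale.
rewrite !ge0_integral_rVS//.
under eq_integral => a _.
  under eq_integral do rewrite rV_consZ/=.
  rewrite (IH (fun y => f (rV_cons (s * a, y)%R)))//; last first.
    apply: measurableT_comp => //; apply: measurableT_comp.
      exact: measurable_rV_cons.
    exact: measurable_fun_pair.
  over.
have sn0 : (0 <= s^-1 ^+ n)%R by rewrite exprn_ge0// invr_ge0 ltW.
have mI := measurable_fun_rV_cons_integral mf f0.
have -> : \int[mu]_a ((s^-1 ^+ n)%:E * \int[lebesgue_rV R n]_y f (rV_cons (s * a, y)%R)) =
    (s^-1 ^+ n)%:E * \int[mu]_a (\int[lebesgue_rV R n]_y f (rV_cons (s * a, y)%R)).
  apply: ge0_integralZl => //.
  - by apply: measurableT_comp mI _; exact: measurable_funM.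
  - by move=> a _; apply: integral_ge0.
rewrite (ge0_integral_lebesgue_scale (f := fun a => \int[lebesgue_rV R n]_y f (rV_cons (a, y))))//.
  by rewrite muleA -EFinM exprSr.
by move=> a; apply: integral_ge0.
Qed.

End Scaling.

(** * Euclidean norm, directions and the unit sphere *)

Section Euclid.
Variables (R : realType) (d : nat).
Implicit Types x y : 'rV[R]_d.

Lemma edot_ge0 x : 0 <= edot x x.
Proof. by apply: sumr_ge0 => i _; rewrite -expr2 sqr_ge0. Qed.

Lemma enorm_ge0 x : 0 <= enorm x. Proof. exact: sqrtr_ge0. Qed.

Lemma sqr_enorm x : enorm x ^+ 2 = edot x x.
Proof. by rewrite sqr_sqrtr ?edot_ge0. Qed.

Lemma edotZl s x y : edot (s *: x) y = s * edot x y.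
Proof. by rewrite mulr_sumr; apply: eq_bigr => i _; rewrite mxE mulrA. Qed.

Lemma edotZr s x y : edot x (s *: y) = s * edot x y.
Proof. by rewrite mulr_sumr; apply: eq_bigr => i _; rewrite mxE mulrCA. Qed.

Lemma enormZ s x : enorm (s *: x) = `|s| * enorm x.
Proof. by rewrite /enorm edotZl edotZr mulrA -expr2 sqrtrM ?sqr_ge0// sqrtr_sqr. Qed.

Lemma enorm_eq0 x : (enorm x == 0) = (x == 0).
Proof.
rewrite sqrtr_eq0 le_eqVlt ltNge edot_ge0 orbF psumr_eq0; last first.
  by move=> i _; rewrite -expr2 sqr_ge0.
apply/allP/eqP => [h|-> i _]; last by rewrite mxE mul0r eqxx.
by apply/rowP => i; rewrite mxE; have := h i (mem_index_enum _); rewrite -expr2 sqrf_eq0 => /eqP.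
Qed.

Lemma enorm0 : enorm (0 : 'rV[R]_d) = 0.
Proof. by apply/eqP; rewrite enorm_eq0. Qed.

Lemma enorm_gt0 x : (0 < enorm x) = (x != 0).
Proof. by rewrite lt_neqAle enorm_ge0 andbT eq_sym enorm_eq0. Qed.

Lemma direction0 : direction (0 : 'rV[R]_d) = 0.
Proof. by rewrite /direction scaler0. Qed.

Lemma directionZ s x : 0 < s -> direction (s *: x) = direction x.
Proof.
move=> s0; rewrite /direction enormZ gtr0_norm// invfM scalerA mulrAC mulVf ?mul1r//.
by rewrite gt_eqF.
Qed.

Lemma enormK x : enorm x *: direction x = x.
Proof.
have [->|x0] := eqVneq x 0; first by rewrite direction0 scaler0.
by rewrite scalerA mulfV ?scale1r// enorm_eq0.
Qed.

Lemma enorm_direction x : x != 0 -> enorm (direction x) = 1.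
Proof.
move=> x0; rewrite enormZ ger0_norm ?invr_ge0 ?enorm_ge0// mulVf//.
by rewrite enorm_eq0.
Qed.

Lemma unit_sphere_direction x : x != 0 -> unit_sphere (direction x).
Proof. exact: enorm_direction. Qed.

Lemma measurable_unit_sphere : measurable (@unit_sphere R d).
Proof.
rewrite (_ : unit_sphere = @enorm R d @^-1` [set 1])//.
by rewrite -[X in measurable X]setTI; apply: measurable_enorm.
Qed.

Lemma unit_sphereN0 : ~ unit_sphere (0 : 'rV[R]_d).
Proof. by rewrite /unit_sphere/= enorm0 => /esym/eqP; rewrite oner_eq0. Qed.

Lemma unit_sphere_coord x i : unit_sphere x -> `|x ord0 i| <= 1.
Proof.
rewrite /unit_sphere/= => x1.
rewrite -(@ler_pXn2r _ 2)// ?nnegrE// expr1n real_normK ?num_real//.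
rewrite -[leRHS](expr1n _ 2) -x1 sqr_enorm /edot (bigD1 i)//= -expr2 lerDl.
by apply: sumr_ge0 => j _; rewrite -expr2 sqr_ge0.
Qed.

Lemma cauchy_schwarz x y : `|edot x y| <= enorm x * enorm y.
Proof.
have [->|x0] := eqVneq x 0.
  by rewrite /edot big1 ?normr0 ?mulr_ge0 ?enorm_ge0// => i _; rewrite mxE mul0r.
rewrite -(@ler_pXn2r _ 2)// ?nnegrE ?mulr_ge0 ?enorm_ge0// real_normK ?num_real//.
rewrite exprMn !sqr_enorm.
have xx0 : 0 < edot x x by rewrite -sqr_enorm exprn_gt0// enorm_gt0.
have edotDl a b c : edot (a + b) c = edot a c + edot b c.
  by rewrite -big_split; apply: eq_bigr => i _; rewrite mxE mulrDl.
have edotC a b : edot a b = edot b a by apply: eq_bigr => i _; rewrite mulrC.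
(* The squared norm of this vector is <x,x> (<x,x><y,y> - <x,y>^2). *)
have := edot_ge0 (edot x x *: y + (- edot x y) *: x).
rewrite edotDl [edot (_ *: y) _]edotC [edot (_ *: x) _]edotC !edotDl.
rewrite !(edotZl, edotZr) [edot y x]edotC => h.
have : 0 <= edot x x * (edot x x * edot y y - edot x y ^+ 2) by lra.
by rewrite pmulr_rge0// subr_ge0.
Qed.

End Euclid.

Section RestrIntegral.
Local Open Scope ereal_scope.

Lemma ge0_integral_mrestr d (T : measurableType d) (R : realType)
    (m : {measure set T -> \bar R}) (B : set T) (mB : measurable B) (f : T -> \bar R) :
  measurable_fun setT f -> (forall x, 0 <= f x) ->
  \int[mrestr m mB]_x f x = \int[m]_(x in B) f x.
Proof.
move=> mf f0; rewrite -{1}(setUv B) ge0_integral_setU//=; last 3 first.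
- exact: measurableC.
- by rewrite setUv.
- exact/disj_setPCl.
rewrite [X in _ + X]null_set_integral ?adde0.
- by apply: eq_measure_integral => A mA AB; rewrite -[LHS]/(m (A `&` B)) setIidl.
- exact: measurableC.
- exact: measurable_funTS.
- by rewrite -[LHS]/(m (~` B `&` B)) setICl measure0.
Qed.
End RestrIntegral.

Section PowTail.
Variable R : realType.

Lemma powRN_cvg0 (a : R) : 0 < a -> x `^ (- a) @[x --> +oo] --> (0 : R).
Proof.
move=> a0; apply/cvgrPdist_lt => e e0; near=> x.
have x0 : 0 < x by near: x; exact: nbhs_pinfty_gt.
rewrite sub0r normrN ger0_norm ?powR_ge0// powRN invf_plt ?posrE ?powR_gt0//.
have : e^-1 `^ a^-1 < x by near: x; exact: nbhs_pinfty_gt.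
move=> /(gt0_ltr_powR a0) h; have := h _ _; rewrite -powRrM mulVf ?gt_eqF// powRr1; last first.
  by rewrite invr_ge0 ltW.
by apply; rewrite nnegrE ?powR_ge0// ltW.
Unshelve. all: by end_near. Qed.

Lemma integral_powR_tail (a : R) : 0 < a ->
  (\int[lebesgue_measure]_(x in `[1%R, +oo[) (x `^ (- a - 1))%:E = (a^-1)%:E)%E.
Proof.
move=> a0.
rewrite (@ge0_continuous_FTC2y _ _ (fun x => - a^-1 * x `^ (- a)) _ 0).
- by rewrite powR1 mulr1 sub0e -EFinN opprK.
- by move=> x _; exact: powR_ge0.
- apply: derivable_within_continuous => x; rewrite in_itv/= andbT => x1.
  by apply: derivable_powR; rewrite in_itv/= andbT (lt_le_trans _ x1).
- by rewrite -[X in _ --> X](mulr0 (- a^-1)); apply: cvgMl_tmp; exact: powRN_cvg0.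
- move=> x x1; apply: derivableM => //.
  by apply: derivable_powR; rewrite in_itv/= andbT (lt_trans _ x1).
- apply: cvgMl_tmp; apply: cvg_at_right_filter.
  have : {for 1, continuous (fun x : R => x `^ (- a))}.
    apply/differentiable_continuous/derivable1_diffP.
    by apply: derivable_powR; rewrite in_itv/= andbT.
  exact.
- move=> x; rewrite in_itv/= andbT => x1; rewrite derive1Ml; last first.
    by apply: derivable_powR; rewrite in_itv/= andbT (lt_trans _ x1).
  rewrite powR_derive1 ?in_itv/= ?andbT ?(lt_trans _ x1)//.
  by rewrite mulrA mulrNN mulVf ?mul1r// gt_eqF.
Qed.
End PowTail.

Section Polar.
Variables (R : realType) (d : nat).
Hypothesis d_gt0 : (0 < d)%N.
Local Notation mu := (@lebesgue_measure R).
Local Notation lam := (lebesgue_rV R d).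

Lemma ge0_integral_surface (g : 'rV[R]_d -> \bar R) :
  measurable_fun setT g -> (forall x, 0 <= g x)%E ->
  (\int[surface_measure]_x g x =
   d%:R%:E * \int[lam]_(x in @unit_ball R d) g (direction x))%E.
Proof.
move=> mg g0; rewrite (ge0_integral_pushforward (@measurable_direction R d))//.
have mgd : measurable_fun setT (g \o @direction R d).
  by apply: measurableT_comp => //; exact: measurable_direction.
rewrite preimage_setT ge0_integral_mscale//; last by move=> x _; exact: g0.
rewrite ge0_integral_mrestr//.
by move=> x; exact: g0.
Qed.

Let hd : R := d%:R / 2.


Let hd_gt0 : 0 < hd. Proof. by rewrite divr_gt0 ?ltr0n. Qed.

Let sqrtX (s : R) : 0 < s -> (Num.sqrt s)^-1 ^+ d = s `^ (- hd).
Proof.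
move=> s0; rewrite -powR12_sqrt ?ltW// -(powR_inv1 (powR_ge0 _ _)) -powRrM.
by rewrite -powR_mulrn ?powR_ge0// -powRrM; congr (_ `^ _); rewrite /hd; field.
Qed.

Variables (g : 'rV[R]_d -> R) (u : R -> R).
Hypotheses (mg : measurable_fun setT g) (g_ge0 : forall x, 0 <= g x) (g0 : g 0 = 0).
Hypotheses (mu_ : measurable_fun setT u) (u_ge0 : forall t, 0 <= u t).

(** The measure ds/s is invariant under dilations, so the substitution [t = s |x|^2] affects only
    the cut-off: [s >= 1] becomes [|x|^2 <= t]. This puts [x / sqrt t] in the unit ball, over which
    the surface measure is defined. *)
Let V (s : R) : R := if 1 <= s then s `^ (-1) else 0.
Let W (c t : R) : R := if (0 < t) && (c <= t) then t `^ (-1) else 0.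
Let sq (x : 'rV[R]_d) : R := enorm x ^+ 2.

Let Phi (p : 'rV[R]_d * measurableTypeR R) : R :=
  g (direction p.1) * u (p.2 * sq p.1) * V p.2.
Let Psi (p : 'rV[R]_d * measurableTypeR R) : R :=
  g (direction p.1) * u p.2 * W (sq p.1) p.2.

Let V_ge0 s : 0 <= V s. Proof. by rewrite /V; case: ifP => // _; exact: powR_ge0. Qed.
Let W_ge0 c s : 0 <= W c s. Proof. by rewrite /W; case: ifP => // _; exact: powR_ge0. Qed.

Let mV : measurable_fun setT V.
Proof.
apply: measurable_fun_ifT => //.
exact: measurable_fun_ler.
Qed.

Let msq : measurable_fun setT sq.
Proof. by apply: measurable_funX; exact: measurable_enorm. Qed.

Let mgd : measurable_fun setT (fun x => g (direction x)).
Proof. by apply: measurableT_comp => //; exact: measurable_direction. Qed.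

Let mPhi : measurable_fun setT Phi.
Proof.
apply: measurable_funM; last exact: (measurableT_comp mV measurable_snd).
apply: measurable_funM; first exact: (measurableT_comp mgd measurable_fst).
apply: (measurableT_comp mu_); apply: measurable_funM => //.
exact: (measurableT_comp msq measurable_fst).
Qed.

Let mPsi : measurable_fun setT Psi.
Proof.
apply: measurable_funM; last first.
  apply: measurable_fun_ifT => //; last first.
    exact: (measurableT_comp (@measurable_powR R _) measurable_snd).
  apply: measurable_and; first exact: measurable_fun_ltr.
  by apply: measurable_fun_ler => //; exact: (measurableT_comp msq measurable_fst).
apply: measurable_funM; first exact: (measurableT_comp mgd measurable_fst).
exact: (measurableT_comp mu_ measurable_snd).
Qed.

Let Phi_ge0 p : (0 <= (Phi p)%:E)%E.
Proof. by rewrite lee_fin /Phi !mulr_ge0. Qed.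
Let Psi_ge0 p : (0 <= (Psi p)%:E)%E.
Proof. by rewrite lee_fin /Psi !mulr_ge0. Qed.

Let A := (\int[lam]_x (g (direction x) * u (sq x))%:E)%E.
Let B := (\int[lam]_(x in @unit_ball R d) (g (direction x))%:E)%E.

Let sq_scale s x : 0 < s -> sq (Num.sqrt s *: x) = s * sq x.
Proof.
by move=> s0; rewrite /sq enormZ exprMn real_normK ?num_real// sqr_sqrtr// ltW.
Qed.

(** Rescaling [x] by [sqrt s] contributes the factor s^(-d/2). *)
Let A_inner s : (\int[lam]_x (Phi (x, s))%:E =
  (if (1 <= s)%R then s `^ (- hd - 1) else 0)%:E * A)%E.
Proof.
rewrite /Phi /V /=; case: ifPn => s1; last first.
  by under eq_integral do rewrite mulr0; rewrite integral0 mul0e.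
have s0 : 0 < s by exact: lt_le_trans s1.
have mf : measurable_fun setT (fun x => (g (direction x) * u (sq x))%:E).
  by apply/measurable_EFinP; apply: measurable_funM => //; exact: measurableT_comp.
have -> : (fun x => (g (direction x) * u (s * sq x) * s `^ (-1))%:E) =
  (fun x => (s `^ (-1))%:E * (g (direction (Num.sqrt s *: x)) * u (sq (Num.sqrt s *: x)))%:E)%E.
  by apply/funext => x; rewrite directionZ ?sqrtr_gt0// sq_scale// -EFinM mulrC.
rewrite ge0_integralZl//; last 3 first.
- by apply: (measurableT_comp mf); exact: measurable_rV_scale.
- by move=> x _; rewrite lee_fin mulr_ge0.
- by rewrite lee_fin powR_ge0.
rewrite (@ge0_integral_rV_scale R d (Num.sqrt s)
  (fun x => (g (direction x) * u (sq x))%:E)) ?sqrtr_gt0//; last first.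
  by move=> x; rewrite lee_fin mulr_ge0.
rewrite muleA -EFinM sqrtX// -powRD; last by rewrite (gt_eqF s0)/= implybT.
by rewrite addrC.
Qed.

Let A_total : (\int[mu]_s \int[lam]_x (Phi (x, s))%:E = hd^-1%:E * A)%E.
Proof.
have A0 : (0 <= A)%E by apply: integral_ge0 => x _; rewrite lee_fin mulr_ge0.
under eq_integral do rewrite A_inner.
rewrite ge0_integralZr//; last 2 first.
- apply/measurable_EFinP; apply: measurable_fun_ifT => //.
  exact: measurable_fun_ler.
- by move=> s _; rewrite lee_fin; case: ifP => // _; exact: powR_ge0.
rewrite -integral_powR_tail// [in RHS]integral_mkcond; congr (_ * _)%E.
apply: eq_integral => s _; rewrite patchE.
rewrite (_ : (s \in _) = (1 <= s)); first by case: ifP.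
by apply/idP/idP; rewrite inE/= in_itv/= andbT.
Qed.

(** The region [|x|^2 <= t] is the unit ball enlarged by [sqrt t], and [g (direction x)] ignores the
    dilation; hence the factor t^(d/2). *)
Let B_inner t : (\int[lam]_x (Psi (x, t))%:E =
  (if (0 < t)%R then u t * t `^ (hd - 1) else 0)%:E * B)%E.
Proof.
rewrite /Psi /W /=; case: ifPn => t0 /=; last first.
  by under eq_integral do rewrite mulr0; rewrite integral0 mul0e.
pose H x : \bar R := ((g (direction x))%:E * (\1_(@unit_ball R d) x)%:E)%E.
have mH : measurable_fun setT H.
  apply: emeasurable_funM; first exact/measurable_EFinP.
  by apply/measurable_EFinP; apply: measurable_indic; exact: measurable_unit_ball.
have H0 x : (0 <= H x)%E by rewrite mule_ge0// lee_fin.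
have st : 0 < Num.sqrt t^-1 by rewrite sqrtr_gt0 invr_gt0.
have Eb x : (Num.sqrt t^-1 *: x \in @unit_ball R d) = (sq x <= t).
  have -> : (sq x <= t) = (enorm (Num.sqrt t^-1 *: x) <= 1).
    rewrite -[in RHS](@ler_pXn2r _ 2)// ?nnegrE ?enorm_ge0//.
    by rewrite -/(sq _) sq_scale ?invr_gt0// expr1n ler_pdivrMl// mulr1.
  by apply/idP/idP; rewrite inE.
have -> : (fun x => (g (direction x) * u t * (if sq x <= t then t `^ (-1) else 0))%:E) =
  (fun x => (u t * t `^ (-1))%:E * H (Num.sqrt t^-1 *: x))%E.
  apply/funext => x; rewrite /H directionZ// -!EFinM indicE Eb.
  by case: ifP => _ /=; congr EFin; ring.
rewrite ge0_integralZl//; last 2 first.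
- by apply: (measurableT_comp mH); exact: measurable_rV_scale.
- by rewrite lee_fin mulr_ge0// powR_ge0.
rewrite (@ge0_integral_rV_scale R d _ H)// muleA -EFinM sqrtX ?invr_gt0//.
rewrite -powR_inv1 ?ltW// -powRrM mulN1r opprK -mulrA -powRD ?(gt_eqF t0)/= ?implybT//.
rewrite addrC; congr (_ * _)%E.
rewrite /H /B; under [in LHS]eq_integral do rewrite muleC.
rewrite [in RHS]integral_mkcond; apply: eq_integral => x _.
by rewrite patchE indicE; case: ifP => _; rewrite ?mul1e ?mul0e.
Qed.

Let B_total : (\int[mu]_t \int[lam]_x (Psi (x, t))%:E =
  \int[mu]_(t in `]0%R, +oo[) (u t * t `^ (hd - 1))%:E * B)%E.
Proof.
have B0 : (0 <= B)%E by apply: integral_ge0 => x _; rewrite lee_fin.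
under eq_integral do rewrite B_inner.
rewrite ge0_integralZr//; last 2 first.
- apply/measurable_EFinP; apply: measurable_fun_ifT => //.
    exact: measurable_fun_ltr.
  by apply: measurable_funM => //; exact: measurable_powR.
- by move=> s _; rewrite lee_fin; case: ifP => // _; rewrite mulr_ge0// powR_ge0.
rewrite [in RHS]integral_mkcond; congr (_ * _)%E.
apply: eq_integral => s _; rewrite patchE.
rewrite (_ : (s \in _) = (0 < s)); first by case: ifP.
by apply/idP/idP; rewrite inE/= in_itv/= andbT.
Qed.

Let PhiPsi x : (\int[mu]_s (Phi (x, s))%:E = \int[mu]_s (Psi (x, s))%:E)%E.
Proof.
have [->|x0] := eqVneq x 0.
  by apply: eq_integral => s _; rewrite /Phi /Psi /= direction0 g0 !mul0r.
have c0 : 0 < sq x by rewrite exprn_gt0// enorm_gt0.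
set c := sq x in c0.
pose F t := (g (direction x) * u t * V (c^-1 * t))%:E.
have mF : measurable_fun setT F.
  apply/measurable_EFinP; apply: measurable_funM; first exact: measurable_funM.
  by apply: (measurableT_comp mV); exact: measurable_funM.
have F0 t : (0 <= F t)%E by rewrite lee_fin !mulr_ge0.
transitivity (\int[mu]_s F (c * s)%R)%E.
  apply: eq_integral => s _; rewrite /Phi /F /= -/c [s * c]mulrC mulKf//.
  by rewrite gt_eqF.
have ci0 : 0 <= c^-1 by rewrite invr_ge0 ltW.
rewrite ge0_integral_lebesgue_scale// -ge0_integralZl//.
apply: eq_integral => t _; rewrite /F /Psi /V /W /= -/c -EFinM; congr EFin.
rewrite mulrCA; congr (_ * _).
rewrite ler_pdivlMl// mulr1; case: ifPn => [ct|]; last by rewrite andbF mulr0.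
have t0 : 0 < t by exact: lt_le_trans ct.
rewrite t0/= !powR_inv1 ?mulr_ge0// ?(ltW t0)//. rewrite [(_ * t)^-1]invfM invrK mulKf//.
by rewrite gt_eqF.
Qed.

(* [\int u(s|x|^2) g(x/|x|) 1_(s >= 1) dx ds/s] is computed twice: by scaling [x] for
   fixed [s], and by substituting [t = s|x|^2] for fixed [x]. *)
Lemma polar_integral :
  (\int[lam]_x (g (direction x) * u (enorm x ^+ 2))%:E =
   (2^-1)%:E * (\int[mu]_(t in `]0%R, +oo[) (u t * t `^ (d%:R / 2 - 1))%:E
     * \int[surface_measure]_x (g x)%:E))%E.
Proof.
have E : (hd^-1%:E * A = \int[mu]_(t in `]0%R, +oo[) (u t * t `^ (hd - 1))%:E * B)%E.
  rewrite -A_total -B_total.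
  have mEPhi : measurable_fun setT (EFin \o Phi) by exact/measurable_EFinP.
  have mEPsi : measurable_fun setT (EFin \o Psi) by exact/measurable_EFinP.
  rewrite -(fubini_tonelli _ mEPhi Phi_ge0) -(fubini_tonelli _ mEPsi Psi_ge0).
  by apply: eq_integral => x _; exact: PhiPsi.
rewrite ge0_integral_surface; [|exact/measurable_EFinP|by move=> x; rewrite lee_fin].
rewrite [X in (_ * X)%E]muleCA -/B -/hd -E muleA muleA -!EFinM -/A.
by rewrite (_ : _ * _ = 1) ?mul1e// /hd; field; rewrite pnatr_eq0 -lt0n.
Qed.

End Polar.

(** * Moments of the sphere *)

Section GaussMoment.
Variable R : realType.
Local Notation mu := (@lebesgue_measure R).
Implicit Types (x : R) (n : nat).

Definition gauss_mon n x : R := x ^+ n * gauss_fun x.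

Lemma exprn_le_expR n (y : R) : 0 <= y -> y ^+ n <= n`!%:R * expR y.
Proof.
move=> y0; case: n => [|n].
  by rewrite expr0 fact0 mul1r -expR0 ler_expR.
have := expR_ge1Dxn n y0; rewrite -ler_pdivrMl ?ltr0n ?fact_gt0//.
by apply: le_trans; rewrite mulrC lerDr.
Qed.

(** Half of the exponent absorbs the power. With [y = x^2/2], one has |x|^n <= 1 + (x^2)^n = 1 + 2^n
    y^n and y^n <= n! e^y, which is where the constant comes from. *)
Lemma gauss_mon_bound n : exists2 C : R, 0 < C &
  forall x, `|gauss_mon n x| <= C * gauss_fun ((Num.sqrt 2)^-1 * x).
Proof.
exists (1 + 2 ^+ n * n`!%:R) => [|x].
  by rewrite ltr_pwDl// mulr_ge0// exprn_ge0.
rewrite normrM [X in _ * X]ger0_norm ?gauss_fun_ge0//.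
rewrite /gauss_fun exprMn exprVn sqr_sqrtr//.
set y := 2^-1 * x ^+ 2.
have y0 : 0 <= y by rewrite mulr_ge0 ?invr_ge0// sqr_ge0.
have -> : expR (- x ^+ 2) = expR (- y) * expR (- y).
  by rewrite -expRD; congr expR; rewrite /y; field.
rewrite mulrA ler_wpM2r ?expR_ge0// expRN ler_pdivrMr ?expR_gt0//.
apply: (@le_trans _ _ (1 + x ^+ 2 ^+ n)).
  rewrite normrX -(real_normK (num_real x)) -exprM mulnC exprM.
  set t := `|x| ^+ n; have t0 : 0 <= t by rewrite exprn_ge0.
  by have := sqr_ge0 (t - 1); nra.
rewrite mulrDl mul1r lerD//; first by rewrite -expR0 ler_expR.
have -> : x ^+ 2 = 2 * y by rewrite /y mulrA mulfV ?mul1r.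
by rewrite exprMn -mulrA ler_wpM2l ?exprn_ge0// exprn_le_expR.
Qed.

Lemma measurable_gauss_mon n : measurable_fun setT (gauss_mon n).
Proof. by apply: measurable_funM => //; exact: measurable_gauss_fun. Qed.

Lemma integrable_gauss_mon n : mu.-integrable setT (EFin \o gauss_mon n).
Proof.
have [C C0 hC] := gauss_mon_bound n.
have s0 : 0 < (Num.sqrt 2 : R)^-1 by rewrite invr_gt0 sqrtr_gt0.
have mg : measurable_fun setT (fun x : R => (gauss_fun ((Num.sqrt 2)^-1 * x))%:E).
  apply/measurable_EFinP; apply: (measurableT_comp measurable_gauss_fun).
  exact: measurable_funM.
apply: (@le_integrable _ _ _ mu setT _ _
  (fun x => C%:E * (gauss_fun ((Num.sqrt 2)^-1 * x))%:E)%E) => //.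
- by apply/measurable_EFinP; exact: measurable_gauss_mon. 
- move=> x _; rewrite /= lee_fin (le_trans (hC x))// [leRHS]ger0_norm//.
  by rewrite mulr_ge0 ?gauss_fun_ge0// ltW.
apply: integrableZl => //; apply/integrableP; split => //.
under eq_integral do rewrite gee0_abs ?lee_fin ?gauss_fun_ge0//.
rewrite (ge0_integral_lebesgue_scale (f := fun x => (gauss_fun x)%:E))//.
- by rewrite integralT_gauss -EFinM ltry.
- by apply/measurable_EFinP; exact: measurable_gauss_fun.
- by move=> x; rewrite lee_fin gauss_fun_ge0.
Qed.

Definition gmom n : R := \int[mu]_x gauss_mon n x.

Lemma gmomE n : (\int[mu]_x (gauss_mon n x)%:E = (gmom n)%:E)%E.
Proof. by rewrite fineK//; apply: integrable_fin_num => //; exact: integrable_gauss_mon. Qed.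

Lemma gmom0 : gmom 0 = Num.sqrt pi.
Proof.
rewrite /gmom /Rintegral -[RHS]/(fine (Num.sqrt pi)%:E) -integralT_gauss.
by congr fine; apply: eq_integral => x _; rewrite /gauss_mon expr0 mul1r.
Qed.

(** The bound for the exponent [n + 1] yields decay like [C / |x|]; the signs [s = 1] and [s = -1]
    serve the two ends of a growing interval. *)
Lemma gauss_mon_cvg0 n (s : R) : `|s| = 1 ->
  gauss_mon n (s * m%:R) @[m --> \oo] --> (0 : R).
Proof.
move=> s1; have [C C0 hC] := gauss_mon_bound n.+1.
(* The doubling converts [1/m] to the harmonic sequence [1/(m+1)], since 1/m <= 2/(m+1) for positive
   [m]. *)
apply/norm_cvg0P; apply: (@squeeze_cvgr _ _ _ _ (cst 0) (fun m => C * m.+1%:R^-1 *+ 2)).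
- near=> m; rewrite normr_ge0/=.
  have m0 : 0 < (m%:R : R) by rewrite ltr0n; near: m; exact: nbhs_infty_gt.
  have nm : `|s * m%:R| = m%:R by rewrite normrM s1 mul1r normr_nat.
  have h : `|gauss_mon n (s * m%:R)| <= C / m%:R.
    rewrite ler_pdivlMr// -[in X in _ * X]nm -normrM.
    have -> : gauss_mon n (s * m%:R) * (s * m%:R) = gauss_mon n.+1 (s * m%:R).
      by rewrite /gauss_mon exprSr mulrAC.
    by rewrite (le_trans (hC _))// ler_piMr ?gauss_fun_le1// ltW.
  rewrite (le_trans h)// -[leRHS]mulr_natr -[leRHS]mulrA ler_wpM2l ?(ltW C0)//.
  rewrite mulrC ler_pdivlMr// mulrC ler_pdivrMr// -natrM ler_nat.
  have : (0 < m)%N by rewrite -(ltr0n R).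
  by lia.
- exact: cvg_cst.
- rewrite -(mul0rn _ 2); apply: cvgMn; rewrite -[X in _ --> X](mulr0 C); apply: cvgMl_tmp.
  exact: cvg_harmonic.
Unshelve. all: by end_near. Qed.

Lemma is_derive_gauss_mon n x : is_derive x 1 (gauss_mon n)
  (n%:R * gauss_mon n.-1 x - 2 * gauss_mon n.+1 x).
Proof.
rewrite /gauss_mon /gauss_fun.
have : is_derive x 1 (fun x => x ^+ n * expR (- x ^+ 2))
   (x ^+ n *: ((- (2 * x)) *: expR (- x ^+ 2)) + expR (- x ^+ 2) *: (n%:R * x ^+ n.-1)).
  apply: is_deriveM.
    rewrite (_ : (fun x => x ^+ n) = (id : R -> R) ^+ n); last first.
      by apply/funext => y; rewrite exprfctE.
    by apply: is_derive_eq; rewrite /GRing.scale/=; ring.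
  by apply: is_derive_eq; rewrite /GRing.scale/=; ring.
by move=> [d1 d2]; apply: DeriveDef => //; rewrite d2 /GRing.scale/= [x ^+ n.+1]exprS; ring.
Qed.

(* The derivative of [x^n e^(-x^2)] has integral zero. *)
Lemma gmom_rec n : n%:R * gmom n.-1 = 2 * gmom n.+1.
Proof.
pose h x := n%:R * gauss_mon n.-1 x - 2 * gauss_mon n.+1 x.
have iZ (c : R) k : mu.-integrable setT (EFin \o (fun x => c * gauss_mon k x)).
  have := @integrableZl _ _ _ mu setT measurableT c _ (integrable_gauss_mon k).
  by apply: eq_integrable => // x _; rewrite /= EFinM.
have ih : mu.-integrable setT (EFin \o h).
  have := @integrableB _ _ _ mu setT measurableT _ _ (iZ n%:R n.-1) (iZ 2 n.+1).
  by apply: eq_integrable => // x _; rewrite /= EFinB.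
have mh : measurable_fun setT h.
  by apply: measurable_funB; apply: measurable_funM => //; exact: measurable_gauss_mon.
have cg k : continuous (gauss_mon k).
  move=> x; apply: differentiable_continuous; apply/derivable1_diffP.
  by have [] := is_derive_gauss_mon k x.
have ch : continuous h by move=> x; apply: cvgB; apply: cvgMl_tmp; exact: cg.
(* The bound is [m + 1] and not [m], so that the interval is nondegenerate for [continuous_FTC2]. *)
pose I m : set R := `[(- m.+1%:R)%R, m.+1%:R]%classic.
have E (m : nat) : (\int[mu]_(x in I m) (h x)%:E =
    (gauss_mon n (1 * m.+1%:R) - gauss_mon n (-1 * m.+1%:R))%:E)%E.
  rewrite mul1r mulN1r /I (@continuous_FTC2 _ h (gauss_mon n)) ?EFinB//.
  - by rewrite gtrN// ltr0n.
  - exact: continuous_subspaceT.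
  - split.
    + by move=> x _; have [] := is_derive_gauss_mon n x.
    + exact/cvg_at_right_filter/cg.
    + exact/cvg_at_left_filter/cg.
  - by move=> x _; rewrite derive1E; have [_ ->] := is_derive_gauss_mon n x.
have c1 : (\int[mu]_(x in I m) (h x)%:E)%E @[m --> \oo] --> (0 : \bar R)%E.
  under eq_fun do rewrite E.
  apply: cvg_EFin; first by near=> m.
  rewrite -[X in _ --> X](subr0 (0 : R)); apply: cvgB.
    have := @gauss_mon_cvg0 n 1 (normr1 _).
    by rewrite -(cvg_shiftS (fun m : nat => gauss_mon n (1 * m%:R))); apply.
  have := @gauss_mon_cvg0 n (-1) (normrN1 _).
  by rewrite -(cvg_shiftS (fun m : nat => gauss_mon n (-1 * m%:R))); apply.
have c2 : (\int[mu]_(x in I m) (h x)%:E)%E @[m --> \oo] --> (\int[mu]_x (h x)%:E)%E.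
  under eq_fun do rewrite integral_mkcond.
  have mI m : measurable (I m) by exact: measurable_itv.
  have [] // := @dominated_convergence _ _ _ mu setT measurableT
    (fun m => (EFin \o h) \_ (I m)) (EFin \o h) (abse \o (EFin \o h)).
  - move=> m; apply/(measurable_restrictT _ (mI m)).
    by apply/measurable_EFinP/measurable_funTS.
  - exact/measurable_EFinP.
  - apply: aeW => x _; apply: cvg_near_cst; near=> m.
    rewrite patchE ifT// inE /I/= in_itv/= -ler_norml.
    near: m; exists (Num.truncn `|x|) => // m /= xm.
    rewrite (le_trans (ltW (truncnS_gt _)))// ler_nat.
    by rewrite ltnS.
  - exact: integrable_abse.
  - apply: aeW => x m _; rewrite patchE; case: ifP => // _.
    by rewrite -[point]/(0%E) abse0 abse_ge0.



have h0 : (\int[mu]_x (h x)%:E = 0)%E by exact: (cvg_unique _ c2 c1).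
apply/eqP; rewrite -subr_eq0; apply/eqP.
transitivity (\int[mu]_x h x); last by rewrite /Rintegral h0.
rewrite /h RintegralB//; [|exact: iZ..].
by rewrite !RintegralZl//; exact: integrable_gauss_mon.
Unshelve. all: by end_near. Qed.

End GaussMoment.

Section ProductIntegral.
Context d1 d2 (T1 : measurableType d1) (T2 : measurableType d2) (R : realType).
Variables (m1 : {sigma_finite_measure set T1 -> \bar R})
  (m2 : {sigma_finite_measure set T2 -> \bar R}) (f : T1 -> R) (h : T2 -> R).
Hypotheses (f_int : m1.-integrable setT (EFin \o f))
  (h_int : m2.-integrable setT (EFin \o h)).
Local Open Scope ereal_scope.

Let mf : measurable_fun setT f.
Proof. exact/measurable_EFinP/(measurable_int _ f_int). Qed.
Let mh : measurable_fun setT h.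
Proof. exact/measurable_EFinP/(measurable_int _ h_int). Qed.

Lemma integrable_prodM :
  (m1 \x m2).-integrable setT (fun z => (f z.1 * h z.2)%:E).
Proof.
apply/integrable12ltyP.
  apply/measurable_EFinP; apply: measurable_funM.
    exact: (measurableT_comp mf measurable_fst).
  exact: (measurableT_comp mh measurable_snd).
have E x : \int[m2]_y `|(f x * h y)%:E| = `|f x|%:E * \int[m2]_y `|(h y)%:E|.
  rewrite -ge0_integralZl//=; last by do 2 apply: measurableT_comp.
  by apply: eq_integral => y _; rewrite normrM EFinM.
under eq_integral do rewrite /= E.
have [_ fi] := integrableP _ _ _ f_int; have [_ hi] := integrableP _ _ _ h_int.
rewrite ge0_integralZr//=; last 2 first.
- by do 2 apply: measurableT_comp.
- by apply: integral_ge0.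
by rewrite lte_mul_pinfty// ?ge0_fin_numE// integral_ge0.
Qed.

Lemma integral_prodM :
  \int[m1 \x m2]_z (f z.1 * h z.2)%:E = \int[m1]_x (f x)%:E * \int[m2]_y (h y)%:E.
Proof.
rewrite -(integral12_prod_meas1 integrable_prodM) /fubini_F /=.
under eq_integral.
  move=> x _; under eq_integral do rewrite EFinM.
  rewrite integralZl//; over.
rewrite -(@fineK _ (\int[m2]_y (h y)%:E)); last exact: integrable_fin_num.
by rewrite integralZr.
Qed.
End ProductIntegral.

(** * Gaussian integrals of monomials over R^d *)

Section GaussMonomial.
Variable R : realType.

Definition rV_gauss_mon d (m : 'I_d -> nat) (x : 'rV[R]_d) : R :=
  \prod_i gauss_mon (m i) (x ord0 i).

Lemma rV_gauss_mon_cons d (m : 'I_d.+1 -> nat) (p : R * 'rV[R]_d) :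
  rV_gauss_mon m (rV_cons p) =
  gauss_mon (m ord0) p.1 * rV_gauss_mon (fun i => m (lift ord0 i)) p.2.
Proof.
rewrite /rV_gauss_mon big_ord_recl; congr (gauss_mon _ _ * _).
  rewrite -[RHS](rV_consE p (inl ord0)); congr (rV_cons _ _ _); exact: val_inj.
apply: eq_bigr => i _; congr gauss_mon.
rewrite -[RHS](rV_consE p (inr i)); congr (rV_cons _ _ _); exact: val_inj.
Qed.

Lemma measurable_rV_gauss_mon d (m : 'I_d -> nat) :
  measurable_fun setT (@rV_gauss_mon d m).
Proof.
apply: measurable_prod => i _.
by apply: (measurableT_comp (measurable_gauss_mon _)); exact: (measurable_rV_coord i).
Qed.

Lemma integral_rV_gauss_mon d (m : 'I_d -> nat) :
  (lebesgue_rV R d).-integrable setT (EFin \o @rV_gauss_mon d m) /\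
  (\int[lebesgue_rV R d]_x (rV_gauss_mon m x)%:E = (\prod_i gmom R (m i))%:E)%E.
Proof.
elim: d m => [|d IH] m.
  have mm := measurable_rV_gauss_mon m.
  split; last first.
    rewrite big_ord0 /= integral_dirac//; last exact/measurable_EFinP.
    by rewrite /rV_gauss_mon big_ord0 diracT mul1e.
  apply/integrableP; split; first exact/measurable_EFinP.
  rewrite /= integral_dirac//; last by do 2 apply: measurableT_comp => //.
  by rewrite diracT mul1e/= ltry.
have [i1 i2] := IH (fun i => m (lift ord0 i)).
have ip := integrable_prodM (integrable_gauss_mon R (m ord0)) i1.
have E : (fun z => (gauss_mon (m ord0) z.1 * rV_gauss_mon (fun i => m (lift ord0 i)) z.2)%:E) =
   (EFin \o rV_gauss_mon m) \o @rV_cons R d.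
  by apply/funext => p; rewrite /= rV_gauss_mon_cons.
have mm : measurable_fun setT (EFin \o rV_gauss_mon m).
  by apply/measurable_EFinP; exact: measurable_rV_gauss_mon.
split.
  apply: (integrable_pushforward (@measurable_rV_cons R d) mm) => //.
  by rewrite preimage_setT -E.
rewrite (integral_pushforward (@measurable_rV_cons R d) mm)//; last first.
  by rewrite preimage_setT -E.
rewrite preimage_setT -E (integral_prodM (integrable_gauss_mon R (m ord0)) i1).
by rewrite i2 gmomE -EFinM big_ord_recl.
Qed.

Lemma rV_gauss_monE d (m : 'I_d -> nat) (x : 'rV[R]_d) :
  rV_gauss_mon m x = (\prod_i x ord0 i ^+ m i) * expR (- enorm x ^+ 2).
Proof.
rewrite /rV_gauss_mon big_split /=; congr (_ * _).
rewrite sqr_enorm /edot -sumrN expR_sum; apply: eq_bigr => i _.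
by rewrite /gauss_fun expr2.
Qed.

End GaussMonomial.

(** * From Gaussian integrals to the sphere *)

Section SphereMoment.
Variable R : realType.
Local Notation mu := (@lebesgue_measure R).

Lemma lebesgue_rV_set0 n : lebesgue_rV R n.+1 [set 0] = 0%E.
Proof.
rewrite -[LHS]/((mu \x lebesgue_rV R n)%E (@rV_cons R n @^-1` [set 0])).
have cons0 : rV_cons (0 : R, 0 : 'rV[R]_n) = 0.
  by have := rV_consZ 0 (0, 0 : 'rV[R]_n); rewrite /= scale0r mul0r scaler0.
have -> : @rV_cons R n @^-1` [set 0] = [set 0] `*` [set 0].
  apply/seteqP; split => [[a y]/= E|[a y]/= [-> ->]]; last exact: cons0.
  by have := congr1 (@rV_uncons R n) (etrans E (esym cons0)); rewrite !rV_consK => -[-> ->].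
have mset0 : measurable [set 0 : 'rV[R]_n].
  rewrite (_ : [set 0] = @enorm R n @^-1` [set 0]).
    by rewrite -[X in measurable X]setTI; apply: measurable_enorm.
  by apply/seteqP; split => x /= => [->|/eqP]; rewrite ?enorm0// enorm_eq0 => /eqP.
rewrite product_measure1E// [X in (X * _)%E](_ : _ = 0%E) ?mul0e//.
exact: lebesgue_measure_set1.
Qed.

Lemma measurable_rV_set0 d : measurable [set 0 : 'rV[R]_d].
Proof.
rewrite (_ : [set 0] = @enorm R d @^-1` [set 0]).
  by rewrite -[X in measurable X]setTI; apply: measurable_enorm.
by apply/seteqP; split => x /= => [->|/eqP]; rewrite ?enorm0// enorm_eq0 => /eqP.
Qed.

Definition gamma_fun (y t : R) : R := t `^ (y - 1) * expR (- t).

Lemma measurable_gamma_fun y : measurable_fun setT (gamma_fun y).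
Proof.
apply: measurable_funM; first exact: measurable_powR.
by apply: measurableT_comp => //; exact: measurable_funN.
Qed.

(** Euler's integral in the extended reals: [gamma] is its [fine] part, which carries information
    only once the integral is known to be finite. *)
Definition egamma y : \bar R := (\int[mu]_(t in `]0%R, +oo[) (gamma_fun y t)%:E)%E.

(** On [1, 2] the integrand is at least t^(-1) e^(-2), hence at least e^(-2) / 2. *)
Lemma egamma_gt0 y : 0 <= y -> (0 < egamma y)%E.
Proof.
move=> y0; apply: (@lt_le_trans _ _ (\int[mu]_(t in `[1%R, 2%R]) (expR (- 2) / 2)%:E)%E).
  rewrite integral_cst//= lebesgue_measure_itv/= lte_fin ltr1n -EFinB -EFinM lte_fin.
  by rewrite mulr_gt0// ?divr_gt0 ?expR_gt0// subr_gt0 ltr1n.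
apply: (@le_trans _ _ (\int[mu]_(t in `[1%R, 2%R]) (gamma_fun y t)%:E)%E).
  apply: ge0_le_integral => //=.
  - by apply/measurable_EFinP/measurable_funTS; exact: measurable_gamma_fun.
  - move=> t; rewrite in_itv/= => /andP[t1 t2]; rewrite lee_fin mulrC /gamma_fun.
    have t0 : 0 < t by exact: lt_le_trans t1.
    apply: ler_pM; rewrite ?invr_ge0 ?expR_ge0// ?ler_expR ?lerN2//.
    apply: (@le_trans _ _ (t `^ (-1))); last by apply: ler_powR => //; lra.
    by rewrite powR_inv1 ?(ltW t0)// lef_pV2 ?posrE.
apply: ge0_subset_integral => //=.
- by apply/measurable_EFinP/measurable_funTS; exact: measurable_gamma_fun.
- by move=> t _; rewrite lee_fin mulr_ge0 ?powR_ge0 ?expR_ge0.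
- move=> t /=; rewrite !in_itv/= andbT => /andP[t1 _]; exact: lt_le_trans t1.
Qed.

Section Dim.
Variable d : nat.
Hypothesis d_gt0 : (0 < d)%N.
Local Notation lam := (lebesgue_rV R d).

(** [polar_integral] with u(t) = t^(a/2) e^(-t): the radial integral is Euler's integral at
    [(a + d)/2]. *)
Lemma polar_gamma (a : nat) (g : 'rV[R]_d -> R) :
  measurable_fun setT g -> (forall x, 0 <= g x) -> g 0 = 0 ->
  (\int[lam]_x (g (direction x) * (enorm x ^+ a * expR (- enorm x ^+ 2)))%:E =
   (2^-1)%:E * (egamma ((a + d)%:R / 2) * \int[surface_measure]_x (g x)%:E))%E.
Proof.
move=> mg g_ge0 g0.
pose u (t : R) := t `^ (a%:R / 2) * expR (- t).
have mu_ : measurable_fun setT u.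
  apply: measurable_funM; first exact: measurable_powR.
  by apply: measurableT_comp => //; exact: measurable_funN.
have u0 t : 0 <= u t by rewrite mulr_ge0 ?powR_ge0 ?expR_ge0.
have E x : u (enorm x ^+ 2) = enorm x ^+ a * expR (- enorm x ^+ 2).
  rewrite /u -powR_mulrn ?enorm_ge0// -powRrM -powR_mulrn ?enorm_ge0//.
  by congr (_ `^ _ * _); field.
under eq_integral do rewrite -E.
rewrite (polar_integral d_gt0 mg g_ge0 g0 mu_ u0).
congr (_ * (_ * _))%E; apply: eq_integral => t; rewrite inE/= in_itv/= andbT => t0.
rewrite /gamma_fun /u mulrAC -powRD; last by rewrite (gt_eqF t0)/= implybT.
by congr ((_ `^ _ * _)%:E); rewrite natrD; field.
Qed.

Lemma negligible_rV_set0 : lam [set 0] = 0%E.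
Proof. by case: d d_gt0 => // n _; exact: lebesgue_rV_set0. Qed.

Lemma ae_direction (f g : 'rV[R]_d -> \bar R) : (forall x, x != 0 -> f x = g x) ->
  measurable_fun setT f -> measurable_fun setT g -> (\int[lam]_x f x = \int[lam]_x g x)%E.
Proof.
move=> fg mf mg; apply: ae_eq_integral => //.
exists [set 0]; split; [exact: measurable_rV_set0|exact: negligible_rV_set0|].
by move=> x /= h; apply: contrapT => /eqP x0; apply: h => _; exact: fg.
Qed.

Lemma polar_gamma_sphere (a : nat) :
  (\int[lam]_x (enorm x ^+ a * expR (- enorm x ^+ 2))%:E =
   (2^-1)%:E * (egamma ((a + d)%:R / 2) * surface_measure (@unit_sphere R d)))%E.
Proof.
have mS := @measurable_unit_sphere R d.
have m1 : measurable_fun setT (\1_(@unit_sphere R d) : _ -> R) by exact: measurable_indic.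
have me : measurable_fun setT (fun x : 'rV[R]_d => enorm x ^+ a * expR (- enorm x ^+ 2)).
  apply: measurable_funM; first by apply: measurable_funX; exact: measurable_enorm.
  apply: measurableT_comp => //; apply: measurable_funN.
  by apply: measurable_funX; exact: measurable_enorm.
rewrite -[X in surface_measure X]setIT -integral_indic// -polar_gamma//.
- apply: ae_direction => [x x0||]; try exact/measurable_EFinP.
    by rewrite indicE mem_set ?mul1r//; exact: unit_sphere_direction.
  apply/measurable_EFinP; apply: measurable_funM => //.
  by apply: (measurableT_comp m1); exact: measurable_direction.
- by rewrite indicE memNset//; exact: unit_sphereN0.
Qed.

End Dim.

(** In dimension one [polar_gamma_sphere] equates half the measure of the two-point sphere times
    Gamma((b+1)/2) with an absolute Gaussian moment, which is finite. The measure of the sphere is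
    nonzero by the same identity at exponent 0, whose left side is the square root of pi. *)
Lemma egamma_fin (b : nat) : (egamma (b.+1%:R / 2) < +oo)%E.
Proof.
have P a := @polar_gamma_sphere 1 isT a.
have E a (x : 'rV[R]_1) : `|gauss_mon a (x ord0 ord0)| = enorm x ^+ a * expR (- enorm x ^+ 2).
  have -> : enorm x = `|x ord0 ord0| by rewrite /enorm /edot big_ord1 -expr2 sqrtr_sqr.
  by rewrite /gauss_mon /gauss_fun normrM normrX real_normK ?num_real// (ger0_norm (expR_ge0 _)).
have I a : (\int[lebesgue_rV R 1]_x (enorm x ^+ a * expR (- enorm x ^+ 2))%:E < +oo)%E.
  have [/integrableP[_ h] _] := integral_rV_gauss_mon R (fun _ : 'I_1 => a).
  move: h; under eq_integral.
    move=> x _; rewrite /= /rV_gauss_mon big_ord1 E; over.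
  by [].
have J : (0 < \int[lebesgue_rV R 1]_x (enorm x ^+ 0 * expR (- enorm x ^+ 2))%:E)%E.
  have [_ h] := integral_rV_gauss_mon R (fun _ : 'I_1 => 0%N).
  have -> : (\int[lebesgue_rV R 1]_x (enorm x ^+ 0 * expR (- enorm x ^+ 2))%:E =
    \int[lebesgue_rV R 1]_x (rV_gauss_mon (fun _ : 'I_1 => 0%N) x)%:E)%E.
    by apply: eq_integral => x _; rewrite rV_gauss_monE big_ord1 !expr0.
  by rewrite h big_ord1 gmom0 lte_fin sqrtr_gt0 pi_gt0.
have S0 : surface_measure (@unit_sphere R 1) != 0%E.
  by apply/eqP => S0; move: J; rewrite P S0 !mule0 ltxx.
have := I b; rewrite P addn1; set K := egamma _.
have K0 : (0 < K)%E by apply: egamma_gt0; rewrite divr_ge0.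
case: K K0 => [k _ _|_|//]; first exact: ltry.
rewrite gt0_mulye; last by rewrite lt0e S0 measure_ge0.
by rewrite gt0_muley// lte_fin invr_gt0.
Qed.

Lemma gammaE y : gamma y = fine (egamma y). Proof. by []. Qed.

Lemma gamma_half_gt0 (b : nat) : 0 < gamma (b.+1%:R / 2 : R).
Proof. by rewrite gammaE fine_gt0// egamma_gt0 ?divr_ge0// egamma_fin. Qed.

Lemma egammaE (b : nat) : (egamma (b.+1%:R / 2) = (gamma (b.+1%:R / 2))%:E)%E.
Proof.
rewrite gammaE fineK// ge0_fin_numE ?egamma_fin// ltW// egamma_gt0// divr_ge0.
Qed.

(** The identity [polar_gamma_sphere] read the other way round: the Gaussian integral is finite and
    Gamma(d/2) is positive. *)
Lemma surface_measure_fin d : (0 < d)%N -> (surface_measure (@unit_sphere R d) < +oo)%E.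
Proof.
move=> d0; have P := @polar_gamma_sphere d d0 0.
have [/integrableP[_ F] _] := integral_rV_gauss_mon R (fun _ : 'I_d => 0%N).
have : (\int[lebesgue_rV R d]_x (enorm x ^+ 0 * expR (- enorm x ^+ 2))%:E < +oo)%E.
  move: F; under eq_integral.
    move=> x _; rewrite /= rV_gauss_monE big1// mul1r ger0_norm ?expR_ge0//; over.
  by under [in X in _ -> X]eq_integral do rewrite expr0 mul1r.
rewrite P add0n -(prednK d0) egammaE.
set s := surface_measure _; have : (0 <= s)%E by exact: measure_ge0.
case: s => // [r _ _|_]; first exact: ltry.
rewrite gt0_muley ?lte_fin ?gamma_half_gt0// gt0_muley// lte_fin invr_gt0.
Qed.

Definition rV_mon d (m : 'I_d -> nat) (x : 'rV[R]_d) : R := \prod_i x ord0 i ^+ m i.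

Lemma measurable_rV_mon d (m : 'I_d -> nat) : measurable_fun setT (rV_mon m).
Proof.
apply: measurable_prod => i _; apply: measurable_funX; exact: (measurable_rV_coord i).
Qed.

Lemma rV_mon_le1 d (m : 'I_d -> nat) x : unit_sphere x -> `|rV_mon m x| <= 1.
Proof.
move=> Sx; rewrite /rV_mon normr_prod; apply: prodr_ile1 => i _.
by rewrite normr_ge0 normrX exprn_ile1 ?unit_sphere_coord.
Qed.

Lemma rV_mon_direction d (m : 'I_d -> nat) (x : 'rV[R]_d) :
  rV_mon m x = rV_mon m (direction x) * enorm x ^+ (\sum_i m i).
Proof.
rewrite /rV_mon -{1}(enormK x) expr_sum -big_split /=; apply: eq_bigr => i _.
by rewrite mxE exprMn mulrC.
Qed.

(* The positive and the negative part of the monomial are integrated separately in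
   polar coordinates. *)
Lemma sphere_moment d (m : 'I_d -> nat) : (0 < d)%N ->
  gamma ((\sum_i m i + d)%:R / 2) / 2 * \int[surface_measure]_(x in unit_sphere) rV_mon m x
  = \prod_i gmom R (m i).
Proof.
move=> d0; pose a := (\sum_i m i)%N.
have mS := @measurable_unit_sphere R d.
(* The cut-off makes [g] bounded and gives [g 0 = 0], as [polar_gamma] asks; the direction of a
   nonzero vector lies on the sphere and is unaffected. *)
pose g (x : 'rV[R]_d) := rV_mon m x * \1_(@unit_sphere R d) x.
have mg : measurable_fun setT g.
  by apply: measurable_funM; [exact: measurable_rV_mon|exact: measurable_indic].
have gN0 : g 0 = 0 by rewrite /g indicE memNset ?mulr0//; exact: unit_sphereN0.
have g_le1 x : `|g x| <= \1_(@unit_sphere R d) x.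
  rewrite /g indicE; case: (boolP (x \in _)) => [|_]; last by rewrite mulr0 normr0.
  by rewrite inE mulr1 => /rV_mon_le1.
pose w (x : 'rV[R]_d) : R := enorm x ^+ a * expR (- enorm x ^+ 2).
have w0 x : 0 <= w x by rewrite mulr_ge0 ?expR_ge0// exprn_ge0// enorm_ge0.
have mw : measurable_fun setT w.
  apply: measurable_funM; first by apply: measurable_funX; exact: measurable_enorm.
  apply: measurableT_comp => //; apply: measurable_funN.
  by apply: measurable_funX; exact: measurable_enorm.
have fE x : x != 0 -> rV_gauss_mon m x = g (direction x) * w x.
  move=> x0; rewrite rV_gauss_monE -/(rV_mon m x) rV_mon_direction /g indicE mem_set.
    by rewrite mulr1 mulrA.
  exact: unit_sphere_direction.
pose c : R := gamma ((a + d)%:R / 2).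
have cE : egamma ((a + d)%:R / 2) = c%:E by rewrite /c -(prednK d0) addnS egammaE.
(* Here [s] stands for either part, max(t, 0) or max(-t, 0). Positive homogeneity lets it pass
   through the radial weight [w], and the bound by [|t|] makes the integrals finite. *)
have P (s : R -> R) : measurable_fun setT s -> (forall t, 0 <= s t) -> s 0 = 0 ->
    (forall t r, 0 <= r -> s (t * r) = s t * r) -> (forall t, s t <= `|t|) ->
    exists2 I : R, (\int[surface_measure]_x (s (g x))%:E = I%:E)%E &
      (\int[lebesgue_rV R d]_x (s (rV_gauss_mon m x))%:E = (c / 2 * I)%:E)%E.
  move=> ms s0 s00 sM sle.
  have msg : measurable_fun setT (s \o g) by exact: measurableT_comp.
  have Jfin : (\int[surface_measure]_x (s (g x))%:E)%E \is a fin_num.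
    rewrite ge0_fin_numE; last by apply: integral_ge0 => x _; rewrite lee_fin.
    apply: (@le_lt_trans _ _ (\int[surface_measure]_x (\1_(@unit_sphere R d) x)%:E)%E).
      apply: ge0_le_integral => //.
      - by move=> x _; rewrite lee_fin.
      - exact/measurable_EFinP.
      - by apply/measurable_EFinP; exact: measurable_indic.
      - by move=> x _; rewrite lee_fin (le_trans (sle _)).
    by rewrite integral_indic// setIT surface_measure_fin.
  exists (fine (\int[surface_measure]_x (s (g x))%:E)%E); first by rewrite fineK.
  transitivity (\int[lebesgue_rV R d]_x (s (g (direction x)) * w x)%:E)%E.
    apply: ae_direction => //.
    - by move=> x x0; rewrite fE// sM.
    - by apply/measurable_EFinP; apply: (measurableT_comp ms); exact: measurable_rV_gauss_mon.
    - apply/measurable_EFinP; apply: measurable_funM => //.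
      by apply: (measurableT_comp msg); exact: measurable_direction.
  rewrite (polar_gamma d0 a (g := s \o g))//=; last by rewrite gN0.
  by rewrite cE muleA -EFinM [2^-1 * c]mulrC -[X in (_ * X)%E = _](fineK Jfin) -EFinM.
have maxM (t r : R) : 0 <= r -> Num.max (t * r) 0 = Num.max t 0 * r.
  by move=> r0; rewrite maxr_pMl// mul0r.
have max_le (t : R) : Num.max t 0 <= `|t| by rewrite ge_max ler_norm normr_ge0.
have mmax : measurable_fun setT (fun t : R => Num.max t 0) by exact: measurable_maxr.
have [] := P (fun t => Num.max t 0) => //.
  by move=> t; rewrite le_max lexx orbT.
  by rewrite maxxx.
move=> I1 gI1 fI1; have [] := P (fun t => Num.max (- t) 0).
- by apply: (measurableT_comp mmax); exact: measurable_funN.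
- by move=> t; rewrite le_max lexx orbT.
- by rewrite oppr0 maxxx.
- by move=> t r r0; rewrite -mulNr maxM.
- by move=> t; rewrite -normrN.
move=> I2 gI2 fI2.
have [_ E] := integral_rV_gauss_mon R m.
have F : (\int[lebesgue_rV R d]_x (rV_gauss_mon m x)%:E = (c / 2 * (I1 - I2))%:E)%E.
  rewrite integralE mulrBr EFinB -fI1 -fI2.
  congr (_ - _)%E; apply: eq_integral => x _; rewrite ?funeposE ?funenegE/=.
    by rewrite -EFin_max.
  by rewrite -EFin_max.
have G : \int[surface_measure]_(x in unit_sphere) rV_mon m x = I1 - I2.
  rewrite /Rintegral integral_mkcond -[RHS]/(fine (I1 - I2)%:E); congr fine.
  rewrite EFinB -gI1 -gI2 integralE.
  have gE x : ((EFin \o rV_mon m) \_ (@unit_sphere R d)) x = (g x)%:E.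
    by rewrite patchE /g indicE; case: ifP => _; rewrite ?mulr1 ?mulr0.
  congr (_ - _)%E; apply: eq_integral => x _; rewrite ?funeposE ?funenegE/= gE.
    by rewrite -EFin_max.
  by rewrite -EFin_max.
by rewrite G -/a -/c; apply: EFin_inj; rewrite -F E.
Qed.

End SphereMoment.

(** * Complex integrals over the sphere *)

Section ComplexNorm1.
Variable R : realType.
Implicit Types z w : R[i].

Lemma cReD z w : complex.Re (z + w) = complex.Re z + complex.Re w.
Proof. by case: z; case: w. Qed.
Lemma cImD z w : complex.Im (z + w) = complex.Im z + complex.Im w.
Proof. by case: z; case: w. Qed.
Lemma cReN z : complex.Re (- z) = - complex.Re z. Proof. by case: z. Qed.
Lemma cImN z : complex.Im (- z) = - complex.Im z. Proof. by case: z. Qed.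
Lemma cReM z w : complex.Re (z * w) =
  complex.Re z * complex.Re w - complex.Im z * complex.Im w.
Proof. by case: z; case: w. Qed.
Lemma cImM z w : complex.Im (z * w) =
  complex.Re z * complex.Im w + complex.Im z * complex.Re w.
Proof. by case: z; case: w. Qed.
Lemma cReJ z : complex.Re z^*%C = complex.Re z. Proof. by case: z. Qed.
Lemma cImJ z : complex.Im z^*%C = - complex.Im z. Proof. by case: z. Qed.
Lemma complex_eqP z w :
  complex.Re z = complex.Re w -> complex.Im z = complex.Im w -> z = w.
Proof. by case: z => a b; case: w => c e /= -> ->. Qed.

(** [nc] is the taxicab norm and [sqc] the squared modulus, both with values in [R] so that they can
    be integrated. [nc] is submultiplicative and dominates the real and the imaginary part. *)
Definition nc z : R := `|complex.Re z| + `|complex.Im z|.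
Definition sqc z : R := complex.Re z ^+ 2 + complex.Im z ^+ 2.

Lemma nc_ge0 z : 0 <= nc z. Proof. by rewrite addr_ge0. Qed.
Lemma sqc_ge0 z : 0 <= sqc z. Proof. by rewrite addr_ge0// sqr_ge0. Qed.

Lemma ncD z w : nc (z + w) <= nc z + nc w.
Proof.
rewrite /nc cReD cImD; have := ler_normD (complex.Re z) (complex.Re w).
by have := ler_normD (complex.Im z) (complex.Im w); lra.
Qed.

Lemma nc0 : nc 0 = 0. Proof. by rewrite /nc normr0 addr0. Qed.

Lemma ncM z w : nc (z * w) <= nc z * nc w.
Proof.
rewrite /nc cReM cImM.
have := ler_normB (complex.Re z * complex.Re w) (complex.Im z * complex.Im w).
have := ler_normD (complex.Re z * complex.Im w) (complex.Im z * complex.Re w).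
rewrite !normrM; lra.
Qed.

Lemma nc_real (r : R) : nc r%:C%C = `|r|. Proof. by rewrite /nc/= normr0 addr0. Qed.

Lemma nc_sqc z : nc z ^+ 2 <= 2 * sqc z.
Proof.
rewrite /nc /sqc -(real_normK (num_real (complex.Re z))) -(real_normK (num_real (complex.Im z))).
by have := sqr_ge0 (`|complex.Re z| - `|complex.Im z|); lra.
Qed.

Lemma sqc_nc z : sqc z <= nc z ^+ 2.
Proof.
rewrite /nc /sqc -(real_normK (num_real (complex.Re z))) -(real_normK (num_real (complex.Im z))).
have := mulr_ge0 (normr_ge0 (complex.Re z)) (normr_ge0 (complex.Im z)); lra.
Qed.

Lemma sqcD z w : sqc (z + w) <= 2 * sqc z + 2 * sqc w.
Proof.
rewrite /sqc cReD cImD; have := sqr_ge0 (complex.Re z - complex.Re w).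
by have := sqr_ge0 (complex.Im z - complex.Im w); lra.
Qed.

Lemma sqcM z w : sqc (z * w) = sqc z * sqc w.
Proof. by rewrite /sqc cReM cImM; ring. Qed.


Lemma mulJ_sqc z : z * z^*%C = (sqc z)%:C%C.
Proof. by apply: complex_eqP; rewrite /sqc ?cReM ?cImM cReJ cImJ/=; ring. Qed.

Lemma nc_mul_sqc z w : nc (z * w) <= sqc z + sqc w.
Proof.
apply: (le_trans (ncM z w)); have := nc_sqc z; have := nc_sqc w.
by have := sqr_ge0 (nc z - nc w); lra.
Qed.

End ComplexNorm1.

Section ComplexIntegral.
Variables (R : realType) (d : nat).
Hypothesis d_gt0 : (0 < d)%N.
Local Notation S := (@unit_sphere R d).
Local Notation sg := (@surface_measure R d).
Implicit Types F G : 'rV[R]_d -> R[i].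

Let mS : measurable S := @measurable_unit_sphere R d.

Definition cmeas F : Prop := measurable_fun S (fun x => complex.Re (F x)) /\
  measurable_fun S (fun x => complex.Im (F x)).

Definition cint F : Prop := sg.-integrable S (EFin \o (fun x => complex.Re (F x))) /\
  sg.-integrable S (EFin \o (fun x => complex.Im (F x))).

Lemma cint_meas F : cint F -> cmeas F.
Proof.
by move=> [/integrableP[/measurable_EFinP ? _] /integrableP[/measurable_EFinP ? _]].
Qed.

Lemma cmeas_cst c : cmeas (fun=> c). Proof. by split. Qed.

Lemma cmeasD F G : cmeas F -> cmeas G -> cmeas (fun x => F x + G x).
Proof.
move=> [F1 F2] [G1 G2]; split.
  by under eq_fun do rewrite cReD; exact: measurable_funD.
by under eq_fun do rewrite cImD; exact: measurable_funD.
Qed.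

Lemma cmeasM F G : cmeas F -> cmeas G -> cmeas (fun x => F x * G x).
Proof.
move=> [F1 F2] [G1 G2]; split.
  under eq_fun do rewrite cReM.
  by apply: measurable_funB; exact: measurable_funM.
under eq_fun do rewrite cImM.
by apply: measurable_funD; exact: measurable_funM.
Qed.

Lemma cmeasN F : cmeas F -> cmeas (fun x => - F x).
Proof.
move=> [F1 F2]; split.
  by under eq_fun do rewrite cReN; exact: measurable_funN.
by under eq_fun do rewrite cImN; exact: measurable_funN.
Qed.

Lemma cmeasJ F : cmeas F -> cmeas (fun x => (F x)^*%C).
Proof.
move=> [F1 F2]; split.
  by under eq_fun do rewrite cReJ.
by under eq_fun do rewrite cImJ; exact: measurable_funN.
Qed.

Lemma cmeas_real (f : 'rV[R]_d -> R) : measurable_fun S f -> cmeas (fun x => (f x)%:C%C).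
Proof. by move=> mf; split => //=; exact: measurable_cst. Qed.

Lemma eq_cmeas F G : (forall x, S x -> F x = G x) -> cmeas F -> cmeas G.
Proof.
move=> FG [F1 F2]; split.
  by apply: eq_measurable_fun F1 => x; rewrite inE => Sx; rewrite FG.
by apply: eq_measurable_fun F2 => x; rewrite inE => Sx; rewrite FG.
Qed.


Lemma measurable_sqc F : cmeas F -> measurable_fun S (fun x => sqc (F x)).
Proof. by move=> [F1 F2]; apply: measurable_funD; exact: measurable_funX. Qed.

Lemma cint_le F (g : 'rV[R]_d -> R) : cmeas F -> sg.-integrable S (EFin \o g) ->
  (forall x, S x -> nc (F x) <= g x) -> cint F.
Proof.
move=> [F1 F2] gi h; split; apply: le_integrable gi => //.
- exact/measurable_EFinP.
- move=> x Sx /=; rewrite lee_fin [leRHS]ger0_norm ?(le_trans (nc_ge0 _) (h x Sx))//.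
  by apply: le_trans (h x Sx); rewrite lerDl.
- exact/measurable_EFinP.
- move=> x Sx /=; rewrite lee_fin [leRHS]ger0_norm ?(le_trans (nc_ge0 _) (h x Sx))//.
  by apply: le_trans (h x Sx); rewrite lerDr.
Qed.

Lemma cint_nc F : cint F -> sg.-integrable S (EFin \o (fun x => nc (F x))).
Proof.
move=> [F1 F2].
have := integrableD mS (integrable_norm F1) (integrable_norm F2).
by apply: eq_integrable.
Qed.

Lemma integrable_cst (M : R) : sg.-integrable S (EFin \o cst M).
Proof.
apply: measurable_bounded_integrable => //; first exact: surface_measure_fin.
by exists `|M|; split; [exact: num_real|move=> y /ltW My x _].
Qed.

Lemma cint_bdd F (M : R) : cmeas F -> (forall x, S x -> nc (F x) <= M) -> cint F.
Proof. by move=> mF h; apply: (cint_le mF (integrable_cst M)). Qed.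

Lemma cintM_bdd F G (M : R) : cint F -> cmeas G -> (forall x, S x -> nc (G x) <= M) ->
  cint (fun x => F x * G x).
Proof.
move=> iF mG h; apply: (@cint_le _ (fun x => nc (F x) * M)).
- by apply: cmeasM => //; exact: cint_meas.
- have := integrableZl mS M (cint_nc iF); apply: eq_integrable => // x _ /=.
  by rewrite -EFinM mulrC.
- by move=> x Sx; apply: (le_trans (ncM _ _)); rewrite ler_wpM2l ?nc_ge0// h.
Qed.

Lemma cintD F G : cint F -> cint G -> cint (fun x => F x + G x).
Proof.
move=> iF iG; apply: (@cint_le _ (fun x => nc (F x) + nc (G x))).
- by apply: cmeasD; exact: cint_meas.
- by have := integrableD mS (cint_nc iF) (cint_nc iG); apply: eq_integrable.
- by move=> x _; exact: ncD.
Qed.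

Lemma cintZ c F : cint F -> cint (fun x => c * F x).
Proof.
move=> iF; under eq_fun do rewrite mulrC.
exact: (cintM_bdd (M := nc c) iF (cmeas_cst c)).
Qed.

Lemma cint0 : cint (fun=> 0).
Proof. by apply: (@cint_bdd _ 0 (cmeas_cst 0)) => x _; rewrite nc0. Qed.

Lemma cint_sum (I : Type) (s : seq I) (F : I -> 'rV[R]_d -> R[i]) :
  (forall i, cint (F i)) -> cint (fun x => \sum_(i <- s) F i x).
Proof.
move=> iF; elim: s => [|i s IH].
  by under eq_fun do rewrite big_nil; exact: cint0.
by under eq_fun do rewrite big_cons; exact: cintD.
Qed.

Lemma eq_sphere_int F G : (forall x, S x -> F x = G x) -> sphere_int F = sphere_int G.
Proof.
by move=> FG; congr (_ +i* _)%C; apply: eq_Rintegral => x; rewrite inE => Sx; rewrite FG.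
Qed.

Lemma sphere_intD F G : cint F -> cint G ->
  sphere_int (fun x => F x + G x) = sphere_int F + sphere_int G.
Proof.
move=> [F1 F2] [G1 G2]; apply: complex_eqP; rewrite /= -RintegralD//.
  by apply: eq_Rintegral => x _; rewrite cReD.
by apply: eq_Rintegral => x _; rewrite cImD.
Qed.

Lemma sphere_intZ c F : cint F -> sphere_int (fun x => c * F x) = c * sphere_int F.
Proof.
move=> [F1 F2].
have iZ (r : R) (f : 'rV[R]_d -> R) : sg.-integrable S (EFin \o f) ->
    sg.-integrable S (EFin \o (fun x => r * f x)).
  by move=> fi; have := integrableZl mS r fi; apply: eq_integrable.
apply: complex_eqP; rewrite ?cReM ?cImM /=.
  rewrite -!RintegralZl// -RintegralB//; [|exact: iZ..].
  by apply: eq_Rintegral => x _; rewrite cReM.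
rewrite -!RintegralZl// -RintegralD//; [|exact: iZ..].
by apply: eq_Rintegral => x _; rewrite cImM.
Qed.

Lemma sphere_int0 : sphere_int (fun _ : 'rV[R]_d => 0 : R[i]) = 0 :> R[i].
Proof.
by apply: complex_eqP; rewrite /= /Rintegral integral0.
Qed.

Lemma sphere_int_sum (I : Type) (s : seq I) (F : I -> 'rV[R]_d -> R[i]) :
  (forall i, cint (F i)) ->
  sphere_int (fun x => \sum_(i <- s) F i x) = \sum_(i <- s) sphere_int (F i).
Proof.
move=> iF; elim: s => [|i s IH].
  by rewrite big_nil -[RHS]sphere_int0; apply: eq_sphere_int => x _; rewrite big_nil.
rewrite big_cons -IH -sphere_intD//; last exact: cint_sum.
by apply: eq_sphere_int => x _; rewrite big_cons.
Qed.

Lemma sphere_int_real (f : 'rV[R]_d -> R) :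
  sphere_int (fun x => (f x)%:C%C) = (\int[sg]_(x in S) f x)%:C%C.
Proof. by apply: complex_eqP; rewrite //= /Rintegral integral0. Qed.

Lemma sphere_int_dom (Fn : nat -> 'rV[R]_d -> R[i]) F (g : 'rV[R]_d -> R) :
  (forall n, cmeas (Fn n)) -> cmeas F -> sg.-integrable S (EFin \o g) ->
  (forall n x, S x -> nc (Fn n x) <= g x) ->
  (forall x, S x -> complex.Re (Fn n x) @[n --> \oo] --> complex.Re (F x)) ->
  (forall x, S x -> complex.Im (Fn n x) @[n --> \oo] --> complex.Im (F x)) ->
  complex.Re (sphere_int (Fn n)) @[n --> \oo] --> complex.Re (sphere_int F) /\
  complex.Im (sphere_int (Fn n)) @[n --> \oo] --> complex.Im (sphere_int F).
Proof.
move=> mFn [mF1 mF2] gi hg c1 c2.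
have P (fn : nat -> 'rV[R]_d -> R) (f : 'rV[R]_d -> R) :
    (forall n, measurable_fun S (fn n)) -> measurable_fun S f ->
    (forall n x, S x -> `|fn n x| <= g x) ->
    (forall x, S x -> fn n x @[n --> \oo] --> f x) ->
    \int[sg]_(x in S) fn n x @[n --> \oo] --> \int[sg]_(x in S) f x.
  move=> mfn mf h c.
  have c' x : S x -> (fn n x)%:E @[n --> \oo] --> (f x)%:E.
    by move=> Sx; apply: cvg_EFin; [exact: nearW|exact: c].
  have [||||fi _ ci] := @dominated_convergence _ _ _ sg S mS (fun n => EFin \o fn n) (EFin \o f)
    (EFin \o g) _ _ _ gi.
  - by move=> n; exact/measurable_EFinP.
  - exact/measurable_EFinP.
  - exact: aeW.
  - by apply: aeW => x n Sx; rewrite lee_fin h.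
  apply: fine_cvg; rewrite fineK//; exact: integrable_fin_num.
split; apply: P => //=.
- by move=> n; have [] := mFn n.
- by move=> n x Sx; apply: le_trans (hg n x Sx); rewrite lerDl.
- by move=> n; have [] := mFn n.
- by move=> n x Sx; apply: le_trans (hg n x Sx); rewrite lerDr.
Qed.

End ComplexIntegral.

(** * Integrals of polynomials over the sphere *)

Section SpherePolynomials.
Variables (R : realType) (d : nat).
Hypothesis d_gt0 : (0 < d)%N.
Local Notation S := (@unit_sphere R d).
Local Notation sg := (@surface_measure R d).
Implicit Types (p q : mpoly d R[i]) (m : multinom d).

Definition peval p (x : 'rV[R]_d) : R[i] := meval (fun i => (x ord0 i)%:C%C) p.

Lemma pevalX m x : peval (mpolyX R[i] m) x = (rV_mon m x)%:C%C.
Proof. by rewrite /peval mevalX /rV_mon rmorph_prod; apply: eq_bigr => i _; rewrite rmorphXn. Qed.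

Lemma pevalE p x : peval p x = \sum_(m <- msupp p) mcoeff m p * (rV_mon m x)%:C%C.
Proof.
rewrite /peval mevalE; apply: eq_bigr => m _; congr (_ * _).
by rewrite -pevalX /peval mevalX.
Qed.

Lemma pevalD p q x : peval (p + q) x = peval p x + peval q x.
Proof. exact: mevalD. Qed.
Lemma pevalM p q x : peval (p * q) x = peval p x * peval q x.
Proof. exact: mevalM. Qed.
Lemma pevalZ c p x : peval (c *: p) x = c * peval p x.
Proof. exact: mevalZ. Qed.
Lemma pevalC c x : peval (mpolyC d c) x = c.
Proof. exact: mevalC. Qed.
Lemma pevalXU i x : peval (mpolyX R[i] (mnm1 i)) x = (x ord0 i)%:C%C.
Proof. exact: mevalXU. Qed.
Lemma peval_linform (r x : 'rV[R]_d) :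
  peval (linform (fun i => (r ord0 i)%:C%C)) x = (edot x r)%:C%C.
Proof.
rewrite /peval /linform raddf_sum rmorph_sum; apply: eq_bigr => i _ /=.
by rewrite mevalZ mevalXU -rmorphM mulrC.
Qed.

Lemma peval_sqn x : S x -> peval (sqn R[i] d) x = 1.
Proof.
move=> Sx; rewrite /peval /sqn raddf_sum /=.
under eq_bigr do rewrite rmorphXn /= mevalXU -rmorphXn.
by rewrite -rmorph_sum -[1]/(1%:C%C) -(expr1n R 2) -Sx sqr_enorm.
Qed.

Lemma peval_hom n p (s : R) x : hom n p -> peval p (s *: x) = (s ^+ n)%:C%C * peval p x.
Proof.
move=> /homP hp; rewrite !pevalE mulr_sumr big_seq [RHS]big_seq; apply: eq_bigr => m mp.
rewrite mulrCA -rmorphM; congr (_ * _%:C%C).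
rewrite -(hp _ mp) mdegE /rV_mon expr_sum -big_split; apply: eq_bigr => i _.
by rewrite mxE exprMn.
Qed.

Lemma cmeas_peval p : cmeas (peval p).
Proof.
rewrite (_ : peval p = fun x => \sum_(m <- msupp p) mcoeff m p * (rV_mon m x)%:C%C); last first.
  by apply/funext => x; exact: pevalE.
elim: (msupp p) => [|m s IH].
  by under eq_fun do rewrite big_nil; exact: cmeas_cst.
under eq_fun do rewrite big_cons.
apply: cmeasD => //; apply: cmeasM; first exact: cmeas_cst.
by apply: cmeas_real; apply: measurable_funTS; exact: measurable_rV_mon.
Qed.

Lemma peval_bdd p : exists M : R, forall x, S x -> nc (peval p x) <= M.
Proof.
exists (\sum_(m <- msupp p) nc (mcoeff m p)) => x Sx; rewrite pevalE.
elim: (msupp p) => [|m s IH]; first by rewrite !big_nil nc0.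
rewrite !big_cons (le_trans (ncD _ _))// lerD// (le_trans (ncM _ _))//.
by rewrite nc_real ler_piMr ?nc_ge0// rV_mon_le1.
Qed.

Lemma cint_peval p : cint (peval p).
Proof. have [M hM] := peval_bdd p; exact: (cint_bdd d_gt0 (cmeas_peval p) hM). Qed.

Definition gC (n : nat) : R[i] := (gmom R n)%:C%C.

Lemma gC_rec n : n%:R * gC n.-1 = 2 * gC n.+1.
Proof.
by rewrite /gC -(rmorph_nat (real_complex R) n) -(rmorph_nat (real_complex R) 2) -!rmorphM gmom_rec.
Qed.

(** The ratio of spherical to Gaussian integrals in degree [a]. *)
Definition smom (a : nat) : R := 2 / gamma ((a + d)%:R / 2).

Lemma gamma_neq0 (a : nat) : gamma ((a + d)%:R / 2) != 0 :> R.
Proof. by rewrite -(prednK d_gt0) addnS gt_eqF// gamma_half_gt0. Qed.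

(** The factor in [sphere_moment] depends on a monomial only through its degree, so for homogeneous
    [p] it comes out of the sum. *)
Lemma sphere_int_peval a p : hom a p ->
  sphere_int (peval p) = (smom a)%:C%C * gfun gC p.
Proof.
move=> /homP hp; rewrite (@eq_sphere_int _ _ _ _ (fun x _ => pevalE p x)).
rewrite sphere_int_sum//; last first.
  move=> m; apply: cintZ => //; have := cint_peval (mpolyX R[i] m).
  by rewrite (_ : peval _ = fun x => (rV_mon m x)%:C%C)//; apply/funext => x; exact: pevalX.
rewrite /gfun mulr_sumr big_seq [RHS]big_seq; apply: eq_bigr => m mp.
rewrite sphere_intZ//; last first.
  have := cint_peval (mpolyX R[i] m).
  by rewrite (_ : peval _ = fun x => (rV_mon m x)%:C%C)//; apply/funext => x; exact: pevalX.
rewrite mulrCA; congr (_ * _); rewrite sphere_int_real /gmon.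
rewrite /gC -rmorph_prod -rmorphM; congr (_%:C%C).
rewrite -(@sphere_moment R d m d_gt0) -mdegE (hp _ mp) /smom mulrA; set I := Rintegral _ _ _.
by rewrite mulrA divfK ?gamma_neq0// mulfV ?mul1r.
Qed.

Lemma gfun_harm0 n p : hom n.+1 p -> lap p = 0 -> gfun gC p = 0.
Proof.
move=> hp lp; have := gfun_linform0 gC_rec (j := 0) (fun=> 0) hp lp.
by rewrite expr0 mulr1; apply.
Qed.

Definition conjp p : mpoly d R[i] := map_mpoly (@conjc R) p.

Lemma peval_conjp p x : peval (conjp p) x = (peval p x)^*%C.
Proof.
rewrite [in LHS](mpolyE p) /conjp raddf_sum /peval raddf_sum /= mevalE rmorph_sum.
apply: eq_bigr => m _; rewrite map_mpolyZ map_mpolyX mevalZ mevalX rmorphM rmorph_prod.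
by congr (_ * _); apply: eq_bigr => i _; rewrite rmorphXn; congr (_ ^+ _); rewrite [RHS]conjc_real.
Qed.

Lemma hom_conjp n p : hom n p -> hom n (conjp p).
Proof.
move=> /homP hp; apply/homP => m; rewrite mcoeff_msupp mcoeff_map_mpoly => h.
by apply: hp; rewrite mcoeff_msupp; apply: contra h => /eqP ->; rewrite raddf0.
Qed.

Lemma lap_conjp p : lap p = 0 -> lap (conjp p) = 0.
Proof.
have E i q : mderiv i (conjp q) = conjp (mderiv i q).
  by apply/mpolyP => m; rewrite mcoeff_deriv !mcoeff_map_mpoly mcoeff_deriv raddfMn.
move=> lp; rewrite /lap; under eq_bigr do rewrite !E.
by rewrite -raddf_sum -/(lap p) lp raddf0.
Qed.

Lemma sphere_orth n k p q : hom n p -> hom k q -> lap p = 0 -> lap q = 0 -> n != k ->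
  sphere_int (fun x => peval p x * (peval q x)^*%C) = 0.
Proof.
move=> hp hq lp lq nk.
rewrite (@eq_sphere_int _ _ _ (peval (p * conjp q))); last first.
  by move=> x _; rewrite pevalM peval_conjp.
rewrite (sphere_int_peval (homM hp (hom_conjp hq))).
by rewrite (gfun_orth gC_rec hp (hom_conjp hq) lp (lap_conjp lq) nk) mulr0.
Qed.

End SpherePolynomials.

(** * The Funk-Hecke formula *)

Section ExpiSeries.
Variable R : realType.
Implicit Types t : R.

Definition expi_coeff t (j : nat) : R[i] := (cos_coeff t j +i* sin_coeff t j)%C.

Lemma expi_coeffE t j : expi_coeff t j = ('i%C * t%:C%C) ^+ j / j`!%:R.
Proof.
rewrite exprMn -(rmorph_nat (real_complex R) j`!) -fmorphV -rmorphXn -mulrA -rmorphM /=.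
have -> : 'i%C ^+ j = (if odd j then (0 +i* (-1) ^+ j./2)%C else ((-1) ^+ j./2)%:C%C) :> R[i].
  rewrite -{1}(odd_double_half j) -mul2n exprD exprM sqr_i.
  have -> : (-1) ^+ j./2 = ((-1) ^+ j./2)%:C%C :> R[i] by rewrite rmorphXn rmorphN rmorph1.
  case: (odd j); last by rewrite expr0 mul1r.
  by rewrite expr1; apply: complex_eqP; rewrite ?cReM ?cImM/=; ring.
rewrite /expi_coeff /cos_coeff /sin_coeff; case: ifPn => oj; apply: complex_eqP;
  rewrite ?cReM ?cImM/= ?oj ?(negbTE oj) -?exprnP/=.
- by ring.
- rewrite (_ : j.-1./2 = j./2); first by ring.
  by case: j oj => //= j /negbTE oj; rewrite uphalf_half oj.
- by ring.
- by ring.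
Qed.

(** One of the two parts vanishes, so the taxicab norm is exact here; it makes the exponential
    series of [|t|] a majorant. *)
Lemma nc_expi_coeff t j : nc (expi_coeff t j) = exp_coeff `|t| j.
Proof.
rewrite /nc /expi_coeff /cos_coeff /sin_coeff /exp_coeff /=.
rewrite -exprnP !normrM !normrX normrN1 !expr1n !normfV !normr_nat.
by case: (odd j); rewrite /=; ring.
Qed.

Lemma series_exp_le t n : 0 <= t -> series (exp_coeff t) n <= expR t.
Proof.
move=> t0; have := @nondecreasing_cvgn_le R (series (exp_coeff t)).
rewrite /expR; apply; last first.
  exact: is_cvg_series_exp_coeff.
apply/nondecreasing_seqP => m; rewrite /series /= big_nat_recr//= lerDl.
exact: exp_coeff_ge0.
Qed.

Definition expi_sum t n : R[i] := \sum_(0 <= j < n) expi_coeff t j.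

Lemma nc_expi_sum t n : nc (expi_sum t n) <= expR `|t|.
Proof.
apply: le_trans (series_exp_le n (normr_ge0 t)).
rewrite /expi_sum /series /=; elim: n => [|n IH]; first by rewrite !big_geq// nc0.
by rewrite !big_nat_recr//= (le_trans (ncD _ _))// lerD// nc_expi_coeff.
Qed.

Lemma cvg_Re_expi_sum t : complex.Re (expi_sum t n) @[n --> \oo] --> cos t.
Proof.
rewrite (_ : (fun n => _) = series (cos_coeff t)); last first.
  apply/funext => n; rewrite /expi_sum /series /=; elim: n => [|n IH]; first by rewrite !big_geq.
  by rewrite !big_nat_recr//= cReD IH.
rewrite unlock; exact: is_cvg_series_cos_coeff.
Qed.

Lemma cvg_Im_expi_sum t : complex.Im (expi_sum t n) @[n --> \oo] --> sin t.
Proof.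
rewrite (_ : (fun n => _) = series (sin_coeff t)); last first.
  apply/funext => n; rewrite /expi_sum /series /=; elim: n => [|n IH]; first by rewrite !big_geq.
  by rewrite !big_nat_recr//= cImD IH.
rewrite unlock; exact: is_cvg_series_sin_coeff.
Qed.

Lemma nc_expi t : nc (expi t) <= 2.
Proof.
rewrite /nc /= [leRHS](_ : 2 = 1 + 1)// lerD//.
  by rewrite ler_norml cos_geN1 cos_le1.
by rewrite ler_norml sin_geN1 sin_le1.
Qed.

(** This turns convergence of integrals into a formula for the [limn] that defines the Bessel
    function. If [w = 0] both sides are zero whatever [limn u] is; otherwise [u n] is recovered as
    [(u n w) w^-1], so it converges and its limit has no imaginary part. *)
Lemma complex_lim (u : nat -> R) (w L : R[i]) :
  complex.Re ((u n)%:C%C * w) @[n --> \oo] --> complex.Re L ->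
  complex.Im ((u n)%:C%C * w) @[n --> \oo] --> complex.Im L ->
  L = (limn u)%:C%C * w.
Proof.
move=> cR cI; have [w0|w0] := eqVneq w 0.
  move: cR cI; rewrite w0; under eq_fun do rewrite mulr0.
  under [in X in _ -> X -> _]eq_fun do rewrite mulr0.
  move=> cR cI; rewrite mulr0; apply: complex_eqP.
    by rewrite -(cvg_lim _ cR)// lim_cst.
  by rewrite -(cvg_lim _ cI)// lim_cst.
pose v n := (u n)%:C%C * w; pose w' := w^-1.
have E n : (u n)%:C%C = v n * w' by rewrite /v mulfK.
have c1 : u n @[n --> \oo] --> complex.Re (L * w^-1).
  have -> : u = fun n => complex.Re (v n) * complex.Re w' - complex.Im (v n) * complex.Im w'.
    by apply/funext => n; rewrite -cReM -E.
  by rewrite cReM; apply: cvgB; apply: cvgMr_tmp.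
have c2 : (0 : R) @[n --> \oo] --> complex.Im (L * w^-1).
  have -> : (fun=> 0) = fun n =>
      complex.Re (v n) * complex.Im w' + complex.Im (v n) * complex.Re w'.
    by apply/funext => n /=; rewrite -cImM -E.
  by rewrite cImM; apply: cvgD; apply: cvgMr_tmp.
rewrite (cvg_lim _ c1)//; apply: (mulIf (invr_neq0 w0)); rewrite mulfK//.
apply: complex_eqP => //=.
by rewrite -(cvg_lim _ c2)// lim_cst.
Qed.

End ExpiSeries.

Section FunkHecke.
Variables (R : realType) (d : nat).
Hypothesis d_gt0 : (0 < d)%N.
Local Notation S := (@unit_sphere R d).
Local Notation sg := (@surface_measure R d).
Implicit Types (p q : mpoly d R[i]).

Lemma measurable_edot (r : 'rV[R]_d) : measurable_fun setT (fun x => edot x r).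
Proof.
apply: measurable_sum => i; apply: measurable_funM => //.
exact: (measurable_rV_coord i).
Qed.

Lemma continuous_measurable_cos : measurable_fun setT (@cos R).
Proof. by apply: continuous_measurable_fun => x; exact: continuous_cos. Qed.

Lemma continuous_measurable_sin : measurable_fun setT (@sin R).
Proof. by apply: continuous_measurable_fun => x; exact: continuous_sin. Qed.

Lemma cmeas_expi (k : R) (r : 'rV[R]_d) : cmeas (fun x => expi (k * edot x r)).
Proof.
have m : measurable_fun S (fun x => k * edot x r).
  by apply: measurable_funTS; apply: measurable_funM => //; exact: measurable_edot.
by split; [exact: measurableT_comp continuous_measurable_cos m|
  exact: measurableT_comp continuous_measurable_sin m].
Qed.

Definition rC (r : 'rV[R]_d) (i : 'I_d) : R[i] := (r ord0 i)%:C%C.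

Definition expi_poly (k : R) (r : 'rV[R]_d) (n : nat) : mpoly d R[i] :=
  \sum_(0 <= j < n) (('i%C * k%:C%C) ^+ j / j`!%:R) *: linform (rC r) ^+ j.

Lemma peval_expi_poly k r n x : peval (expi_poly k r n) x = expi_sum (k * edot x r) n.
Proof.
rewrite /expi_poly /expi_sum; elim: n => [|n IH].
  by rewrite !big_geq// /peval meval0.
rewrite !big_nat_recr//= pevalD IH; congr (_ + _).
rewrite pevalZ expi_coeffE /peval rmorphXn /= -/(peval _ x) peval_linform.
by rewrite rmorphM /= [in RHS]mulrA [in RHS]exprMn [RHS]mulrAC.
Qed.

(** On the sphere |k x.r| <= |k| |r| by Cauchy-Schwarz, so all partial sums of the plane wave are
    dominated by one constant. *)
Lemma funk_hecke_series (k : R) (r : 'rV[R]_d) p :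
  let L := sphere_int (fun x => peval p x * expi (k * edot x r)) in
  let u n := sphere_int (peval (p * expi_poly k r n)) in
  complex.Re (u n) @[n --> \oo] --> complex.Re L /\
  complex.Im (u n) @[n --> \oo] --> complex.Im L.
Proof.
move=> L u; have [M hM] := peval_bdd p.
apply: (@sphere_int_dom R d (fun n => peval (p * expi_poly k r n))
  (fun x => peval p x * expi (k * edot x r)) (fun=> M * expR (`|k| * enorm r))).
- by move=> n; exact: cmeas_peval.
- by apply: cmeasM; [exact: cmeas_peval|exact: cmeas_expi].
- exact: integrable_cst.
- move=> n x Sx; rewrite pevalM peval_expi_poly (le_trans (ncM _ _))//.
  apply: ler_pM; rewrite ?nc_ge0// ?hM// (le_trans (nc_expi_sum _ _))// ler_expR normrM.
  rewrite ler_wpM2l// (le_trans (cauchy_schwarz _ _))//.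
  by rewrite (Sx : enorm x = 1) mul1r.
- move=> x Sx; rewrite cReM /=.
  under eq_fun do rewrite pevalM peval_expi_poly cReM.
  by apply: cvgB; apply: cvgMl_tmp; [exact: cvg_Re_expi_sum|exact: cvg_Im_expi_sum].
- move=> x Sx; rewrite cImM /=.
  under eq_fun do rewrite pevalM peval_expi_poly cImM.
  by apply: cvgD; apply: cvgMl_tmp; [exact: cvg_Im_expi_sum|exact: cvg_Re_expi_sum].
Qed.

(** The factorial of [n + 2s] from the exponential series cancels the one in [gfun_linform]. The
    factor 2 and the gamma value come from [smom], the power of [sqrt pi] from [g 0 ^+ d]; the phase
    [i^n] is split off. *)
Definition fh_coeff (n : nat) (k : R) (r : 'rV[R]_d) (s : nat) : R :=
  2 * Num.sqrt pi ^+ d * (-1) ^+ s * k ^+ (n + s.*2) * enorm r ^+ (s.*2)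
  / (2 ^+ n * 4 ^+ s * s`!%:R * gamma ((n + (n + s.*2) + d)%:R / 2)).

(** By [gfun_linform0] only the exponents [j = n + 2s] survive, and truncation at order [n + 2N]
    keeps exactly those with [s < N]. *)
Lemma sphere_int_linform n (k : R) r p N : hom n p -> lap p = 0 ->
  sphere_int (peval (p * expi_poly k r (n + N.*2))) =
  (\sum_(0 <= s < N) fh_coeff n k r s)%:C%C * ('i%C ^+ n * peval p r).
Proof.
move=> hp lp.
pose c j : R[i] := ('i%C * k%:C%C) ^+ j / j`!%:R.
pose T j := c j * ((smom R d (n + j))%:C%C * gfun (gC R) (p * linform (rC r) ^+ j)).
have E M : sphere_int (peval (p * expi_poly k r M)) = \sum_(0 <= j < M) T j.
  elim: M => [|M IH].
    rewrite /expi_poly !big_geq// mulr0 -[RHS](sphere_int0 R d).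
    by apply: eq_sphere_int => x _; rewrite /peval meval0.
  rewrite big_nat_recr//= -IH -[T M]/(c M * _) -(sphere_int_peval d_gt0); last first.
    by apply: homM => //; rewrite -[X in hom X]mul1n; apply/homX/hom_linform.
  rewrite -sphere_intZ//; last exact: cint_peval.
  rewrite -sphere_intD//; [|exact: cint_peval|exact/cintZ/cint_peval].
  apply: eq_sphere_int => x _.
  by rewrite /expi_poly big_nat_recr//= mulrDr pevalD -scalerAr pevalZ.
have T0 j : (j < n)%N || odd (n + j) -> T j = 0.
  by move=> h; rewrite /T (gfun_linform0 (@gC_rec R) _ hp lp h) !mulr0.
have TE s : T (n + s.*2)%N = (fh_coeff n k r s)%:C%C * ('i%C ^+ n * peval p r).
  rewrite /T (gfun_linform (@gC_rec R) s (rC r) hp lp) -[meval _ _]/(peval p r).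
  have -> : \sum_i rC r i ^+ 2 = (enorm r ^+ 2)%:C%C.
    by rewrite sqr_enorm rmorph_sum; apply: eq_bigr => i _; rewrite rmorphM expr2.
  rewrite /c /gC gmom0 !mulrA; congr (_ * _).
  rewrite exprMn [X in X * _ ^+ _](_ : _ = 'i%C ^+ n * ((-1) ^+ s)%:C%C); last first.
    by rewrite exprD -mul2n exprM sqr_i rmorphXn rmorphN rmorph1.
  rewrite /fh_coeff /smom !(rmorphM, fmorphV, rmorphXn, rmorph_nat, rmorphN, rmorph1).
  have E2 (z : R[i]) : z ^+ s.*2 = (z * z) ^+ s by rewrite -mul2n exprM expr2.
  rewrite E2 /=; field.
  by rewrite fmorph_eq0 gamma_neq0// !expf_neq0 ?pnatr_eq0 -?lt0n ?fact_gt0.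
rewrite E rmorph_sum mulr_suml; elim: N => [|N IH].
  rewrite addn0 [RHS]big_geq// big_nat big1 => [//|j /andP[_ jn]].
  by rewrite T0 ?jn.
(* Two exponents are added, [n + 2N] and its successor; the latter has the wrong parity. *)
rewrite doubleS !addnS !big_nat_recr//= IH TE [T _.+1]T0 ?addr0//.
by rewrite !addnS/= addnA addnn oddD !odd_double orbT.
Qed.

End FunkHecke.

(** * Identification with the Bessel function *)

Section FunkHeckeBessel.
Variables (R : realType) (d : nat).
Hypothesis d_gt0 : (0 < d)%N.
Local Notation S := (@unit_sphere R d).
Local Notation sg := (@surface_measure R d).
Implicit Types (p q : mpoly d R[i]).

Definition bessel_term (nu z : R) (s : nat) : R :=
  (-1) ^+ s / (s`!%:R * gamma (s%:R + nu + 1)) * (z / 2) `^ (2 * s%:R + nu).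

Definition bessel_factor (z : R) : R := (2 * pi) `^ (d%:R / 2) / z `^ (d%:R / 2 - 1).

(** With nu = n + d/2 - 1 the argument s + nu + 1 is [(n + (n + 2s) + d)/2], so both sides contain
    the same gamma value. The factor [enorm r ^+ n] is what [p r] contributes beyond
    [p (direction r)]. *)
Lemma fh_coeff_bessel n (k : R) (r : 'rV[R]_d) s : 0 < k -> 0 < enorm r ->
  fh_coeff n k r s * enorm r ^+ n =
  bessel_term (n%:R + d%:R / 2 - 1) (k * enorm r) s * bessel_factor (k * enorm r).
Proof.
move=> k0 r0; set z := k * enorm r; have z0 : 0 < z by exact: mulr_gt0.
rewrite /fh_coeff /bessel_term /bessel_factor.
have -> : s%:R + (n%:R + d%:R / 2 - 1) + 1 = (n + (n + s.*2) + d)%:R / 2 :> R.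
  by rewrite -addnn !natrD; field.
have -> : 2 * s%:R + (n%:R + d%:R / 2 - 1) = (n + s.*2)%:R + (d%:R / 2 - 1) :> R.
  by rewrite -addnn !natrD; field.
have z2 : 0 < z / 2 by rewrite divr_gt0.
rewrite powRD; last by rewrite (gt_eqF z2)/= implybT.
rewrite powR_mulrn ?ltW//.
rewrite [(z / 2) `^ _]powRM ?invr_ge0// ?ltW//.
rewrite [(2 * pi) `^ _]powRM ?pi_ge0//.
have -> : pi `^ (d%:R / 2) = Num.sqrt pi ^+ d :> R.
  by rewrite -powR12_sqrt ?pi_ge0// -powR_mulrn ?powR_ge0// -powRrM mulrC.
(* The powers of 2 in (2 pi)^(d/2) and in (z/2)^(d/2-1) combine to the factor 2 that [fh_coeff] has
   from [smom]. *)
have e2 : 2 `^ (d%:R / 2) * 2^-1 `^ (d%:R / 2 - 1) = 2 :> R.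
  rewrite -(powR_inv1 (ler0n R 2)) -powRrM mulN1r -powRD; last by rewrite pnatr_eq0 implybT.
  by rewrite opprB addrC subrK powRr1.
have -> : k ^+ (n + s.*2) = z ^+ (n + s.*2) / enorm r ^+ (n + s.*2).
  by rewrite /z exprMn mulfK// expf_neq0// gt_eqF.
have z2s : 2 ^+ (n + s.*2) = 2 ^+ n * 4 ^+ s :> R.
  by rewrite exprD -mul2n exprM; congr (_ * _ ^+ _); rewrite -natrX.
have rs : enorm r ^+ (n + s.*2) = enorm r ^+ n * enorm r ^+ s.*2 by rewrite exprD.
rewrite expr_div_n z2s rs -[X in X * Num.sqrt pi ^+ d]e2.
have zp : z `^ (d%:R / 2 - 1) != 0 by rewrite gt_eqF// powR_gt0.
have rn : enorm r != 0 by rewrite gt_eqF.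
have g0 := @gamma_neq0 R d d_gt0 (n + (n + s.*2)).
move: (gamma _) g0 (_ `^ _) zp (_ `^ _) (_ `^ _) => G g0 Z zp A B.
move: (z ^+ _) (enorm r ^+ s.*2) (expf_neq0 s.*2 rn) (enorm r ^+ n) (expf_neq0 n rn).
move=> zz r1 h1 r2 h2.
field.
by rewrite zp g0 h1 h2 !expf_neq0 ?pnatr_eq0 -?lt0n ?fact_gt0.
Qed.

Lemma cvg_addn_double n : (n + N.*2)%N @[N --> \oo] --> \oo.
Proof.
apply/cvgnyPge => A; near=> N.
rewrite -addnn addnA; apply: leq_trans (leq_addl _ _).
by near: N; exact: nbhs_infty_ge.
Unshelve. all: by end_near. Qed.

(** Along the truncation orders [n + 2N] the approximating integrals are real partial sums of the
    Bessel series times a fixed complex number [w], so [complex_lim] gives the value of the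
    limit. *)
Lemma funk_hecke n p (k : R) (r : 'rV[R]_d) : hom n p -> lap p = 0 -> 0 < k -> r != 0 ->
  sphere_int (fun x => peval p x * expi (k * edot x r)) =
  'i%C ^+ n * ((sph_bessel d n (k * enorm r))%:C%C * peval p (direction r)).
Proof.
move=> hp lp k0 r0; have er0 : 0 < enorm r by rewrite enorm_gt0.
set L := sphere_int _; set z := k * enorm r.
have z0 : 0 < z by exact: mulr_gt0.
have [cR cI] := funk_hecke_series d_gt0 k r p.
pose w := (bessel_factor z)%:C%C * ('i%C ^+ n * peval p (direction r)).
pose u N := \sum_(0 <= s < N) bessel_term (n%:R + d%:R / 2 - 1) z s.
have E N : sphere_int (peval (p * expi_poly k r (n + N.*2))) = (u N)%:C%C * w.
  have H : (u N)%:C%C * (bessel_factor z)%:C%C =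
      (\sum_(0 <= s < N) fh_coeff n k r s)%:C%C * (enorm r ^+ n)%:C%C :> R[i].
    apply: complex_eqP; rewrite ?cReM ?cImM /= ?(mulr0, mul0r, addr0, subr0)//.
    by rewrite /u !mulr_suml; apply: eq_bigr => s _; rewrite fh_coeff_bessel.
  rewrite (sphere_int_linform d_gt0 k r N hp lp) -{2}(enormK r) (peval_hom _ _ hp) /w.
  by rewrite [RHS]mulrA H; ring.
have {}cR : complex.Re ((u N)%:C%C * w) @[N --> \oo] --> complex.Re L.
  by under eq_fun do rewrite -E; exact: (cvg_comp _ _ (cvg_addn_double n) cR).
have {}cI : complex.Im ((u N)%:C%C * w) @[N --> \oo] --> complex.Im L.
  by under eq_fun do rewrite -E; exact: (cvg_comp _ _ (cvg_addn_double n) cI).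
rewrite (complex_lim cR cI) /w.
have -> : sph_bessel d n z = limn u * bessel_factor z.
  by rewrite /sph_bessel gt_eqF// /sph_bessel_pos /bessel_factor mulrCA mulrA.
have -> : (limn u * bessel_factor z)%:C%C = (limn u)%:C%C * (bessel_factor z)%:C%C :> R[i].
  exact: rmorphM.
by move: (_%:C%C) (_%:C%C) => a b; ring.
Qed.

Lemma base_point_sphere : S (@base_point R d).
Proof.
rewrite /unit_sphere /= /enorm /edot (bigD1 (Ordinal d_gt0))//= big1 => [|i i0].
  by rewrite mxE /= mul1r addr0 sqrtr1.
by rewrite mxE (_ : (i == 0 :> nat) = false) ?mul0r//; apply/negbTE: i0.
Qed.

(** The Funk-Hecke formula for the constant polynomial at a unit vector. In this integral [z] can
    tend to 0 by dominated convergence, which yields [sph_bessel00]. *)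
Lemma sph_bessel0_int (z : R) : 0 < z ->
  (sph_bessel_pos d 0 z)%:C%C = sphere_int (fun x => expi (z * edot x (@base_point R d))).
Proof.
move=> z0; have S1 := base_point_sphere.
have b0 : @base_point R d != 0.
  by apply/eqP => b0; move: S1; rewrite b0 => /unit_sphereN0.
have h1 : hom 0 (1 : mpoly d R[i]) by exact: dhomog1.
have := funk_hecke h1 (lap_hom0 h1) z0 b0; rewrite expr0 mul1r (S1 : enorm _ = 1) mulr1.
rewrite /peval meval1 mulr1 /sph_bessel gt_eqF// => <-.
by apply: eq_sphere_int => x _; rewrite meval1 mul1r.
Qed.

Lemma sph_bessel00 : (sph_bessel d 0 0)%:C%C = sphere_int (fun _ : 'rV[R]_d => 1) :> R[i].
Proof.
rewrite /sph_bessel eqxx.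
suff c : sph_bessel_pos d 0 x @[x --> 0^'+] -->
    complex.Re (sphere_int (fun _ : 'rV[R]_d => 1 : R[i])).
  by rewrite (cvg_lim _ c)//; apply: complex_eqP => //=; rewrite /Rintegral integral0.
apply/cvg_at_rightP => v [v0 cv].
have -> : (fun n => sph_bessel_pos d 0 (v n)) =
    fun n => complex.Re (sphere_int (fun x => expi (v n * edot x (@base_point R d)))).
  by apply/funext => n; rewrite -sph_bessel0_int.
have c0 (x : 'rV[R]_d) : v n * edot x (@base_point R d) @[n --> \oo] --> (0 : R).
  by rewrite -[X in _ --> X](mul0r (edot x (@base_point R d))); exact: cvgMr_tmp.
have [||||||cR _] := @sphere_int_dom R d (fun n x => expi (v n * edot x (@base_point R d)))
  (fun=> 1) (fun=> 2).
- by move=> n; exact: cmeas_expi.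
- exact: cmeas_cst.
- exact: integrable_cst.
- by move=> n x _; exact: nc_expi.
- move=> x _ /=; rewrite -cos0; apply: (cvg_comp _ _ (c0 x)); exact: continuous_cos.
- move=> x _ /=; rewrite -sin0; apply: (cvg_comp _ _ (c0 x)); exact: continuous_sin.
exact: cR.
Qed.

Lemma expi0 : expi 0 = 1 :> R[i]. Proof. by rewrite /expi cos0 sin0. Qed.

(** Off the origin this is [funk_hecke] with the phase cancelled. At the origin the plane wave is 1:
    for [n = 0] the integral is a constant times the surface area, and for positive [n] it vanishes
    because a harmonic [p] is orthogonal to constants. *)
Lemma psi_fun_int n p (k : R) Y (r : 'rV[R]_d) : hom n p -> lap p = 0 ->
  (forall x, S x -> Y x = peval p x) -> 0 < k ->
  psi_fun k n Y r = sphere_int (fun x => (- 'i%C) ^+ n * Y x * expi (k * edot x r)).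
Proof.
move=> hp lp YE k0.
have ip : cint (fun x => peval p x * expi (k * edot x r)).
  apply: (cintM_bdd (M := 2)); first exact: cint_peval.
    exact: cmeas_expi.
  by move=> x _; exact: nc_expi.
have -> : sphere_int (fun x => (- 'i%C) ^+ n * Y x * expi (k * edot x r)) =
    (- 'i%C) ^+ n * sphere_int (fun x => peval p x * expi (k * edot x r)).
  by rewrite -sphere_intZ//; apply: eq_sphere_int => x Sx; rewrite YE// mulrA.
have iN : (- 'i%C) * 'i%C = 1 :> R[i] by rewrite mulNr -expr2 sqr_i opprK.
rewrite /psi_fun; have [->|r0] := eqVneq r 0; last first.
  rewrite (funk_hecke hp lp k0 r0) [RHS]mulrA -exprMn iN expr1n mul1r YE//.
  exact: unit_sphere_direction.
have -> : sphere_int (fun x => peval p x * expi (k * edot x 0)) = sphere_int (peval p).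
  apply: eq_sphere_int => x _; rewrite /edot big1 ?mulr0 ?expi0 ?mulr1//.
  by move=> i _; rewrite mxE mulr0.
case: n hp ip => [|n] hp ip /=.
  rewrite expr0 mul1r sph_bessel00 YE; last exact: base_point_sphere.
  rewrite (hom0_const hp); set c := mcoeff _ _.
  transitivity (sphere_int (fun _ : 'rV[R]_d => c * 1)); last first.
    by apply: eq_sphere_int => x _; rewrite pevalC mulr1.
  rewrite sphere_intZ ?pevalC 1?mulrC//.
  by apply: (cint_bdd d_gt0 (M := nc 1)); first exact: cmeas_cst.
by rewrite (sphere_int_peval d_gt0 hp) (gfun_harm0 hp lp) !mulr0.
Qed.

End FunkHeckeBessel.

(** * Density of the polynomials *)

Section ThresholdPolynomials.
Variable R : realType.
Implicit Types u : R.

Lemma bernoulli_le (x : R) n : 0 <= x <= 1 -> 1 - n%:R * x <= (1 - x) ^+ n.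
Proof.
move=> /andP[x0 x1]; elim: n => [|n IH]; first by rewrite mul0r subr0 expr0.
rewrite exprS; apply: (@le_trans _ _ ((1 - x) * (1 - n%:R * x))); last first.
  by rewrite ler_wpM2l// subr_ge0.
have : 0 <= n%:R * x * x by rewrite !mulr_ge0.
by rewrite -natr1; lra.
Qed.

Lemma one_minus_pow_le (x : R) n : 0 <= x <= 1 -> (1 - x) ^+ n <= expR (- (n%:R * x)).
Proof.
move=> /andP[x0 x1]; rewrite -mulrN mulrC expRM_natr.
by rewrite lerXn2r ?nnegrE ?expR_ge0 ?subr_ge0// expR_ge1Dx.
Qed.

(** With [z = s^2], one factor s^n tames [n], since n s^n is at most the geometric sum (1 - s^n)/(1
    - s); the other tends to 0. *)
Lemma natr_exp_cvg0 (z : R) : 0 <= z < 1 -> n%:R * z ^+ n @[n --> \oo] --> (0 : R).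
Proof.
move=> /andP[z0 z1]; pose s := Num.sqrt z.
have s0 : 0 <= s by exact: sqrtr_ge0.
have s1 : s < 1 by rewrite -sqrtr1 ltr_sqrt.
have zs : z = s ^+ 2 by rewrite sqr_sqrtr.
have b n : n%:R * s ^+ n * (1 - s) <= 1.
  suff h : n%:R * s ^+ n * (1 - s) <= 1 - s ^+ n.
    by rewrite (le_trans h)// gerBl exprn_ge0.
  elim: n => [|n IH]; first by rewrite mul0r mul0r expr0 subrr.
  have sn : 0 <= s ^+ n by rewrite exprn_ge0.
  have sn1 : s ^+ n.+1 <= s ^+ n by rewrite exprS ler_piMl// ltW.
  have := ler_wpM2l s0 IH.
  have e1 : s * (n%:R * s ^+ n * (1 - s)) = n%:R * s ^+ n.+1 * (1 - s) by rewrite exprS; ring.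
  have -> : s * (1 - s ^+ n) = s - s ^+ n.+1 by rewrite exprS mulrBr mulr1.
  rewrite e1 -natr1 => h.
  have : s ^+ n.+1 * (1 - s) <= 1 - s by rewrite ler_piMl ?subr_ge0 ?(ltW s1)// exprn_ile1// ltW.
  by rewrite !mulrDl mul1r; lra.
apply: (@squeeze_cvgr _ _ _ _ (cst 0) (fun n => s ^+ n / (1 - s))).
- near=> n; rewrite mulr_ge0 ?exprn_ge0//=.
  rewrite ler_pdivlMr ?subr_gt0// zs -exprM mul2n -addnn exprD mulrA mulrAC.
  by rewrite ler_piMl ?exprn_ge0// b.
- exact: cvg_cst.
- rewrite -(mul0r (1 - s)^-1); apply: cvgMr_tmp; apply: cvg_expr; by rewrite ger0_norm.
Unshelve. all: by end_near. Qed.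

(** Heuristically (1 - v)^M is e^(-M v), and here M v = n (2u)^n tends to 0 for [u < 1/2] and to
    infinity otherwise: polynomials in [u] converging on [0, 1] to a step function. *)
Definition threshold n u : R := (1 - u ^+ n) ^+ (n * 2 ^ n).

Lemma threshold_itv n u : 0 <= u <= 1 -> 0 <= threshold n u <= 1.
Proof.
move=> /andP[u0 u1]; have : 0 <= u ^+ n <= 1 by rewrite exprn_ge0// exprn_ile1.
move=> /andP[a b]; rewrite exprn_ge0 ?subr_ge0//= exprn_ile1 ?subr_ge0//.
by rewrite gerBl.
Qed.

(* The exponent [n 2^n] rather than [2^n] makes the limit at [u = 1/2] equal to [0]
   instead of [1/e]. *)
Lemma threshold_cvg u : 0 <= u <= 1 ->
  threshold n u @[n --> \oo] --> ((u < 2^-1)%R%:R : R).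
Proof.
move=> /andP[u0 u1].
have un n : 0 <= u ^+ n <= 1 by rewrite exprn_ge0// exprn_ile1.
have E n : (n * 2 ^ n)%:R * u ^+ n = n%:R * (2 * u) ^+ n :> R.
  by rewrite natrM natrX exprMn mulrA.
have [u2|u2] := ltP u 2^-1 => /=.
  apply: (@squeeze_cvgr _ _ _ _ (fun n => 1 - n%:R * (2 * u) ^+ n) (cst 1)).
  - near=> n; rewrite -E bernoulli_le//=.
    by have /andP[] : 0 <= threshold n u <= 1 by apply: threshold_itv; rewrite u0.
  - rewrite -[X in _ --> X](subr0 (1 : R)); apply: cvgB; first exact: cvg_cst.
    apply: natr_exp_cvg0; rewrite mulr_ge0//=; lra.
  - exact: cvg_cst.
apply: (@squeeze_cvgr _ _ _ _ (cst 0) (fun n => expR (- n%:R))).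
- near=> n; have /andP[t0 _] : 0 <= threshold n u <= 1 by apply: threshold_itv; rewrite u0.
  rewrite t0/= (le_trans (one_minus_pow_le _ (un n)))// ler_expR lerN2 E ler_peMr//.
  by rewrite exprn_ege1//; lra.
- exact: cvg_cst.
- exact: (cvg_comp _ _ cvgr_idn (@cvgr_expR R)).
Unshelve. all: by end_near. Qed.

End ThresholdPolynomials.

Section L2Density.
Variables (R : realType) (d : nat).
Hypothesis d_gt0 : (0 < d)%N.
Local Notation S := (@unit_sphere R d).
Local Notation sg := (@surface_measure R d).
Implicit Types (f g h q : 'rV[R]_d -> R) (A B : set 'rV[R]_d).

Let mS : measurable S := @measurable_unit_sphere R d.

Definition pol q : Prop :=
  exists p : mpoly d R[i], forall x, S x -> (q x)%:C%C = peval p x.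

Lemma pol_cst c : pol (fun=> c).
Proof. by exists (mpolyC d c%:C%C) => x _; rewrite pevalC. Qed.

Lemma polD f g : pol f -> pol g -> pol (fun x => f x + g x).
Proof.
move=> [p hp] [q hq]; exists (p + q) => x Sx.
by rewrite pevalD -hp// -hq// rmorphD.
Qed.

Lemma polM f g : pol f -> pol g -> pol (fun x => f x * g x).
Proof.
move=> [p hp] [q hq]; exists (p * q) => x Sx.
by rewrite pevalM -hp// -hq// rmorphM.
Qed.

Lemma polN f : pol f -> pol (fun x => - f x).
Proof.
move=> pf; have := polM (pol_cst (-1)) pf.
by under eq_fun do rewrite mulN1r.
Qed.

Lemma polX f n : pol f -> pol (fun x => f x ^+ n).
Proof.
move=> pf; elim: n => [|n IH]; first by under eq_fun do rewrite expr0; exact: pol_cst.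
by under eq_fun do rewrite exprS; exact: polM.
Qed.

Lemma pol_coord (i : 'I_d) : pol (fun x => x ord0 i).
Proof. by exists (mpolyX R[i] (mnm1 i)) => x _; rewrite pevalXU. Qed.

Lemma measurable_pol q : pol q -> measurable_fun S q.
Proof.
move=> [p hp]; have [m _] := @cmeas_peval R d p.
by apply: eq_measurable_fun m => x; rewrite inE => Sx; rewrite -hp.
Qed.

Definition dist2 f g : \bar R := (\int[sg]_(x in S) ((f x - g x) ^+ 2)%:E)%E.

Lemma measurable_sqrB f g : measurable_fun S f -> measurable_fun S g ->
  measurable_fun S (fun x => ((f x - g x) ^+ 2)%:E).
Proof.
by move=> mf mg; apply/measurable_EFinP; apply: measurable_funX; exact: measurable_funB.
Qed.

Lemma le_dist2 f g f1 g1 f2 g2 :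
  measurable_fun S f -> measurable_fun S g -> measurable_fun S f1 ->
  measurable_fun S g1 -> measurable_fun S f2 -> measurable_fun S g2 ->
  (forall x, S x -> (f x - g x) ^+ 2 <= 2 * (f1 x - g1 x) ^+ 2 + 2 * (f2 x - g2 x) ^+ 2) ->
  (dist2 f g <= 2%:E * dist2 f1 g1 + 2%:E * dist2 f2 g2)%E.
Proof.
move=> mf mg mf1 mg1 mf2 mg2 h; have m1 := measurable_sqrB mf1 mg1.
have m2 := measurable_sqrB mf2 mg2.
rewrite /dist2 -!ge0_integralZl//; try by move=> x _; rewrite lee_fin sqr_ge0.
rewrite -ge0_integralD//; last 4 first.
- by move=> x _; rewrite mule_ge0// lee_fin ?sqr_ge0.
- exact: measurable_funeM.
- by move=> x _; rewrite mule_ge0// lee_fin ?sqr_ge0.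
- exact: measurable_funeM.
apply: ge0_le_integral => //.
- by move=> x _; rewrite lee_fin sqr_ge0.
- exact: measurable_sqrB.
- by apply: emeasurable_funD; exact: measurable_funeM.
Qed.

(** The quarters come from (a + b)^2 <= 2 a^2 + 2 b^2. *)
Lemma dist2_small f g f1 g1 f2 g2 (e : R) :
  measurable_fun S f -> measurable_fun S g -> measurable_fun S f1 ->
  measurable_fun S g1 -> measurable_fun S f2 -> measurable_fun S g2 ->
  (forall x, S x -> (f x - g x) ^+ 2 <= 2 * (f1 x - g1 x) ^+ 2 + 2 * (f2 x - g2 x) ^+ 2) ->
  (dist2 f1 g1 < (e / 4)%:E)%E -> (dist2 f2 g2 < (e / 4)%:E)%E -> (dist2 f g < e%:E)%E.
Proof.
move=> mf mg mf1 mg1 mf2 mg2 h d1 d2.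
apply: (le_lt_trans (le_dist2 mf mg mf1 mg1 mf2 mg2 h)).
have -> : e = 2 * (e / 4) + 2 * (e / 4) by field.
rewrite -[ltRHS]/(2%:E * (e / 4)%:E + 2%:E * (e / 4)%:E)%E; apply: lteD; rewrite lte_pmul2l//.
Qed.

Lemma dist2_tri f g h (e : R) :
  measurable_fun S f -> measurable_fun S g -> measurable_fun S h ->
  (dist2 f g < (e / 4)%:E)%E -> (dist2 g h < (e / 4)%:E)%E -> (dist2 f h < e%:E)%E.
Proof.
move=> mf mg mh; apply: dist2_small => // x _.
by have := sqr_ge0 ((f x - g x) - (g x - h x)); lra.
Qed.

Lemma dist2_dom (fn : nat -> 'rV[R]_d -> R) f (w : 'rV[R]_d -> R) :
  (forall n, measurable_fun S (fn n)) -> measurable_fun S f ->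
  sg.-integrable S (EFin \o w) ->
  (forall n x, S x -> (f x - fn n x) ^+ 2 <= w x) ->
  (forall x, S x -> fn n x @[n --> \oo] --> f x) ->
  forall e : R, 0 < e -> exists n, (dist2 f (fn n) < e%:E)%E.
Proof.
move=> mfn mf wi hw c e e0.
have c' x : S x -> ((f x - fn n x) ^+ 2)%:E @[n --> \oo] --> (0 : \bar R)%E.
  move=> Sx; apply: cvg_EFin; first exact: nearW.
  have h : (f x - fn n x) * (f x - fn n x) @[n --> \oo] --> (f x - f x) * (f x - f x).
    by apply: cvgM; apply: cvgB; [exact: cvg_cst|exact: c|exact: cvg_cst|exact: c].
  by move: h; rewrite subrr mul0r; exact.
have [|||||_ _ D] := @dominated_convergence _ _ _ sg S mS
  (fun n x => ((f x - fn n x) ^+ 2)%:E) (cst 0)%E (EFin \o w).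
- by move=> n; exact: measurable_sqrB.
- exact: measurable_cst.
- exact: aeW.
- exact: wi.
- by apply: aeW => x n Sx; rewrite /= lee_fin ger0_norm ?sqr_ge0// hw.
move: D; rewrite integral0 => D.
have [F1 F2] := (fine_cvgP _ _).1 D.
have /cvgrPdist_lt/(_ _ e0) F3 := F2.
have [N _ hN] := filterI F1 F3.
have [N1 N2] := hN N (leqnn N); exists N.
have N1' : dist2 f (fn N) \is a fin_num by exact: N1.
rewrite -(fineK N1') lte_fin; move: N2; rewrite /= sub0r normrN.
by apply: le_lt_trans; exact: ler_norm.
Qed.

(** The bounds on [q] are what makes intersections work: in 1_A 1_B - q r = 1_B (1_A - q) + q (1_B -
    r) both multipliers lie in [0, 1]. *)
Definition pol_approx_set A : Prop := measurable A /\ forall e : R, 0 < e ->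
  exists q, [/\ pol q, forall x, S x -> 0 <= q x <= 1 &
    (dist2 (\1_A) q < e%:E)%E].

Let mind A : measurable A -> measurable_fun S (\1_A : _ -> R).
Proof. by move=> mA; exact: measurable_indic. Qed.

Lemma pol_approx_setC A : pol_approx_set A -> pol_approx_set (~` A).
Proof.
move=> [mA hA]; split; first exact: measurableC.
move=> e /hA[q [pq q01 dq]]; exists (fun x => 1 - q x); split.
- by apply: polD; [exact: pol_cst|exact: polN].
- by move=> x /q01; lra.
- rewrite /dist2 (_ : (fun x => _) = (fun x => ((\1_A x - q x) ^+ 2)%:E))//.
  apply/funext => x; rewrite !indicE in_setC; case: (_ \in _) => /=; congr EFin; ring.
Qed.

Lemma pol_approx_setI A B : pol_approx_set A -> pol_approx_set B -> pol_approx_set (A `&` B).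
Proof.
move=> [mA hA] [mB hB]; split; first exact: measurableI.
move=> e e0; have e4 : 0 < e / 4 by rewrite divr_gt0.
have [q [pq q01 dq]] := hA _ e4; have [r [pr r01 dr]] := hB _ e4.
exists (fun x => q x * r x); split.
- exact: polM.
- by move=> x Sx; have := q01 x Sx; have := r01 x Sx; nra.
- apply: (dist2_small _ _ _ _ _ _ _ dq dr) => //; try exact: mind; try exact: measurable_pol.
  + by apply: mind; exact: measurableI.
  + by apply: measurable_pol; exact: polM.
  move=> x Sx; rewrite indicI /=.
  have : 0 <= (\1_B x : R) <= 1 by rewrite indicE; case: (_ \in _); rewrite /= ?lexx ?ler01.
  have /andP[q0 q1] := q01 x Sx; have /andP[r0 r1] := r01 x Sx => /andP[b0 b1].
  set a := \1_A x; set b := \1_B x.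
  have -> : a * b - q x * r x = b * (a - q x) + q x * (b - r x) by ring.
  have h1 : (b * (a - q x)) ^+ 2 <= (a - q x) ^+ 2.
    by rewrite exprMn ler_piMl ?sqr_ge0// exprn_ile1.
  have h2 : (q x * (b - r x)) ^+ 2 <= (b - r x) ^+ 2.
    by rewrite exprMn ler_piMl ?sqr_ge0// exprn_ile1.
  by have := sqr_ge0 (b * (a - q x) - q x * (b - r x)); lra.
Qed.

Lemma pol_approx_set_lim (F : nat -> set 'rV[R]_d) A :
  measurable A -> (forall n, pol_approx_set (F n)) ->
  (forall x, (\1_(F n) x : R) @[n --> \oo] --> (\1_A x : R)) -> pol_approx_set A.
Proof.
move=> mA hF c; split => // e e0; have e4 : 0 < e / 4 by rewrite divr_gt0.
have [n dn] : exists n, (dist2 (\1_A) (\1_(F n)) < (e / 4)%:E)%E.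
  apply: (@dist2_dom (fun n => \1_(F n)) _ (fun=> 1)) => //.
  - by move=> n; apply: mind; have [] := hF n.
  - exact: integrable_cst.
have [mF /(_ _ e4)[q [pq q01 dq]]] := hF n.
exists q; split => //; apply: (dist2_tri _ _ _ dn dq); [exact: mind..|exact: measurable_pol].
Qed.

Lemma pol_approx_set0 : pol_approx_set set0.
Proof.
split => // e e0; exists (fun=> 0); split; first exact: pol_cst.
- by move=> x _; rewrite lexx ler01.
- rewrite /dist2 (_ : (fun x => _) = (fun=> 0%E)) ?integral0 ?lte_fin//.
  by apply/funext => x; rewrite indic0 subrr expr0n.
Qed.

(** Finite unions come from complements and intersections; a countable union is the pointwise limit
    of finite ones, which dominated convergence handles. *)
Lemma sigma_algebra_pol_approx : sigma_algebra setT pol_approx_set.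
Proof.
split; first exact: pol_approx_set0.
  by move=> A hA; rewrite setTD; exact: pol_approx_setC.
move=> F hF.
have hG n : pol_approx_set (\big[setU/set0]_(i < n) F i).
  elim: n => [|n IH]; first by rewrite big_ord0; exact: pol_approx_set0.
  rewrite big_ord_recr /= -[X in pol_approx_set X]setCK setCU.
  by apply: pol_approx_setC; apply: pol_approx_setI; exact: pol_approx_setC.
apply: (pol_approx_set_lim _ hG); first by apply: bigcup_measurable => n _; have [] := hF n.
move=> x; rewrite [X in _ --> X]indicE; case: (boolP (x \in _)) => xF.
  move: xF; rewrite inE => -[k _ Fkx]; apply: cvg_near_cst; exists k.+1 => // n /= kn.
  by rewrite indicE mem_set// -bigcup_mkord; exists k.
apply: cvg_near_cst; apply: nearW => n; rewrite indicE memNset// -bigcup_mkord => -[k _ Fkx].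
by move/negP: xF; apply; rewrite inE; exists k.
Qed.

Lemma pol_approx_halfspace (i : 'I_d) (a : R) : pol_approx_set [set x : 'rV[R]_d | x ord0 i < a].
Proof.
set A := [set _ | _].
have mA : measurable A.
  rewrite -[X in measurable X]setTI; apply: measurable_fun_ltr => //.
  exact: (measurable_rV_coord i).
(* On the sphere |x_i - a| <= 1 + |a| = c/2, so the affine function [u] maps it into [0, 1] and
   takes the value 1/2 where [x_i = a]. *)
split=> // e e0; pose c := 2 * (1 + `|a|).
have c0 : 0 < c by rewrite mulr_gt0// ltr_pwDl.
pose u (x : 'rV[R]_d) := 2^-1 + (x ord0 i - a) / c.
have u01 x : S x -> 0 <= u x <= 1.
  move=> Sx; have := unit_sphere_coord i Sx; rewrite /u ler_norml => /andP[x1 x2].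
  have h : - 2^-1 <= (x ord0 i - a) / c <= 2^-1.
    rewrite ler_pdivlMr// ler_pdivrMr//.
    have := ler_norm a; have := ler_norm (- a); rewrite normrN /c; lra.
  by lra.
have uA x : (u x < 2^-1) = (x ord0 i < a).
  rewrite /u -[ltRHS]addr0 ltrD2l pmulr_llt0 ?invr_gt0// subr_lt0.
  by [].
have pu : pol u.
  apply: polD; first exact: pol_cst.
  apply: polM; last exact: pol_cst.
  by apply: polD; [exact: pol_coord|exact: pol_cst].
have pt n : pol (fun x => threshold n (u x)).
  by apply: polX; apply: polD; [exact: pol_cst|apply: polN; exact: polX].
have [n dn] : exists n, (dist2 (\1_A) (fun x => threshold n (u x)) < e%:E)%E.
  apply: (@dist2_dom (fun n x => threshold n (u x)) _ (fun=> 1)) => //.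
  - by move=> n; exact: measurable_pol.
  - exact: integrable_cst.
  - move=> n x Sx; have /andP[t0 t1] := threshold_itv n (u01 x Sx).
    rewrite -[leRHS](expr1n _ 2) -[X in X <= _]real_normK ?num_real// lerXn2r ?nnegrE//.
    rewrite ler_norml indicE; case: (_ \in _); rewrite /=; lra.
  - move=> x Sx; have := threshold_cvg (u01 x Sx); rewrite uA indicE.
    by rewrite (_ : (x \in A) = (x ord0 i < a))//; apply/idP/idP; rewrite inE.
by exists (fun x => threshold n (u x)); split => // x Sx; exact/threshold_itv/u01.
Qed.

Lemma measurable_pol_approx A : measurable A -> pol_approx_set A.
Proof.
suff : measurable `<=` pol_approx_set by exact.
apply: smallest_sub; first exact: sigma_algebra_pol_approx.
rewrite -bigcup_seq => B [i _] [C mC <-] /=; rewrite setTI.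
have [sa0 saC saU] := sigma_algebra_pol_approx.
(* The Borel sets of the line are generated by the rays ]-oo, a[, whose preimages are the
   half-spaces above. *)
suff : (@ocitv R).-sigma.-measurable `<=`
    [set C : set R | pol_approx_set (@rV_coord R d i @^-1` C)] by exact.
rewrite RGenInftyO.measurableE; apply: smallest_sub.
  split => /=.
  - by rewrite preimage_set0.
  - by move=> D; rewrite setTD preimage_setC; exact: pol_approx_setC.
  - by move=> F hF; rewrite preimage_bigcup; exact: saU.
move=> D [a ->] /=.
rewrite (_ : _ @^-1` _ = [set x : 'rV[R]_d | x ord0 i < a]); first exact: pol_approx_halfspace.
by apply/seteqP; split => x /=; rewrite in_itv.
Qed.

End L2Density.

(** * From indicators to square-integrable functions *)

Section L2Closure.
Import HBNNSimple.
Variables (R : realType) (d : nat).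
Hypothesis d_gt0 : (0 < d)%N.
Local Notation S := (@unit_sphere R d).
Local Notation sg := (@surface_measure R d).
Implicit Types (f g h q : 'rV[R]_d -> R) (A B : set 'rV[R]_d).

Let mS : measurable S := @measurable_unit_sphere R d.

Definition pol_approx f : Prop :=
  forall e : R, 0 < e -> exists2 q, pol q & (dist2 f q < e%:E)%E.

Lemma pol_approx_indic A : measurable A -> pol_approx (\1_A).
Proof.
by move=> mA e e0; have [_ /(_ _ e0)[q [pq _ dq]]] := measurable_pol_approx d_gt0 mA; exists q.
Qed.

Lemma pol_approxD f g : measurable_fun S f -> measurable_fun S g ->
  pol_approx f -> pol_approx g -> pol_approx (fun x => f x + g x).
Proof.
move=> mf mg hf hg e e0; have e4 : 0 < e / 4 by rewrite divr_gt0.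
have [q pq dq] := hf _ e4; have [r pr dr] := hg _ e4.
exists (fun x => q x + r x); first exact: polD.
have mq := measurable_pol pq; have mr := measurable_pol pr.
apply: (dist2_small _ _ _ _ _ _ _ dq dr) => //; try exact: measurable_funD.
by move=> x _; have := sqr_ge0 ((f x - q x) - (g x - r x)); lra.
Qed.

Lemma pol_approxZ c f : measurable_fun S f ->
  pol_approx f -> pol_approx (fun x => c * f x).
Proof.
(* Adding 1 to [c^2] makes the division safe when [c = 0]. *)
move=> mf hf e e0; have c1 : 0 < c ^+ 2 + 1 by rewrite ltr_wpDl// sqr_ge0.
have [q pq dq] := hf (e / (c ^+ 2 + 1)) (divr_gt0 e0 c1).
exists (fun x => c * q x); first by apply: polM => //; exact: pol_cst.
have mq := measurable_pol pq.
have -> : dist2 (fun x => c * f x) (fun x => c * q x) = ((c ^+ 2)%:E * dist2 f q)%E.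
  rewrite /dist2 -ge0_integralZl//.
  - by apply: eq_integral => x _; rewrite -mulrBr exprMn EFinM.
  - exact: measurable_sqrB.
  - by move=> x _; rewrite lee_fin sqr_ge0.
  - by rewrite lee_fin sqr_ge0.
have d0 : (0 <= dist2 f q)%E by apply: integral_ge0 => x _; rewrite lee_fin sqr_ge0.
apply: (@le_lt_trans _ _ ((c ^+ 2 + 1)%:E * dist2 f q)%E).
  by rewrite lee_wpmul2r// lee_fin lerDl.
rewrite -(@lte_pmul2l _ (c ^+ 2 + 1)^-1%:E)// ?lte_fin ?invr_gt0//.
by rewrite muleA -!EFinM mulVf ?gt_eqF// mul1e mulrC.
Qed.

Lemma pol_approx_nnsfun (h : {nnsfun 'rV[R]_d >-> R}) : pol_approx h.
Proof.
have -> : (h : _ -> R) = fun x => \sum_(y <- fset_set (range h)) (y * \1_(h @^-1` [set y]) x).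
  by apply/funext => x; rewrite fimfunE fsbig_finite.
have mt (y : R) : measurable_fun S (fun x => y * \1_(h @^-1` [set y]) x).
  by apply: measurable_funM => //; exact: measurable_indic.
suff P (s : seq R) : measurable_fun S (fun x => \sum_(y <- s) (y * \1_(h @^-1` [set y]) x)) /\
    pol_approx (fun x => \sum_(y <- s) (y * \1_(h @^-1` [set y]) x)).
  by have [] := P (fset_set (range h)).
elim: s => [|y s [m IH]].
  have -> : (fun x : 'rV[R]_d => \sum_(y <- [::]) (y * \1_(h @^-1` [set y]) x)) = fun=> 0.
    by apply/funext => x; rewrite big_nil.
  split; first exact: measurable_cst.
  move=> e e0; exists (fun=> 0); first exact: pol_cst.
  by rewrite /dist2; under eq_integral do rewrite subrr expr0n; rewrite integral0 lte_fin.
have -> : (fun x : 'rV[R]_d => \sum_(y <- y :: s) (y * \1_(h @^-1` [set y]) x)) =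
  fun x => y * \1_(h @^-1` [set y]) x + \sum_(y <- s) (y * \1_(h @^-1` [set y]) x).
  by apply/funext => x; rewrite big_cons.
split; first exact: measurable_funD.
apply: pol_approxD => //; apply: pol_approxZ; first exact: measurable_indic.
exact: pol_approx_indic.
Qed.

Lemma pol_approx_ge0 f : measurable_fun S f -> (forall x, S x -> 0 <= f x) ->
  sg.-integrable S (EFin \o (fun x => f x ^+ 2)) -> pol_approx f.
Proof.
move=> mf f0 fi e e0; have e4 : 0 < e / 4 by rewrite divr_gt0.
have mEf : measurable_fun S (EFin \o f) by exact/measurable_EFinP.
pose a n : {nnsfun 'rV[R]_d >-> R} := nnsfun_approx mS mEf n.
have ca x : S x -> a n x @[n --> \oo] --> f x.
  move=> Sx; have h := cvg_nnsfun_approx mS mEf (fun x Sx => f0 x Sx) Sx.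
  by have [_] := (fine_cvgP _ _).1 h.
have ma n : measurable_fun S (a n) by exact: measurable_funTS.
have [n dn] : exists n, (dist2 f (a n) < (e / 4)%:E)%E.
  (* The majorant is [f^2], because 0 <= a n <= f bounds (f - a n)^2 by it. *)
  apply: (dist2_dom ma mf fi) => // n x Sx.
  have a0 : 0 <= a n x by exact: fun_ge0.
  have af : a n x <= f x.
    rewrite -(cvg_lim _ (ca x Sx))//; apply: nondecreasing_cvgn_le.
      by move=> i j ij; exact/lefP/nd_nnsfun_approx.
    by apply/cvg_ex; exists (f x); exact: ca.
  by rewrite lerXn2r ?nnegrE ?subr_ge0 ?f0// gerBl.
have [q pq dq] := pol_approx_nnsfun (a n) e4.
by exists q => //; apply: (dist2_tri _ _ _ dn dq) => //; exact: measurable_pol.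
Qed.

Lemma pol_approx_L2 f : measurable_fun S f ->
  sg.-integrable S (EFin \o (fun x => f x ^+ 2)) -> pol_approx f.
Proof.
move=> mf fi.
have P (g : 'rV[R]_d -> R) : measurable_fun S g -> (forall x, 0 <= g x <= `|f x|) -> pol_approx g.
  move=> mg hg; apply: pol_approx_ge0 => //; first by move=> x _; have /andP[] := hg x.
  apply: le_integrable fi => //.
    by apply/measurable_EFinP; exact: measurable_funX.
  move=> x Sx /=; rewrite lee_fin !ger0_norm ?sqr_ge0//.
  have /andP[g0 gf] := hg x.
  by rewrite -[leRHS]real_normK ?num_real// lerXn2r ?nnegrE.
have m1 : measurable_fun S (fun x => Num.max (f x) 0) by exact: measurable_maxr.
have m2 : measurable_fun S (fun x => Num.max (- f x) 0).
  by apply: measurable_maxr => //; exact: measurable_funN.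
have -> : f = fun x => Num.max (f x) 0 + (-1) * Num.max (- f x) 0.
  apply/funext => x; rewrite mulN1r; case: (leP 0 (f x)) => fx.
    by rewrite max_r ?oppr_le0// subr0.
  by rewrite max_l ?opprK ?add0r// oppr_ge0 ltW.
apply: pol_approxD => //; first exact: measurable_funM.
  by apply: P => // x; rewrite le_max lexx orbT ge_max ler_norm normr_ge0.
apply: pol_approxZ => //; apply: P => // x.
by rewrite le_max lexx orbT ge_max -normrN ler_norm normr_ge0.
Qed.

End L2Closure.

Section ComplexL2.
Variables (R : realType) (d : nat).
Hypothesis d_gt0 : (0 < d)%N.
Local Notation S := (@unit_sphere R d).
Local Notation sg := (@surface_measure R d).
Implicit Types F G : 'rV[R]_d -> R[i].

Let mS : measurable S := @measurable_unit_sphere R d.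

Definition L2 F : Prop := cmeas F /\ sg.-integrable S (EFin \o (fun x => sqc (F x))).

Lemma sphere_L2P F : sphere_L2 F <-> L2 F.
Proof.
split=> [[m1 m2 h]|[[m1 m2] /integrableP[_ h]]].
  split => //; apply/integrableP; split; first by apply/measurable_EFinP; exact: measurable_sqc.
  by under eq_integral do rewrite /= ger0_norm ?sqc_ge0//.
split => //; move: h; under eq_integral do rewrite /= ger0_norm ?sqc_ge0//.
by [].
Qed.

Lemma L2_le F (g : 'rV[R]_d -> R) : cmeas F -> sg.-integrable S (EFin \o g) ->
  (forall x, S x -> sqc (F x) <= g x) -> L2 F.
Proof.
move=> mF gi h; split => //; apply: le_integrable gi => //.
  by apply/measurable_EFinP; exact: measurable_sqc.
move=> x Sx /=; rewrite lee_fin ger0_norm ?sqc_ge0// (le_trans (h x Sx))//.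
exact: ler_norm.
Qed.

Lemma eq_L2 F G : (forall x, S x -> F x = G x) -> L2 F -> L2 G.
Proof.
move=> FG [mF iF]; split; first exact: eq_cmeas mF.
by apply: eq_integrable iF => // x; rewrite inE => Sx; rewrite /= FG.
Qed.

Lemma L2_bdd F (M : R) : cmeas F -> (forall x, S x -> nc (F x) <= M) -> L2 F.
Proof.
move=> mF h; apply: (L2_le mF (integrable_cst d_gt0 (M ^+ 2))) => x Sx.
rewrite (le_trans (sqc_nc _))// lerXn2r ?nnegrE ?nc_ge0 ?h//.
exact: le_trans (nc_ge0 _) (h x Sx).
Qed.

Lemma L2_peval p : L2 (@peval R d p).
Proof. have [M hM] := peval_bdd p; exact: L2_bdd (cmeas_peval p) hM. Qed.

Lemma L2D F G : L2 F -> L2 G -> L2 (fun x => F x + G x).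
Proof.
move=> [mF iF] [mG iG].
apply: (@L2_le _ (fun x => 2 * sqc (F x) + 2 * sqc (G x))); first exact: cmeasD.
  have := integrableD mS (integrableZl mS 2 iF) (integrableZl mS 2 iG).
  by apply: eq_integrable.
by move=> x _; exact: sqcD.
Qed.

Lemma L2Z c F : L2 F -> L2 (fun x => c * F x).
Proof.
move=> [mF iF]; apply: (@L2_le _ (fun x => sqc c * sqc (F x))).
- by apply: cmeasM => //; exact: cmeas_cst.
- by have := integrableZl mS (sqc c) iF; apply: eq_integrable.
- by move=> x _; rewrite sqcM.
Qed.

Lemma L2N F : L2 F -> L2 (fun x => - F x).
Proof. by move=> LF; have := L2Z (-1) LF; apply: eq_L2 => x _; rewrite mulN1r. Qed.

Lemma L2B F G : L2 F -> L2 G -> L2 (fun x => F x - G x).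
Proof. by move=> LF LG; apply: L2D => //; exact: L2N. Qed.

Lemma L2J F : L2 F -> L2 (fun x => (F x)^*%C).
Proof.
move=> [mF iF]; apply: (L2_le (cmeasJ mF) iF) => x _.
by rewrite /sqc cReJ cImJ sqrrN.
Qed.

Lemma L2M F G : L2 F -> L2 G -> cint (fun x => F x * G x).
Proof.
move=> [mF iF] [mG iG]; apply: (@cint_le _ _ _ (fun x => sqc (F x) + sqc (G x))).
- exact: cmeasM.
- by have := integrableD mS iF iG; apply: eq_integrable.
- by move=> x _; exact: nc_mul_sqc.
Qed.

Lemma L2_cint F : L2 F -> cint F.
Proof.
move=> LF; have L1 : L2 (fun _ : 'rV[R]_d => 1 : R[i]).
  by apply: (@L2_bdd _ (nc 1)); first exact: cmeas_cst.
by have := L2M LF L1; under eq_fun do rewrite mulr1.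
Qed.

Definition n2 F : R := \int[sg]_(x in S) sqc (F x).

Lemma n2_ge0 F : 0 <= n2 F. Proof. by apply: Rintegral_ge0 => x _; exact: sqc_ge0. Qed.

Lemma n2_dot F : n2 F = complex.Re (sphere_dot F F).
Proof. by apply: eq_Rintegral => x _; rewrite mulJ_sqc. Qed.

Lemma L2_pol_dense F (e : R) : L2 F -> 0 < e -> exists p, n2 (fun x => F x - peval p x) < e.
Proof.
move=> [[m1 m2] iF] e0; have e2 : 0 < e / 2 by rewrite divr_gt0.
have i1 : sg.-integrable S (EFin \o (fun x => complex.Re (F x) ^+ 2)).
  apply: le_integrable iF => //; first by apply/measurable_EFinP; exact: measurable_funX.
  by move=> x _ /=; rewrite lee_fin !ger0_norm ?sqc_ge0 ?sqr_ge0// lerDl sqr_ge0.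
have i2 : sg.-integrable S (EFin \o (fun x => complex.Im (F x) ^+ 2)).
  apply: le_integrable iF => //; first by apply/measurable_EFinP; exact: measurable_funX.
  by move=> x _ /=; rewrite lee_fin !ger0_norm ?sqc_ge0 ?sqr_ge0// lerDr sqr_ge0.
have [q1 pq1 d1] := pol_approx_L2 d_gt0 m1 i1 e2.
have [q2 pq2 d2] := pol_approx_L2 d_gt0 m2 i2 e2.
have mq1 := measurable_pol pq1; have mq2 := measurable_pol pq2.
have [p1 hp1] := pq1; have [p2 hp2] := pq2.
exists (p1 + 'i%C *: p2).
rewrite /n2 /Rintegral (eq_integral (fun x => ((complex.Re (F x) - q1 x) ^+ 2)%:E +
    ((complex.Im (F x) - q2 x) ^+ 2)%:E)%E); last first.
  move=> x; rewrite inE => Sx; rewrite pevalD pevalZ -hp1// -hp2// -EFinD; congr EFin.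
  by rewrite /sqc cReD cImD cReN cImN cReD cImD cReM cImM /=; ring.
rewrite ge0_integralD//; try by move=> x _; rewrite lee_fin sqr_ge0.
- rewrite -/(dist2 _ _) -/(dist2 _ _) -lte_fin fineK; last first.
    rewrite ge0_fin_numE; first by rewrite lte_add_pinfty// (lt_trans _ (ltry (e / 2))).
    by rewrite adde_ge0//; apply: integral_ge0 => x _; rewrite lee_fin sqr_ge0.
  by rewrite (splitr e) EFinD lteD.
- exact: measurable_sqrB.
- exact: measurable_sqrB.
Qed.

End ComplexL2.

(** * Uniqueness of the density *)

Section ExpiTaylor.
Variable R : realType.
Implicit Types s t : R.

Lemma expiD s t : expi (s + t) = expi s * expi t.
Proof. by apply: complex_eqP; rewrite ?cReM ?cImM /= ?cosD ?sinD; ring. Qed.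

(** The terms from order 2 on are compared one by one with those of s^2 e^|s|, using j! <=
    (j+2)!. *)
Lemma expi_taylor s : nc (expi s - (1 + 'i%C * s%:C%C)) <= s ^+ 2 * expR `|s|.
Proof.
set z := 1 + _.
have c n : nc (expi_sum s n.+2 - z) <= s ^+ 2 * expR `|s|.
  have -> : expi_sum s n.+2 - z = \sum_(0 <= j < n) expi_coeff s j.+2.
    rewrite /expi_sum big_nat_recl// big_nat_recl// addrA.
    have -> : expi_coeff s 0 + expi_coeff s 1 = z.
      by rewrite /z (expi_coeffE s 0) (expi_coeffE s 1) expr0 expr1 !divr1.
    by rewrite addrAC subrr add0r.
  apply: (@le_trans _ _ (s ^+ 2 * series (exp_coeff `|s|) n)); last first.
    by rewrite ler_wpM2l ?sqr_ge0// series_exp_le.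
  rewrite /series /=; elim: n => [|n IH]; first by rewrite !big_geq// nc0 mulr0.
  rewrite !big_nat_recr//= (le_trans (ncD _ _))// mulrDr lerD// nc_expi_coeff /exp_coeff /=.
  rewrite -(real_normK (num_real s)) mulrA -exprD add2n ler_wpM2l ?exprn_ge0//.
  rewrite lef_pV2 ?posrE ?ltr0n ?fact_gt0// ler_nat !factS.
  by rewrite mulnA leq_pmull// muln_gt0.
have cR : complex.Re (expi_sum s n.+2 - z) @[n --> \oo] --> complex.Re (expi s - z).
  under eq_fun do rewrite cReD; rewrite cReD; apply: cvgD; last exact: cvg_cst.
  by have := @cvg_Re_expi_sum R s; rewrite -(cvg_shiftn 2) /=; under eq_fun do rewrite addn2.
have cI : complex.Im (expi_sum s n.+2 - z) @[n --> \oo] --> complex.Im (expi s - z).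
  under eq_fun do rewrite cImD; rewrite cImD; apply: cvgD; last exact: cvg_cst.
  by have := @cvg_Im_expi_sum R s; rewrite -(cvg_shiftn 2) /=; under eq_fun do rewrite addn2.
have cN : nc (expi_sum s n.+2 - z) @[n --> \oo] --> nc (expi s - z).
  by apply: cvgD; apply: cvg_norm.
rewrite -(cvg_lim _ cN)//; apply: limr_le; first by apply/cvg_ex; exists (nc (expi s - z)).
exact: nearW.
Qed.

End ExpiTaylor.

Section DensityUnique.
Variables (R : realType) (d : nat).
Hypothesis d_gt0 : (0 < d)%N.
Local Notation S := (@unit_sphere R d).
Local Notation sg := (@surface_measure R d).
Implicit Types F G H : 'rV[R]_d -> R[i].

Let mS : measurable S := @measurable_unit_sphere R d.

Lemma nc_sphere_int F : cint F -> nc (sphere_int F) <= \int[sg]_(x in S) nc (F x).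
Proof.
move=> iF; have [i1 i2] := iF; rewrite /nc /= RintegralD//; try exact: integrable_norm.
by apply: lerD; exact: le_normr_Rintegral.
Qed.

(* The integral of [F (expi (k t x_i) - 1)] is zero; divide by [i k t] and let [t] tend
   to [0]. *)
Lemma sphere_int_mul_coord F (k : R) (i : 'I_d) : cint F -> 0 < k ->
  (forall t : R, sphere_int (fun x => F x * expi (k * (t * x ord0 i))) = 0) ->
  sphere_int (fun x => F x * (x ord0 i)%:C%C) = 0.
Proof.
move=> iF k0 h0.
pose I := \int[sg]_(x in S) nc (F x).
have I0 : 0 <= I by apply: Rintegral_ge0 => x _; exact: nc_ge0.
set L := sphere_int _.
have mc : cmeas (fun x : 'rV[R]_d => (x ord0 i)%:C%C).
  by apply: cmeas_real; apply: measurable_funTS; exact: (measurable_rV_coord i).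
have ic : cint (fun x => F x * (x ord0 i)%:C%C).
  by apply: (cintM_bdd (M := 1)) => // x Sx; rewrite nc_real unit_sphere_coord.
have me t : cmeas (fun x : 'rV[R]_d => expi (k * (t * x ord0 i))).
  have m : measurable_fun S (fun x : 'rV[R]_d => k * (t * x ord0 i)).
    apply: measurable_funTS; apply: measurable_funM => //; apply: measurable_funM => //.
    exact: (measurable_rV_coord i).
  by split; [exact: measurableT_comp (@continuous_measurable_cos R) m|
    exact: measurableT_comp (@continuous_measurable_sin R) m].
have ie t : cint (fun x => F x * expi (k * (t * x ord0 i))).
  by apply: (cintM_bdd (M := 2)) => // x Sx; exact: nc_expi.
have bound (t : R) : 0 < t <= 1 -> nc L <= k * t * expR k * I.
  move=> /andP[t0 t1]; have kt : 0 < k * t by exact: mulr_gt0.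
  pose D (x : 'rV[R]_d) : R[i] :=
    expi (k * (t * x ord0 i)) - (1 + 'i%C * (k * (t * x ord0 i))%:C%C).
  have mD : cmeas D.
    apply: cmeasD => //; apply: cmeasN; apply: cmeasD; first exact: cmeas_cst.
    apply: cmeasM; first exact: cmeas_cst.
    apply: cmeas_real; apply: measurable_funTS; apply: measurable_funM => //.
    by apply: measurable_funM => //; exact: (measurable_rV_coord i).
  have bD x : S x -> nc (D x) <= (k * t) ^+ 2 * expR k.
    move=> Sx; apply: (le_trans (expi_taylor _)).
    have xi : `|k * (t * x ord0 i)| <= k * t.
      by rewrite !normrM (gtr0_norm k0) (gtr0_norm t0) mulrA ler_piMr ?(ltW kt)// unit_sphere_coord.
    apply: ler_pM; rewrite ?sqr_ge0 ?expR_ge0//.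
      by rewrite -[leLHS]real_normK ?num_real// lerXn2r// nnegrE ltW.
    by rewrite ler_expR (le_trans xi)// ler_piMr// ltW.
  have iD : cint (fun x => F x * D x) by exact: (cintM_bdd iF mD bD).
  (* [F] integrates to zero against the exponential, and by itself (the case [t = 0]), so only the
     linear term of [D] remains; it is of order [t], whereas [D] is of order [t^2]. *)
  have E : sphere_int (fun x => F x * D x) = - ('i%C * (k * t)%:C%C) * L.
    have e0 : sphere_int F = 0.
      rewrite -(h0 0); apply: eq_sphere_int => x _.
      by rewrite mul0r mulr0 expi0 mulr1.
    transitivity (sphere_int (fun x => (F x * expi (k * (t * x ord0 i)) + (-1) * F x) +
        (- ('i%C * (k * t)%:C%C)) * (F x * (x ord0 i)%:C%C))).
      apply: eq_sphere_int => x _; rewrite /D.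
      have -> : (k * (t * x ord0 i))%:C%C = (k * t)%:C%C * (x ord0 i)%:C%C :> R[i].
        by rewrite mulrA; exact: rmorphM.
      by move: (expi _) (_%:C%C) (_%:C%C) => a b c; ring.
    rewrite sphere_intD//; [|apply: cintD => //; exact: cintZ|exact: cintZ].
    rewrite sphere_intD//; last exact: cintZ.
    by rewrite h0 !sphere_intZ// e0 mulr0 add0r add0r.
  have ncE : nc (- ('i%C * (k * t)%:C%C) * L) = k * t * nc L.
    rewrite /nc !cReM !cImM !cReN !cImN !cReM !cImM /=.
    rewrite !(mul0r, mulr0, mul1r, subr0, sub0r, addr0, add0r, oppr0, oppr0) .
    rewrite !normrM !normrN !normrM (gtr0_norm k0) (gtr0_norm t0).
    by rewrite normrN normrM (gtr0_norm k0) (gtr0_norm t0); ring.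
  have : k * t * nc L <= (k * t) * (k * t * expR k * I).
    rewrite -ncE -E (le_trans (nc_sphere_int iD))//.
    rewrite [leRHS](_ : _ = \int[sg]_(x in S) ((k * t) ^+ 2 * expR k * nc (F x))); last first.
      by rewrite RintegralZl//; [rewrite -/I; ring|exact: cint_nc].
    apply: le_Rintegral => //.
    - exact: cint_nc.
    - by have := integrableZl mS ((k * t) ^+ 2 * expR k) (cint_nc iF); apply: eq_integrable.
    - move=> x Sx; rewrite (le_trans (ncM _ _))// mulrC ler_wpM2r ?nc_ge0// bD//.
  by rewrite ler_pM2l.
have nL : nc L <= 0.
  apply/ler_addgt0Pl => e e0; rewrite addr0.
  (* The summand 1 keeps [C] positive when [I = 0]. *)
  pose C := k * expR k * I + 1.
  have C0 : 0 < C by rewrite ltr_wpDl// !mulr_ge0 ?expR_ge0// ltW.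
  pose t := Num.min 1 (e / C).
  have t01 : 0 < t <= 1 by rewrite lt_min ltr01 divr_gt0//= ge_min lexx.
  rewrite (le_trans (bound t t01))//.
  have tC : t * C <= e by rewrite -ler_pdivlMr// ge_min lexx orbT.
  have /andP[t0 _] := t01.
  by rewrite (le_trans _ tC)// /C; nra.
have : nc L == 0 by rewrite eq_le nL nc_ge0.
rewrite /nc paddr_eq0// !normr_eq0 => /andP[/eqP a /eqP b].
exact: complex_eqP.
Qed.

Section Orth.
Variables (k : R) (F : 'rV[R]_d -> R[i]).
Hypotheses (k0 : 0 < k) (iF : cint F).
Hypothesis F0 : forall r, sphere_int (fun x => F x * expi (k * edot x r)) = 0.

(** Orthogonality of [F h] to every plane wave, and not only to 1, is the invariant that survives
    multiplication by a further coordinate; the bound on [h] keeps [F h] integrable. *)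
Let V (h : 'rV[R]_d -> R) := [/\ measurable_fun setT h, forall x, S x -> `|h x| <= 1 &
  forall r, sphere_int (fun x => F x * (h x)%:C%C * expi (k * edot x r)) = 0].

Let edotDr (x r s : 'rV[R]_d) : edot x (r + s) = edot x r + edot x s.
Proof. by rewrite /edot -big_split; apply: eq_bigr => i _; rewrite mxE mulrDr. Qed.

Let edot_delta (x : 'rV[R]_d) i : edot x (delta_mx ord0 i) = x ord0 i.
Proof.
rewrite /edot (bigD1 i)//= big1 => [|j ji]; rewrite mxE ?eqxx ?mulr1 ?addr0//.
by rewrite (negbTE ji) andbF mulr0.
Qed.

Let V_coord h i : V h -> V (fun x => h x * x ord0 i).
Proof.
move=> [mh hb h0]; split.
- by apply: measurable_funM => //; exact: (measurable_rV_coord i).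
- by move=> x Sx; rewrite normrM mulr_ile1 ?hb ?unit_sphere_coord.
move=> r; pose G (x : 'rV[R]_d) : R[i] := F x * (h x)%:C%C * expi (k * edot x r).
have iG : cint G.
  apply: (cintM_bdd (M := 2)); last 2 first.
  - exact: cmeas_expi.
  - by move=> x _; exact: nc_expi.
  apply: (cintM_bdd (M := 1)) => //; first by apply: cmeas_real; exact: measurable_funTS.
  by move=> x Sx; rewrite nc_real hb.
rewrite -[RHS](sphere_int_mul_coord (i := i) iG k0).
  apply: eq_sphere_int => x _; rewrite /G.
  have -> : (h x * x ord0 i)%:C%C = (h x)%:C%C * (x ord0 i)%:C%C :> R[i] by exact: rmorphM.
  by move: (_%:C%C) (_%:C%C) => a b; ring.
(* A plane wave times e^(i k t x_i) is the plane wave at the shifted point [r + t e_i]. *)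
move=> t; rewrite -[RHS](h0 (r + t *: delta_mx ord0 i)); apply: eq_sphere_int => x _.
by rewrite /G edotDr edotZr edot_delta (mulrDr k) expiD [RHS]mulrA.
Qed.

Let V1 : V (fun=> 1).
Proof.
split; [exact: measurable_cst|by move=> x _; rewrite normr1|move=> r].
by rewrite -[RHS](F0 r); apply: eq_sphere_int => x _; rewrite mulr1.
Qed.

Let V_mon (m : multinom d) : V (fun x => rV_mon m x).
Proof.
suff P (s : seq 'I_d) : V (fun x : 'rV[R]_d => \prod_(i <- s) x ord0 i ^+ m i) by exact: P.
elim: s => [|i s IH].
  by rewrite (_ : (fun x => _) = (fun=> 1)); [exact: V1|apply/funext => x; rewrite big_nil].
rewrite (_ : (fun x => _) = fun x : 'rV[R]_d =>
    (\prod_(j <- s) x ord0 j ^+ m j) * x ord0 i ^+ m i); last first.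
  by apply/funext => x; rewrite big_cons mulrC.
elim: (m i) => [|n IHn]; first by under eq_fun do rewrite expr0 mulr1.
by under eq_fun do rewrite exprSr mulrA; exact: V_coord.
Qed.

Lemma sphere_int_mul_peval (p : mpoly d R[i]) : sphere_int (fun x => F x * peval p x) = 0.
Proof.
have im (m : multinom d) : cint (fun x => F x * (rV_mon m x)%:C%C).
  apply: (cintM_bdd (M := 1)) => //.
    by apply: cmeas_real; apply: measurable_funTS; exact: measurable_rV_mon.
  by move=> x Sx; rewrite nc_real rV_mon_le1.
transitivity (sphere_int (fun x =>
    \sum_(m <- msupp p) mcoeff m p * (F x * (rV_mon m x)%:C%C))).
  by apply: eq_sphere_int => x _; rewrite pevalE mulr_sumr; apply: eq_bigr => m _; rewrite mulrCA.
rewrite (sphere_int_sum d_gt0) => [|m]; last exact: cintZ.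
rewrite big1 // => m _; rewrite sphere_intZ//.
have [_ _ /(_ 0) h] := V_mon m.
rewrite [X in _ * X](_ : _ = 0) ?mulr0// -[RHS]h; apply: eq_sphere_int => x _.
rewrite /edot big1 ?mulr0 ?expi0 ?mulr1// => i _.
by rewrite mxE mulr0.
Qed.

End Orth.

Lemma n2B F G : L2 F -> L2 G ->
  n2 (fun x => F x - G x) = n2 F + n2 G - 2 * complex.Re (sphere_dot F G).
Proof.
move=> LF LG; have [_ iF] := LF; have [_ iG] := LG.
have [i1 _] := L2M LF (L2J LG).
rewrite /n2 /sphere_dot /= -RintegralZl// -RintegralD// -RintegralB//.
- apply: eq_Rintegral => x _.
  by rewrite /sqc cReD cImD cReN cImN cReM cReJ cImJ; ring.
- by have := integrableD mS iF iG; apply: eq_integrable.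
- by have := integrableZl mS 2 i1; apply: eq_integrable.
Qed.

Lemma n2Z c F : L2 F -> n2 (fun x => c * F x) = sqc c * n2 F.
Proof.
move=> [_ iF]; rewrite /n2 -RintegralZl//.
by apply: eq_Rintegral => x _; rewrite sqcM.
Qed.

Lemma eq_n2 F G : (forall x, S x -> F x = G x) -> n2 F = n2 G.
Proof. by move=> FG; apply: eq_Rintegral => x; rewrite inE => Sx; rewrite FG. Qed.

Lemma sphere_dotZl c F G : L2 F -> L2 G ->
  sphere_dot (fun x => c * F x) G = c * sphere_dot F G.
Proof.
move=> LF LG; rewrite /sphere_dot -sphere_intZ//; last exact: L2M LF (L2J LG).
by apply: eq_sphere_int => x _; rewrite mulrA.
Qed.

Lemma sphere_dotDl F G H : L2 F -> L2 G -> L2 H ->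
  sphere_dot (fun x => F x + G x) H = sphere_dot F H + sphere_dot G H.
Proof.
move=> LF LG LH; rewrite /sphere_dot -sphere_intD; [|exact: L2M LF (L2J LH)|exact: L2M LG (L2J LH)].
by apply: eq_sphere_int => x _; rewrite mulrDl.
Qed.

Lemma sphere_dotC F G : L2 F -> L2 G -> sphere_dot F G = (sphere_dot G F)^*%C.
Proof.
move=> LF LG; have [_ i2] := L2M LG (L2J LF).
apply: complex_eqP; rewrite ?cReJ ?cImJ /=.
  by apply: eq_Rintegral => x _; rewrite !cReM !cReJ !cImJ; ring.
rewrite -mulN1r -RintegralZl//.
by apply: eq_Rintegral => x _; rewrite !cImM !cReJ !cImJ; ring.
Qed.

Lemma eq_sphere_dot F G F' G' : (forall x, S x -> F x = F' x) ->
  (forall x, S x -> G x = G' x) -> sphere_dot F G = sphere_dot F' G'.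
Proof. by move=> FF GG; apply: eq_sphere_int => x Sx; rewrite FF// GG. Qed.

(* [0 <= n2 (t H - G)] for all real [t] forces [Re <H, G> = 0]. *)
Lemma n2_eq0_dot H G : L2 H -> L2 G -> n2 H = 0 -> sphere_dot H G = 0.
Proof.
move=> LH LG H0.
have P (K : 'rV[R]_d -> R[i]) : L2 K -> n2 K = 0 -> complex.Re (sphere_dot K G) = 0.
  move=> LK K0; set b := complex.Re _.
  have h (t : R) : 0 <= n2 G - 2 * (t * b).
    have := n2_ge0 (fun x => t%:C%C * K x - G x).
    rewrite n2B//; last exact: L2Z.
    by rewrite n2Z// K0 mulr0 add0r sphere_dotZl// cReM/= mul0r subr0.
  (* At this [t] the inequality [h] reads 0 <= - n2 G - 2. *)
  have := n2_ge0 G; have h1 := h ((n2 G + 1) / b).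
  have [//|b0] := eqVneq b 0; move: h1; rewrite divfK// => h1 g0; exfalso; lra.
apply: complex_eqP; first exact: P.
(* The real part of <-iH, G> is the imaginary part of <H, G>. *)
have := P (fun x => (- 'i%C) * H x); rewrite n2Z// H0 mulr0 => /(_ (L2Z _ LH) erefl).
by rewrite sphere_dotZl// cReM/= oppr0 mul0r sub0r mulN1r opprK.
Qed.

(** The inner product depends only on classes modulo functions of zero norm, hence not on the
    densities selected by [density_of]. *)
Lemma n2_dot_eq F F' G G' : L2 F -> L2 F' -> L2 G -> L2 G' ->
  n2 (fun x => F x - F' x) = 0 -> n2 (fun x => G x - G' x) = 0 ->
  sphere_dot F G = sphere_dot F' G'.
Proof.
have P (A A' B : 'rV[R]_d -> R[i]) : L2 A -> L2 A' -> L2 B -> n2 (fun x => A x - A' x) = 0 ->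
    sphere_dot A B = sphere_dot A' B.
  move=> LA LA' LB h.
  rewrite (@eq_sphere_dot A B (fun x => (A x - A' x) + A' x) B)//; last first.
    by move=> x _; rewrite subrK.
  rewrite sphere_dotDl//; last exact: L2B.
  by rewrite n2_eq0_dot ?add0r//; exact: L2B.
move=> LF LF' LG LG' h1 h2; rewrite (P _ _ _ LF LF' LG h1).
by rewrite sphere_dotC// (P _ _ _ LG LG' LF' h2) -sphere_dotC.
Qed.

(** [F] is orthogonal to every polynomial [p], so Pythagoras gives n2 F <= n2 (F - p), and the right
    side can be made arbitrarily small. *)
Lemma density_unique (k : R) F : 0 < k -> L2 F ->
  (forall r, sphere_int (fun x => F x * expi (k * edot x r)) = 0) -> n2 F = 0.
Proof.
move=> k0 LF F0; apply/eqP; rewrite eq_le n2_ge0 andbT.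
apply/ler_addgt0Pl => e e0; rewrite addr0.
have [p hp] := L2_pol_dense d_gt0 LF e0.
apply: (le_trans _ (ltW hp)); rewrite n2B//; last exact: L2_peval.
have -> : sphere_dot F (peval p) = 0.
  (* The vanishing integrals carry no conjugation, so the polynomial is conjugated instead. *)
  rewrite -(sphere_int_mul_peval k0 (L2_cint d_gt0 LF) F0 (conjp p)).
  by apply: eq_sphere_int => x _; rewrite peval_conjp.
by rewrite /= mulr0 subr0 lerDl n2_ge0.
Qed.

End DensityUnique.

(** * The orthonormal basis *)

Section Assembly.
Variables (R : realType) (d : nat).
Hypothesis d_gt0 : (0 < d)%N.
Variable k : R.
Hypothesis k_gt0 : 0 < k.
Local Notation S := (@unit_sphere R d).
Implicit Types (f g F G : 'rV[R]_d -> R[i]) (p : mpoly d R[i]).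

(** The density is transported to the unit sphere, which removes the dilation by [k] of
    [sbl_density]. *)
Definition has_density f F :=
  L2 F /\ forall r, f r = sphere_int (fun x => F x * expi (k * edot x r)).

Let scaleK (x : 'rV[R]_d) : k^-1 *: (k *: x) = x.
Proof. by rewrite scalerA mulVf ?scale1r// gt_eqF. Qed.

Lemma sbl_density_has f F : sbl_density k f F -> has_density f (fun x => F (k *: x)).
Proof. by move=> [/sphere_L2P LF fF]. Qed.

Lemma has_density_sbl f F : has_density f F -> sbl_density k f (fun y => F (k^-1 *: y)).
Proof.
move=> [LF fF]; split; last by move=> r; under eq_fun do rewrite scaleK.
by apply/sphere_L2P; under eq_fun do rewrite scaleK.
Qed.

Lemma has_density_space f F : has_density f F -> sbl_space k f.
Proof. by move=> /has_density_sbl h; exists (fun y => F (k^-1 *: y)). Qed.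

Lemma has_density_of f F : has_density f F ->
  has_density f (fun x => density_of k f (k *: x)).
Proof. by move=> /has_density_sbl h; apply: sbl_density_has; exact: (xgetI (fun=> 0) h). Qed.

Let cint_expi F r : L2 F -> cint (fun x => F x * expi (k * edot x r)).
Proof.
move=> LF; apply: (cintM_bdd (M := 2)); first exact: L2_cint.
  exact: cmeas_expi.
by move=> x _; exact: nc_expi.
Qed.

Lemma has_densityD f g F G : has_density f F -> has_density g G ->
  has_density (fun r => f r + g r) (fun x => F x + G x).
Proof.
move=> [LF fF] [LG gG]; split=> [|r]; first exact: L2D.
rewrite fF gG -sphere_intD; try exact: cint_expi.
by apply: eq_sphere_int => x _; rewrite mulrDl.
Qed.

Lemma has_densityZ c f F : has_density f F ->
  has_density (fun r => c * f r) (fun x => c * F x).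
Proof.
move=> [LF fF]; split=> [|r]; first exact: L2Z.
rewrite fF -sphere_intZ; last exact: cint_expi.
by apply: eq_sphere_int => x _; rewrite mulrA.
Qed.

Lemma has_densityB f g F G : has_density f F -> has_density g G ->
  has_density (fun r => f r - g r) (fun x => F x - G x).
Proof.
move=> fF gG; have := has_densityD fF (has_densityZ (-1) gG).
by under eq_fun do rewrite mulN1r; under [X in has_density _ X]eq_fun do rewrite mulN1r.
Qed.

Lemma has_density0 : has_density (fun=> 0) (fun=> 0).
Proof.
split=> [|r]; first by apply: eq_L2 (L2Z 0 (L2_peval d_gt0 0)) => x _; rewrite mul0r.
by rewrite -[LHS](sphere_int0 R d); apply: eq_sphere_int => x _; rewrite mul0r.
Qed.

Lemma has_density_sum (I : Type) (s : seq I) (f F : I -> 'rV[R]_d -> R[i]) :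
  (forall i, has_density (f i) (F i)) ->
  has_density (fun r => \sum_(i <- s) f i r) (fun x => \sum_(i <- s) F i x).
Proof.
move=> fF; elim: s => [|i s IH].
  under eq_fun do rewrite big_nil; under [X in has_density _ X]eq_fun do rewrite big_nil.
  exact: has_density0.
under eq_fun do rewrite big_cons; under [X in has_density _ X]eq_fun do rewrite big_cons.
exact: has_densityD.
Qed.

Lemma has_density_unique f F G : has_density f F -> has_density f G ->
  n2 (fun x => F x - G x) = 0.
Proof.
move=> fF fG; have [LD D0] := has_densityB fF fG.
by apply: (density_unique d_gt0 k_gt0 LD) => r; rewrite -D0 subrr.
Qed.

(** Any density computes the inner product: the selected one differs from it by a function of zero
    norm. *)
Lemma sbl_dotE f g F G : has_density f F -> has_density g G ->
  sbl_dot k f g = sphere_dot F G.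
Proof.
move=> fF gG; have dF := has_density_of fF; have dG := has_density_of gG.
apply: n2_dot_eq; [exact: dF.1|exact: fF.1|exact: dG.1|exact: gG.1| | ].
  exact: has_density_unique fF.
exact: has_density_unique gG.
Qed.

Lemma sbl_normE f F : has_density f F -> sbl_norm k f = Num.sqrt (n2 F).
Proof. by move=> fF; rewrite /sbl_norm (sbl_dotE fF fF) n2_dot. Qed.

Lemma spherical_harmonicP n (Y : 'rV[R]_d -> R[i]) : spherical_harmonic n Y <->
  exists p, [/\ hom n p, lap p = 0 & forall x, S x -> Y x = peval p x].
Proof. by split=> -[p [? ? ?]]; exists p. Qed.

Lemma psi_fun_density n (Y : 'rV[R]_d -> R[i]) : spherical_harmonic n Y ->
  has_density (psi_fun k n Y) (fun x => (- 'i%C) ^+ n * Y x).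
Proof.
move=> /spherical_harmonicP[p [hp lp Yp]]; split=> [|r]; last exact: psi_fun_int Yp k_gt0.
apply: L2Z; apply: (@eq_L2 _ _ (peval p)); last exact: L2_peval.
by move=> x Sx; rewrite Yp.
Qed.

(** * Orthonormality and completeness of the family *)

Section Basis.
Variables (N : nat -> nat) (Y : forall n : nat, 'I_(N n) -> 'rV[R]_d -> R[i]).
Hypothesis Y_basis : forall n : nat, harmonic_orthonormal_basis n (@Y n).
Local Notation I := {n : nat & 'I_(N n)}.
Let Yi (i : I) : 'rV[R]_d -> R[i] := Y (tagged i).
Let psi (i : I) := psi_fun k (tag i) (Yi i).

Let Y_harm n m : spherical_harmonic n (Y (n := n) m).
Proof. by have [] := Y_basis n. Qed.

Let psi_density i : has_density (psi i) (fun x => (- 'i%C) ^+ tag i * Yi i x).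
Proof. exact: (psi_fun_density (Y_harm (tagged i))). Qed.

Let imK n : (- 'i%C : R[i]) ^+ n * 'i%C ^+ n = 1.
Proof. by rewrite -exprMn mulNr -expr2 sqr_i opprK expr1n. Qed.

Let conj_im n : (((- 'i%C : R[i]) ^+ n)^*)%C = 'i%C ^+ n.
Proof.
rewrite [LHS]rmorphXn; congr (_ ^+ n).
by apply: complex_eqP; rewrite ?cReJ ?cImJ ?cReN ?cImN /= ?opprK ?oppr0.
Qed.

Lemma sphere_dot_Y (i j : I) : sphere_dot (Yi i) (Yi j) = (i == j)%:R.
Proof.
case: i j => [n m] [n' m']; rewrite /Yi /=.
have [e|ne] := eqVneq n n'.
  case: n' / e m' => m'; have [_ _ _ ->] := Y_basis n.
  by rewrite eq_Tagged.
have /spherical_harmonicP[p [hp lp pE]] := Y_harm m.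
have /spherical_harmonicP[q [hq lq qE]] := Y_harm m'.
rewrite -tag_eqE /tag_eq /= (negbTE ne) /= -[RHS](sphere_orth d_gt0 hp hq lp lq ne).
by apply: eq_sphere_int => x Sx; rewrite pE// qE.
Qed.

(** The phases contribute (-i)^n i^n' for degrees [n] and [n']; this is 1 on the diagonal, and
    elsewhere the inner product of the harmonics is already 0. *)
Lemma sbl_dot_psi (i j : I) : sbl_dot k (psi i) (psi j) = (i == j)%:R.
Proof.
rewrite (sbl_dotE (psi_density i) (psi_density j)).
have LY i' : L2 (Yi i').
  have /spherical_harmonicP[p [hp lp pE]] := Y_harm (tagged i').
  by apply: (@eq_L2 _ _ (peval p)); [move=> x Sx; rewrite -pE|exact: L2_peval].
transitivity ((- 'i%C) ^+ tag i * 'i%C ^+ tag j * sphere_dot (Yi i) (Yi j)).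
  rewrite /sphere_dot -sphere_intZ; last exact: L2M (LY i) (L2J (LY j)).
  apply: eq_sphere_int => x _; rewrite -conj_im mulrACA; congr (_ * _).
  exact: rmorphM.
rewrite sphere_dot_Y; have [->|_] := eqVneq i j; last by rewrite mulr0.
by rewrite imK mul1r.
Qed.

(** A list of pairs may repeat an index, so sums are mere concatenations; [peval_Y_span] merges the
    repetitions into a coefficient function. *)
Let spanY F := exists l : seq (I * R[i]),
  forall x, S x -> F x = \sum_(a <- l) a.2 * Yi a.1 x.

Let spanYD F G : spanY F -> spanY G -> spanY (fun x => F x + G x).
Proof.
by move=> [l hl] [l' hl']; exists (l ++ l') => x Sx; rewrite big_cat/= hl// hl'.
Qed.

Let spanYZ c F : spanY F -> spanY (fun x => c * F x).
Proof.
move=> [l hl]; exists [seq (a.1, c * a.2) | a <- l] => x Sx.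
by rewrite big_map hl// mulr_sumr; apply: eq_bigr => a _; rewrite mulrA.
Qed.

Let spanY_harm n F : spherical_harmonic n F -> spanY F.
Proof.
have [_ _ span _] := Y_basis n.
move=> /span[c hc]; exists [seq (Tagged (fun n => 'I_(N n)) m, c m) | m <- enum 'I_(N n)].
by move=> x Sx; rewrite big_map hc// big_enum.
Qed.

Let spanY_hom n p : hom n p -> spanY (peval p).
Proof.
elim/ltn_ind: n p => -[_ p hp|[_ p hp|n IH p hp]].
- by apply: (@spanY_harm 0); apply/spherical_harmonicP; exists p; rewrite lap_hom0.
- by apply: (@spanY_harm 1); apply/spherical_harmonicP; exists p; rewrite lap_hom1.
have [h [q [hh lh hq ->]]] := harmonic_decomp d_gt0 hp.
have hH : spanY (peval h) by apply: (@spanY_harm n.+2); apply/spherical_harmonicP; exists h.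
have [l hl] := spanYD hH (IH n (ltnW (ltnSn n.+1)) q hq).
by exists l => x Sx; rewrite -hl// pevalD pevalM peval_sqn// mul1r.
Qed.

Lemma peval_spanY p : spanY (peval p).
Proof.
rewrite [p]mpolyE; elim: (msupp p) => [|m s IH].
  by exists [::] => x Sx; rewrite !big_nil /peval meval0.
have hm : hom (mdeg m) (mpolyX _ m : mpoly d R[i]) by rewrite /hom dhomogX.
have [l hl] := spanYD (spanYZ (mcoeff m p) (spanY_hom hm)) IH.
by exists l => x Sx; rewrite big_cons pevalD pevalZ hl.
Qed.

Lemma peval_Y_span p : exists (s : seq I) (c : I -> R[i]),
  forall x, S x -> peval p x = \sum_(i <- s) c i * Yi i x.
Proof.
have [l hl] := peval_spanY p.
(* The coefficient of an index collects all its occurrences, and [undup] counts the index once. *)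
exists (undup [seq a.1 | a <- l]), (fun i => \sum_(a <- l | a.1 == i) a.2) => x Sx.
rewrite hl//; under [RHS]eq_bigr do rewrite mulr_suml big_mkcond.
rewrite exchange_big /= big_seq [RHS]big_seq; apply: eq_bigr => a al.
rewrite (bigD1_seq a.1) ?undup_uniq ?mem_undup ?map_f//= eqxx big1 ?addr0//.
by move=> i; rewrite eq_sym => /negbTE->.
Qed.

Lemma sbl_orthonormal_basis_psi : sbl_orthonormal_basis k psi.
Proof.
split=> [i|i j|f [F /sbl_density_has fF] e e0].
- exact: has_density_space (psi_density i).
- exact: sbl_dot_psi.
(* The tolerance is [e^2] because the norm is the square root of [n2]. *)
have [p hp] := L2_pol_dense d_gt0 fF.1 (exprn_gt0 2 e0).
have [s [c hc]] := peval_Y_span p.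
(* The power of [i] undoes the phase (-i)^n in the density of [psi]. *)
exists s, (fun i => c i * 'i%C ^+ tag i).
have psiD := has_density_sum s (fun i => has_densityZ (c i * 'i%C ^+ tag i) (psi_density i)).
rewrite (sbl_normE (has_densityB fF psiD)).
rewrite -[ltRHS]gtr0_norm// -sqrtr_sqr ltr_sqrt ?exprn_gt0//.
rewrite (le_lt_trans _ hp)// le_eqVlt; apply/orP; left; apply/eqP; apply: eq_n2 => x Sx.
rewrite hc//; congr (_ - _); apply: eq_bigr => i _.
by rewrite -mulrA (mulrA ('i%C ^+ _)) (mulrC ('i%C ^+ _)) imK mul1r.
Qed.

End Basis.
End Assembly.

Theorem mainTheorem2 (R : realType) (d : nat) (d_ge1 : (1 <= d)%N)
    (k : R) (k_gt0 : 0 < k)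
    (N : nat -> nat) (Y : forall n : nat, 'I_(N n) -> 'rV[R]_d -> R[i])
    (Y_basis : forall n : nat, harmonic_orthonormal_basis n (Y n)) :
  (forall (n : nat) (m : 'I_(N n)), sbl_space k (psi_fun k n (Y n m))) /\
  sbl_orthonormal_basis k
    (fun nm : {n : nat & 'I_(N n)} =>
       psi_fun k (tag nm) (Y (tag nm) (tagged nm))).
Proof.
split=> [n m|]; last exact: sbl_orthonormal_basis_psi.
have [Y_harm _ _ _] := Y_basis n.
exact: has_density_space (psi_fun_density d_ge1 k_gt0 (Y_harm m)).
Qed.
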